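(* Let $\kappa\in\tfrac12+\mathbb{Z}$, let $N$ be an odd squarefree positive integer, and let $f\in\mathcal{B}'$. Then for all $z=x+iy\in\mathbb{H}$ and every $\varepsilon>0$, \[ y^{\kappa/2}|f(z)|\ll_{\kappa,\varepsilon} N^{\frac12+\varepsilon}\,\|y^{\kappa/2}f\|_{L^2}. \]
   Context: $\mathbb{H}$ is the upper half plane, $d\mu=dx\,dy/y^2$. $S_\kappa(4N,\eta)$ is the space of holomorphic cusp forms of half-integral weight $\kappa$, level $4N$, nebentypus $\eta$ (Dirichlet character mod $4N$) in Shimura's sense: $f(\gamma z)=\eta(d)\,\varepsilon_d^{-2\kappa}\left(\frac cd\right)(cz+d)^\kappa f(z)$ for $\gamma=\begin{pmatrix}a&b\\c&d\end{pmatrix}\in\Gamma_0(4N)$, vanishing at all cusps ($\varepsilon_d=1$ if $d\equiv1\pmod4$, $i$ if $d\equiv3\pmod4$; $\left(\frac cd\right)$ Shimura's extended Kronecker symbol). $\mathcal B$ is the union over all $\eta$ mod $4N$ of bases of $S_\kappa(4N,\eta)$ consisting of simultaneous eigenforms of Shimura's Hecke operators. With $A=\begin{pmatrix}1&0\\2N&1\end{pmatrix}$ and $W(2)$ a fixed integer matrix $\begin{pmatrix}2\alpha&\beta\\2N\gamma&2\delta\end{pmatrix}$ of determinant $2$, $\mathcal B'=\mathcal B\cup\mathcal B|_\kappa[A]\cup\mathcal B|_\kappa[W(2)]\cup\mathcal B|_\kappa[AW(2)]$, where for $M=\begin{pmatrix}a&b\\c&d\end{pmatrix}$ with positive determinant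 $f|_\kappa[M](z)=\phi(z)^{-2\kappa}f(Mz)$ with $\phi$ a choice of square root as in Shimura's metaplectic group (determined up to a unimodular constant), so that $y^{\kappa/2}|f|_\kappa[M](z)|=\mathrm{Im}(Mz)^{\kappa/2}|f(Mz)|$. The norm is $\|y^{\kappa/2}f\|_{L^2}^2=\frac1{\mathcal V}\iint_{\Gamma\backslash\mathbb{H}}y^\kappa|f(z)|^2\,d\mu(z)$, $\mathcal V=\mathrm{Vol}(\Gamma\backslash\mathbb{H})$, with $\Gamma$ a congruence subgroup of $\Gamma_0(2N)$ under which $y^\kappa|f|^2$ is invariant. *)

(* Defs.v *)
From mathcomp Require Import all_boot all_order all_algebra.
From mathcomp Require Import all_classical all_reals all_analysis.
From mathcomp Require Import complex.
From Stdlib Require List.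
Set Implicit Arguments. Unset Strict Implicit. Unset Printing Implicit Defensive.
Import Order.TTheory GRing.Theory Num.Theory.
Local Open Scope ring_scope.

Record mat2 := Mat2 { ma : int; mb : int; mc : int; md : int }.

Definition mdet (M : mat2) : int := ma M * md M - mb M * mc M.
Definition mmul (M M' : mat2) : mat2 :=
  Mat2 (ma M * ma M' + mb M * mc M') (ma M * mb M' + mb M * md M')
       (mc M * ma M' + md M * mc M') (mc M * mb M' + md M * md M').
Definition minv (M : mat2) : mat2 := Mat2 (md M) (- mb M) (- mc M) (ma M).
Definition mid : mat2 := Mat2 1 0 0 1.

Definition SL2Z (M : mat2) : Prop := mdet M = 1.
Definition Gamma0 (q : nat) (M : mat2) : Prop := SL2Z M /\ (q%:Z %| mc M)%Z.
Definition Gamma_princ (q : nat) (M : mat2) : Prop :=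
  [/\ SL2Z M, (q%:Z %| ma M - 1)%Z, (q%:Z %| mb M)%Z, (q%:Z %| mc M)%Z
    & (q%:Z %| md M - 1)%Z].

Definition cong_subgroup_of_Gamma0 (q : nat) (G : mat2 -> Prop) : Prop :=
  [/\ (forall M, G M -> Gamma0 q M),
      G mid,
      (forall M M', G M -> G M' -> G (mmul M M')),
      (forall M, G M -> G (minv M))
    & exists L : nat, (0 < L)%N /\ (forall M, Gamma_princ L M -> G M)].

Definition squarefree (n : nat) : Prop := forall p, prime p -> ~~ (p ^ 2 %| n)%N.

Definition legendre (a : int) (p : nat) : int :=
  if (p%:Z %| a)%Z then 0
  else if has (fun x : nat => (p%:Z %| x%:Z ^+ 2 - a)%Z) (iota 0 p) then 1 else -1.

Definition jacobi (a : int) (n : nat) : int :=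
  \prod_(pe <- prime_decomp n) legendre a pe.1 ^+ pe.2.

(* Shimura's extended Kronecker symbol (c/d), d odd:
   (c/d) = (c/|d|) unless c < 0 and d < 0, in which case (c/d) = -(c/|d|);
   in particular (0/1) = (0/-1) = 1. *)
Definition kron (c d : int) : int :=
  if (c < 0) && (d < 0) then - jacobi c (absz d) else jacobi c (absz d).

Section Complex.
Variable R : realType.
Local Notation C := R[i].

Definition reC (z : C) : R := @complex.Re R z.
Definition imC (z : C) : R := @complex.Im R z.
Definition cabs (z : C) : R := Num.sqrt (reC z ^+ 2 + imC z ^+ 2).
Definition upper (z : C) : Prop := 0 < imC z.
Definition ci : C := Complex 0 1.
Definition rC (x : R) : C := Complex x 0.
Definition zC (a : int) : C := a%:~R.

Definition jfac (M : mat2) (z : C) : C := zC (mc M) * z + zC (md M).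
Definition mob (M : mat2) (z : C) : C := (zC (ma M) * z + zC (mb M)) / jfac M z.

Definition epsd (d : int) : C := if (d %% 4)%Z == 1 then 1 else ci.

Definition dirichlet_char (q : nat) (eta : int -> C) : Prop :=
  [/\ forall a, eta (a + q%:Z) = eta a,
      forall a b, eta (a * b) = eta a * eta b,
      eta 1 = 1
    & forall a, eta a = 0 <-> ~~ coprime (absz a) q].

(* Weight kappa = m/2 with m odd.  (cz+d)^kappa is taken with the principal
   branch, i.e. (cz+d)^kappa = (sqrtc (cz+d))^m where sqrtc is the principal
   square root (-pi/2 < arg <= pi/2), as in Shimura. *)

Definition holo_H (f : C -> C) : Prop :=
  forall z, upper z -> exists L : C, forall e : R, 0 < e ->
    exists d : R, 0 < d /\ forall h : C, 0 < cabs h -> cabs h < d ->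
      cabs ((f (z + h) - f z) / h - L) < e.

Definition automorphic (m : int) (N : nat) (eta : int -> C) (f : C -> C) : Prop :=
  forall M, Gamma0 (4 * N) M -> forall z, upper z ->
    f (mob M z) = eta (md M) * epsd (md M) ^ (- m) * zC (kron (mc M) (md M))
                  * sqrtc (jfac M z) ^ m * f z.

Definition cuspidal (m : int) (f : C -> C) : Prop :=
  forall M, SL2Z M -> forall e : R, 0 < e -> exists Y : R,
    forall z, upper z -> Y < imC z ->
      imC (mob M z) `^ (m%:~R / 4) * cabs (f (mob M z)) < e.

Definition cusp_form (m : int) (N : nat) (eta : int -> C) (f : C -> C) : Prop :=
  [/\ holo_H f, automorphic m N eta f & cuspidal m f].

Definition en (n : nat) (z : C) : C :=
  let t := 2 * pi * n%:R in
  rC (expR (- (t * imC z))) * Complex (cos (t * reC z)) (sin (t * reC z)).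

Definition fourier_exp (a : nat -> C) (f : C -> C) : Prop :=
  forall z, upper z -> forall e : R, 0 < e -> exists M0 : nat,
    forall M, (M0 <= M)%N -> cabs (\sum_(n < M) a n * en n z - f z) < e.

(* f is an eigenform of Shimura's Hecke operators T(p^2), p prime, p not
   dividing 4N (Shimura, Thm 1.7: with kappa = m/2, t = (m-1)/2,
   T(p^2) f = sum b(n) e(nz), b(n) = a(p^2 n) + eta(p) ((-1)^t n / p) p^(t-1) a(n)
   + eta(p^2) p^(m-2) a(n/p^2)). *)
Definition hecke_eigenform (m : int) (N : nat) (eta : int -> C) (f : C -> C) : Prop :=
  exists a : nat -> C, fourier_exp a f /\
  forall p, prime p -> coprime p (4 * N) -> exists lam : C, forall n : nat,
    let t := ((m - 1) %/ 2)%Z in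
    a (p ^ 2 * n)%N
    + eta p%:Z * zC (jacobi ((-1) ^ t * n%:Z) p) * (p%:R : C) ^ (t - 1) * a n
    + eta (p ^ 2)%N%:Z * (p%:R : C) ^ (m - 2)
        * (if (p ^ 2 %| n)%N then a (n %/ p ^ 2)%N else 0)
    = lam * a n.

Definition eigenbasis (m : int) (N : nat) (eta : int -> C) (bs : seq (C -> C)) : Prop :=
  [/\ (forall g, List.In g bs -> cusp_form m N eta g /\ hecke_eigenform m N eta g),
      (forall c : nat -> C,
         (forall z, upper z -> \sum_(i < size bs) c i * nth (fun _ => 0) bs i z = 0) ->
         forall i, (i < size bs)%N -> c i = 0)
    & (forall h, cusp_form m N eta h -> exists c : nat -> C,
         forall z, upper z -> h z = \sum_(i < size bs) c i * nth (fun _ => 0) bs i z)].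

Definition in_B (m : int) (N : nat) (f : C -> C) : Prop :=
  exists eta, dirichlet_char (4 * N) eta /\
  exists bs, eigenbasis m N eta bs /\ List.In f bs.

Definition matA (N : nat) : mat2 := Mat2 1 0 (2 * N%:Z) 1.
Definition matW (N : nat) (al be ga de : int) : mat2 :=
  Mat2 (2 * al) be (2 * N%:Z * ga) (2 * de).

(* g = f|_kappa[M] for M of positive determinant, up to the unimodular
   constant in the choice of phi:  f|[M](z) = phi(z)^(-2 kappa) f(Mz) with
   phi(z)^2 = t det(M)^(-1/2) (cz+d), |t| = 1. *)
Definition slash_of (m : int) (M : mat2) (f g : C -> C) : Prop :=
  exists u : C, cabs u = 1 /\ forall z, upper z ->
    g z = u * rC ((mdet M)%:~R `^ (m%:~R / 4)) * sqrtc (jfac M z) ^ (- m) * f (mob M z).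

Definition in_B' (m : int) (N : nat) (W : mat2) (g : C -> C) : Prop :=
  exists f, in_B m N f /\
  [\/ (forall z, upper z -> g z = f z),
      slash_of m (matA N) f g,
      slash_of m W f g
    | slash_of m (mmul (matA N) W) f g].

Definition invariant_under (m : int) (G : mat2 -> Prop) (g : C -> C) : Prop :=
  forall M, G M -> forall z, upper z ->
    imC (mob M z) `^ (m%:~R / 2) * cabs (g (mob M z)) ^+ 2
    = imC z `^ (m%:~R / 2) * cabs (g z) ^+ 2.

Definition leb2 := ((@lebesgue_measure R) \x (@lebesgue_measure R))%E.
Definition toC (p : R * R) : C := Complex p.1 p.2.
Definition ofC (z : C) : R * R := (reC z, imC z).

Definition fund_domain (G : mat2 -> Prop) (D : set (R * R)) : Prop :=
  [/\ measurable D,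
      (forall p, D p -> 0 < p.2),
      (forall p, 0 < p.2 -> exists M, G M /\ D (ofC (mob M (toC p))))
    & leb2.-negligible
        [set p | D p /\ exists M, G M /\ D (ofC (mob M (toC p)))
                                  /\ mob M (toC p) <> toC p]].

Definition volD (D : set (R * R)) : R :=
  fine (\int[leb2]_(p in D) (p.2 ^- 2)%:E)%E.

Definition L2normsq (m : int) (g : C -> C) (D : set (R * R)) : R :=
  fine (\int[leb2]_(p in D)
          ((p.2 `^ (m%:~R / 2) * cabs (g (toC p)) ^+ 2) * p.2 ^- 2)%:E)%E
  / volD D.

End Complex.

(* Main.v *)
Require Import Defs.
From mathcomp Require Import all_boot all_order all_algebra.
From mathcomp Require Import all_classical all_reals all_analysis.
From mathcomp Require Import complex measurable_realfun.
From mathcomp Require Import ring lra zify.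
From mathcomp Require cyclic.
From HB Require Import structures.
Set Implicit Arguments. Unset Strict Implicit. Unset Printing Implicit Defensive.
Import Order.TTheory GRing.Theory Num.Theory.
Import numFieldNormedType.Exports.
Local Open Scope ring_scope.

(** Let [F^2 = y^(m/2) |g|^2] and let [B] be its supremum.  [F^2] is invariant under
    the intersection [Gamma'] of [Gamma(8)] with [Gamma_0(N)], whose width at the cusp
    with lower-left entry [c] is [W = 8 N / gcd(N, c)].  Near a point where [F^2] almost
    attains [B], consider [g^2] in a coordinate [w = x + i y] at a cusp, [1/2 < y]: it is
    [W]-periodic, so Cauchy's estimate bounds its derivative by a multiple of
    [W / y^2]; were [y] much larger than [W], [g^2] would be almost constant on the
    vertical segment from [y] to [2 y] (or [y / 2] if [m < 0]) and the factor [y^(m/2)]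
    would push [F^2] above [B].  So [y << W], and by Cauchy again [F^2 >= B / 4] on a
    box of constant hyperbolic area which meets at most [W] consecutive unit strips.
    The translations by [0, ..., W - 1] lie in distinct cosets of [Gamma'], hence,
    unfolding over [SL2(Z)], the set where [F^2 >= B / 4] fills a proportion
    [>> 1 / [SL2(Z) : Gamma']] of the fundamental domain, and this index is at most
    [8^4 2^omega(N) N << N^(1 + eps)].

    The Hecke operators are not needed: an eigenform only contributes its
    [q]-expansion, which approximates [f] by polynomials on discs, so that Cauchy's
    estimates are available without contour integrals. *)

(** * Cauchy estimates for limits of polynomials *)

(** Analytic statements concern [f^2] or [|f|^2]: squaring removes the branch of the square root and
    the quadratic symbol, and leaves the integer weight [m]. An element of B' is, up to a unimodular
    constant, [f] slashed by an integer matrix of determinant 1 or 2 whose lower-left entry is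
    divisible by [N]; level 8 is chosen because it stays divisible by 4 after conjugation by such a
    matrix. The group [G] and [Gamma'] need not be comparable, so both are read modulo one common
    level; the index of [G] enters the area of the fundamental domain and the area where [F^2] is
    large in the same way, and cancels. The domain is known only through its axioms, so its area is
    obtained by unfolding against the strip [0 <= x < 1], [y > 1/2]. A point with [F^2 > 19/20 B]
    replaces a maximum: it cannot lie deep in a cusp, where [F^2 <= 9/10 B]. In the coordinates
    [z = e^(-v) (Y + i)] the modular group acts by compositions of fibrewise translations and
    reflections, so that invariance of area reduces to dimension one. *)

Section ComplexAbs.
Variable R : realType.
Implicit Types (x y z : R[i]) (r : R).

Lemma eqW (a b : R) : a = b -> a <= b.
Proof. by move=> ->. Qed.

Lemma cabsE z : cabs z = Normc.normc z.
Proof. by case: z. Qed.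

Lemma normC_cabs z : `|z| = (cabs z)%:C%C.
Proof. by rewrite normc_def. Qed.

Lemma cabs_ge0 z : 0 <= cabs z. Proof. exact: sqrtr_ge0. Qed.
Lemma cabs0 : cabs (0 : R[i]) = 0. Proof. by rewrite cabsE Normc.normc0. Qed.
Lemma cabs1 : cabs (1 : R[i]) = 1. Proof. by rewrite cabsE Normc.normc1. Qed.
Lemma cabsM x y : cabs (x * y) = cabs x * cabs y.
Proof. by rewrite !cabsE Normc.normcM. Qed.
Lemma cabsV x : cabs x^-1 = (cabs x)^-1.
Proof. by rewrite !cabsE Normc.normcV. Qed.
Lemma cabsD x y : cabs (x + y) <= cabs x + cabs y.
Proof. by rewrite -lecR rmorphD /= -!normC_cabs ler_normD. Qed.
Lemma cabsN x : cabs (- x) = cabs x.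
Proof. by apply: complexI; rewrite -!normC_cabs normrN. Qed.
Lemma cabsB x y : cabs (x - y) = cabs (y - x).
Proof. by rewrite -cabsN opprB. Qed.
Lemma cabs_eq0 x : (cabs x == 0) = (x == 0).
Proof. by rewrite -(normr_eq0 x) normC_cabs eq_complex /= eqxx andbT. Qed.
Lemma cabs_gt0 x : (0 < cabs x) = (x != 0).
Proof. by rewrite lt_neqAle cabs_ge0 andbT eq_sym cabs_eq0. Qed.
Lemma cabsX x n : cabs (x ^+ n) = cabs x ^+ n.
Proof. by elim: n => [|n IH]; rewrite ?expr0 ?cabs1 // !exprS cabsM IH. Qed.
Lemma cabsXz x (n : int) : cabs (x ^ n) = cabs x ^ n.
Proof. by case: n => n; rewrite ?NegzE ?exprnN -?exprnP ?cabsX // cabsV cabsX. Qed.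
Lemma cabs_rC r : cabs (rC r) = `|r|.
Proof. by rewrite /cabs /rC /= expr0n addr0 sqrtr_sqr. Qed.
Lemma cabsBD x y z : cabs (x - z) <= cabs (x - y) + cabs (y - z).
Proof. by have := cabsD (x - y) (y - z); rewrite addrA subrK. Qed.
Lemma cabs_ler x y : cabs x - cabs y <= cabs (x - y).
Proof. by have := cabsD (x - y) y; rewrite subrK; lra. Qed.

Lemma cabs_sum (I : Type) (s : seq I) (P : pred I) (F : I -> R[i]) :
  cabs (\sum_(i <- s | P i) F i) <= \sum_(i <- s | P i) cabs (F i).
Proof.
elim/big_rec2: _ => [|i u v _ uv]; first by rewrite cabs0.
by apply: le_trans (cabsD _ _) _; rewrite lerD2l.
Qed.

Lemma cabs_sqr x : cabs x ^+ 2 = reC x ^+ 2 + imC x ^+ 2.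
Proof. by rewrite sqr_sqrtr // addr_ge0 // sqr_ge0. Qed.
Lemma reC_le x : `|reC x| <= cabs x.
Proof. by rewrite -sqrtr_sqr ler_wsqrtr // lerDl sqr_ge0. Qed.
Lemma imC_le x : `|imC x| <= cabs x.
Proof. by rewrite -sqrtr_sqr ler_wsqrtr // lerDr sqr_ge0. Qed.
Lemma cabs_le x : cabs x <= `|reC x| + `|imC x|.
Proof.
rewrite -(ler_pXn2r (n := 2)) ?nnegrE ?cabs_ge0 ?addr_ge0 // cabs_sqr.
rewrite sqrrD !real_normK ?num_real // lerD2r lerDl mulrn_wge0 //.
Qed.

Lemma reCD x y : reC (x + y) = reC x + reC y. Proof. by case: x y => [a b] [c d]. Qed.
Lemma imCD x y : imC (x + y) = imC x + imC y. Proof. by case: x y => [a b] [c d]. Qed.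
Lemma reCN x : reC (- x) = - reC x. Proof. by case: x. Qed.
Lemma imCN x : imC (- x) = - imC x. Proof. by case: x. Qed.
Lemma reCM x y : reC (x * y) = reC x * reC y - imC x * imC y.
Proof. by case: x y => [a b] [c d]. Qed.
Lemma imCM x y : imC (x * y) = reC x * imC y + imC x * reC y.
Proof. by case: x y => [a b] [c d]. Qed.
Lemma zCE (a : int) : zC R a = Complex a%:~R 0.
Proof.
rewrite /zC; have -> : (a%:~R : R[i]) = (a%:~R : R)%:C%C by rewrite rmorph_int.
by [].
Qed.
Lemma cabs_zC (a : int) : cabs (zC R a) = `|a%:~R|.
Proof. by rewrite zCE cabs_rC. Qed.
Lemma complex_eq x y : reC x = reC y -> imC x = imC y -> x = y.
Proof. by case: x y => [a b] [c d] /= -> ->. Qed.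

Lemma upper_neq0 z : upper z -> z != 0.
Proof. by apply: contraTneq => ->; rewrite /upper /imC ltxx. Qed.

End ComplexAbs.

Section PolyTaylor.
Variable R : realType.
Implicit Types (x y z u v : R[i]) (r : R).

(** [X^n - 1] splits over [R[i]] and is separable, so there are [n] distinct roots of unity, and
    these form a cyclic group. *)
Lemma prim_root_ex n : (0 < n)%N -> exists w : R[i], n.-primitive_root w.
Proof.
move=> n0; pose p : {poly R[i]} := 'X^n - 1.
have [r Dp] := closed_field_poly_normal p.
have sz_p : size p = n.+1 by rewrite size_XnsubC.
rewrite (monicP _) ?monicXnsubC // scale1r in Dp.
have rn1 : all n.-unity_root r by apply/allP=> z; rewrite -root_prod_XsubC -Dp.
have sz_r : (n < (size r).+1)%N by rewrite -(size_prod_XsubC r id) -Dp sz_p.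
have [|z] := hasP (cyclic.has_prim_root n0 rn1 _ sz_r); last by exists z.
by rewrite -separable.separable_prod_XsubC -Dp cyclotomic.separable_Xn_sub_1 // pnatr_eq0 -lt0n.
Qed.

(* averaging over the roots of unity replaces the contour integral *)
Lemma cauchy_est (p : {poly R[i]}) (r S : R) : 0 < r ->
  (forall u, cabs u <= r -> cabs p.[u] <= S) ->
  forall k, cabs p`_k * r ^+ k <= S.
Proof.
move=> r0 hp k.
(* With more nodes than the degree and than [k], the average isolates the coefficient [k] without
   aliasing. *)
pose n := (maxn (size p) k.+1); have n0 : (0 < n)%N by rewrite /n leq_max orbT.
have kn : (k < n)%N by rewrite /n leq_max leqnn orbT.
have [w pw] := prim_root_ex n0.
have wn : w ^+ n = 1 by exact: prim_expr_order pw.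
have cw : cabs w = 1.
  have : cabs w ^+ n = 1 by rewrite -cabsX wn cabs1.
  by move/eqP; rewrite pexpr_eq1 ?cabs_ge0 // => /eqP.
have key : n%:R * (p`_k * rC r ^+ k) =
    \sum_(j < n) p.[rC r * w ^+ j] * w ^+ (j * (n - k)).
  under eq_bigr => j _.
    rewrite (@horner_coef_wide _ n) ?leq_max ?leqnn // mulr_suml.
    under eq_bigr => l _ do
      rewrite exprMn mulrA -!mulrA -!exprM -exprD -mulnDr mulnC exprM.
    over.
  rewrite exchange_big /= (bigD1 (Ordinal kn)) //= [X in _ + X]big1 ?addr0.
    rewrite subnKC ?(ltnW kn) //; under eq_bigr do rewrite wn expr1n mulr1.
    by rewrite sumr_const card_ord mulr_natl.
  move=> l lk; rewrite -big_distrr /= -big_distrr /=.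
  (* The exponent [l + (n - k)] lies strictly between 0 and [2 n] and is not [n] because [l != k];
     hence [q] is a nontrivial root of unity and its geometric sum vanishes. *)
  set q := w ^+ _.
  have q1 : q != 1.
    rewrite /q -(prim_order_dvd pw).
    have ln := ltn_ord l.
    apply/negP => /dvdnP [[|[|t]]]; last by lia.
      by lia.
    by rewrite mul1n => E; case/eqP: lk; apply: val_inj => /=; lia.
  have : (q - 1) * \sum_(j < n) q ^+ j = 0.
    by rewrite -subrX1 /q -exprM mulnC exprM wn expr1n subrr.
  move/eqP; rewrite mulf_eq0 subr_eq0 (negPf q1) /= => /eqP ->.
  by rewrite !mulr0.
have : cabs (n%:R * (p`_k * rC r ^+ k)) <= n%:R * S.
  rewrite key; apply: le_trans (cabs_sum _ _ _) _.
  rewrite -[X in X%:R * S]card_ord mulr_natl -sumr_const; apply: ler_sum => j _.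
  rewrite cabsM cabsX cw expr1n mulr1; apply: hp.
  by rewrite cabsM cabsX cw expr1n mulr1 cabs_rC gtr0_norm.
rewrite !cabsM cabsX cabs_rC gtr0_norm // -[X in cabs X]/(zC R n%:Z) cabs_zC.
by rewrite normr_nat ler_pM2l ?ltr0n.
Qed.

Lemma geo_sum_le (x : R) n : 0 <= x -> x <= 1/2 -> \sum_(k < n) x ^+ k <= 2.
Proof.
move=> x0 x1.
have E : (1 - x) * \sum_(k < n) x ^+ k = 1 - x ^+ n.
  by have := subrX1 x n; move=> E; rewrite -opprB -(opprB (x ^+ n)) E mulNr.
have xn : 0 <= x ^+ n by rewrite exprn_ge0.
have s0 : 0 <= \sum_(k < n) x ^+ k by apply: sumr_ge0 => i _; rewrite exprn_ge0.
nra.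
Qed.

(** A difference quotient at an auxiliary [v] replaces the linear coefficient, so that the estimate
    passes to uniform limits. Only degrees at least 2 survive, and Cauchy's bound makes their sum
    geometric with ratio at most [1/2]. *)
Lemma poly_quot_est (p : {poly R[i]}) (r S : R) u v : 0 < r ->
  (forall u, cabs u <= r -> cabs p.[u] <= S) ->
  cabs u <= r / 2 -> cabs v <= r / 2 -> v != 0 ->
  cabs (p.[u] - p.[0] - u / v * (p.[v] - p.[0])) <=
    2 * S * (cabs u / r) * (cabs u / r + cabs v / r).
Proof.
move=> r0 hp hu hv v0.
have ce := cauchy_est r0 hp.
have S0 : 0 <= S by apply: le_trans (hp 0 _); rewrite ?cabs_ge0 // cabs0 ltW.
pose n := (size p).
have E t : p.[t] = p.[0] + p`_1 * t + \sum_(k < n) p`_(k.+2) * t ^+ k.+2.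
  rewrite (@horner_coef_wide _ n.+2) ?leqW // 2!big_ord_recl /= horner_coef0.
  by rewrite addrA expr0 mulr1 expr1.
have -> : p.[u] - p.[0] - u / v * (p.[v] - p.[0]) =
   \sum_(k < n) p`_(k.+2) * (u ^+ k.+2 - u * v ^+ k.+1).
  rewrite (E u) (E v) [RHS](eq_bigr (fun k : 'I_n => p`_(k.+2) * u ^+ k.+2 - u / v * (p`_(k.+2) * v ^+ k.+2))).
    rewrite sumrB -mulr_sumr; field.
    exact: v0.
  move=> k _; rewrite (exprS v k.+1); field; exact: v0.
set a := cabs u / r; set b := cabs v / r.
have a0 : 0 <= a by rewrite divr_ge0 ?cabs_ge0 ?ltW.
have b0 : 0 <= b by rewrite divr_ge0 ?cabs_ge0 ?ltW.
have a1 : a <= 1/2 by rewrite ler_pdivrMr // mulrC; lra.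
have b1 : b <= 1/2 by rewrite ler_pdivrMr // mulrC; lra.
apply: le_trans (cabs_sum _ _ _) _.
apply: (@le_trans _ _ (\sum_(k < n) S * (a * a * a ^+ k + a * b * b ^+ k))).
  apply: ler_sum => k _; rewrite cabsM.
  have h : cabs (u ^+ k.+2 - u * v ^+ k.+1) <= r ^+ k.+2 * (a * a * a ^+ k + a * b * b ^+ k).
    apply: le_trans (cabsD _ _) _; rewrite cabsN cabsM !cabsX.
    have -> : cabs u = r * a by rewrite /a mulrC divfK // gt_eqF.
    have -> : cabs v = r * b by rewrite /b mulrC divfK // gt_eqF.
    by clearbody a b; apply: eqW; rewrite !exprMn !exprS; ring.
  apply: (@le_trans _ _ (cabs p`_k.+2 * (r ^+ k.+2 * (a * a * a ^+ k + a * b * b ^+ k)))).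
    by rewrite ler_wpM2l ?cabs_ge0.
  by rewrite mulrA ler_wpM2r ?ce //; clearbody a b; rewrite !(addr_ge0, mulr_ge0, exprn_ge0).
rewrite -mulr_sumr big_split /= -!mulr_sumr.
have := geo_sum_le n a0 a1; have := geo_sum_le n b0 b1.
set A := \sum_(i < n) a ^+ i; set B := \sum_(i < n) b ^+ i => hB hA.
clearbody A B a b.
have : a * a * A <= a * a * 2 by rewrite ler_wpM2l ?mulr_ge0.
have : a * b * B <= a * b * 2 by rewrite ler_wpM2l ?mulr_ge0.
move=> h1 h2.
have -> : 2 * S * a * (a + b) = S * (a * a * 2 + a * b * 2) by ring.
by rewrite ler_wpM2l // lerD.
Qed.

(** This stands in for holomorphy on a disc: it is stable under sums and products and carries over
    the estimates proved for polynomials. *)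
Definition poly_approx (r : R) (phi : R[i] -> R[i]) : Prop :=
  forall e : R, 0 < e -> exists p : {poly R[i]},
    forall u, cabs u <= r -> cabs (phi u - p.[u]) <= e.

Lemma taylor2_quot (phi : R[i] -> R[i]) (r S : R) u v : 0 < r ->
  poly_approx r phi ->
  (forall u, cabs u <= r -> cabs (phi u) <= S) ->
  cabs u <= r / 2 -> cabs v <= r / 2 -> v != 0 ->
  cabs (phi u - phi 0 - u / v * (phi v - phi 0)) <=
    2 * S * (cabs u / r) * (cabs u / r + cabs v / r).
Proof.
move=> r0 ap hp hu hv v0.
(* [K] adds up what an error [e / K] costs: two values in [phi u - phi 0], two more multiplied by
   [|u / v|], and the enlarged bound [S + e / K] in the main term. *)
pose K := 2 + 2 * cabs (u / v) + 2 * (cabs u / r) * (cabs u / r + cabs v / r).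
have K0 : 0 < K.
  have rV : 0 <= r^-1 by rewrite invr_ge0 ltW.
  have h1 := cabs_ge0 (u / v).
  have h2 : 0 <= 2 * (cabs u / r) * (cabs u / r + cabs v / r).
    by rewrite !(mulr_ge0, addr_ge0) ?cabs_ge0.
  by rewrite /K; lra.
apply/ler_addgt0Pr => e e0.
have [p hpe] := ap (e / K) (divr_gt0 e0 K0).
have hp' : forall u, cabs u <= r -> cabs p.[u] <= S + e / K.
  move=> t ht; have -> : p.[t] = phi t - (phi t - p.[t]) by ring.
  by apply: le_trans (cabsD _ _) _; rewrite cabsN lerD ?hp ?hpe.
have := poly_quot_est r0 hp' hu hv v0.
have c0 : cabs (0 : R[i]) <= r by rewrite cabs0 ltW.
have h0 := hpe 0 c0; have hu' := hpe u ltac:(lra); have hv' := hpe v ltac:(lra).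
have -> : phi u - phi 0 - u / v * (phi v - phi 0) =
  (p.[u] - p.[0] - u / v * (p.[v] - p.[0])) +
  ((phi u - p.[u]) - (phi 0 - p.[0]) - u / v * ((phi v - p.[v]) - (phi 0 - p.[0]))) by ring.
move=> h1; apply: le_trans (cabsD _ _) _.
set a := phi u - p.[u] in hu' *; set b := phi 0 - p.[0] in h0 *; set c := phi v - p.[v] in hv' *.
have h2 : cabs (a - b - u / v * (c - b)) <= (2 + 2 * cabs (u / v)) * (e / K).
  apply: le_trans (cabsD _ _) _; rewrite cabsN cabsM.
  have := cabsD a (- b); have := cabsD c (- b); rewrite cabsN => cb ab.
  have : cabs (u / v) * cabs (c - b) <= cabs (u / v) * (2 * (e / K)).
    by rewrite ler_wpM2l ?cabs_ge0 //; lra.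
  by lra.
have KE : e = K * (e / K) by rewrite mulrC divfK // gt_eqF.
rewrite [X in _ <= _ + X]KE /K; move: h1 h2; rewrite -/K.
set q := e / K; set s := cabs (u / v); set aa := cabs u / r; set bb := cabs v / r.
set X1 := cabs _; set X2 := cabs _ => h1 h2.
by apply: le_trans (lerD h1 h2) _; rewrite /K -/s -/aa -/bb; clearbody s aa bb q; apply: eqW; ring.
Qed.

(** Let [v] tend to 0 in [taylor2_quot]: the quotient tends to the derivative [L] and the term
    [|v| / r] disappears. *)
Lemma taylor2 (f : R[i] -> R[i]) z (L : R[i]) (r S : R) : 0 < r ->
  poly_approx r (fun u => f (z + u)) ->
  (forall u, cabs u <= r -> cabs (f (z + u)) <= S) ->
  (forall e : R, 0 < e -> exists d : R, 0 < d /\ forall h : R[i], 0 < cabs h -> cabs h < d ->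
      cabs ((f (z + h) - f z) / h - L) < e) ->
  forall u, cabs u <= r / 2 ->
  cabs (f (z + u) - f z - L * u) <= 2 * S * (cabs u / r) ^+ 2.
Proof.
move=> r0 ap hS hL u hu.
have S0 : 0 <= S by apply: le_trans (hS 0 _); rewrite ?cabs_ge0 // cabs0 ltW.
apply/ler_addgt0Pr => e e0.
pose K := cabs u + 2 * S * (cabs u / r) / r + 1.
have aux : 0 <= 2 * S * (cabs u / r) / r.
  by rewrite !mulr_ge0 ?invr_ge0 ?cabs_ge0 ?(ltW r0).
have K0 : 0 < K by have := cabs_ge0 u; rewrite /K; lra.
have eK : 0 < e / K by rewrite divr_gt0.
have [d [d0 hd]] := hL (e / K) eK.
pose t := Num.min (Num.min (d / 2) (r / 2)) (e / K).
have t0 : 0 < t by rewrite /t !lt_min !divr_gt0.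
pose v : R[i] := rC t.
have cv : cabs v = t by rewrite cabs_rC gtr0_norm.
have v0 : v != 0 by rewrite -cabs_gt0 cv.
have tr : t <= r / 2 by rewrite /t !ge_min lexx orbT.
have td : t < d.
  have : t <= d / 2 by rewrite /t !ge_min lexx.
  by lra.
have te : t <= e / K by rewrite /t ge_min lexx orbT.
have h1 := hd v ltac:(rewrite cv //) ltac:(rewrite cv //).
have h2 := taylor2_quot r0 ap hS hu (v := v) ltac:(rewrite cv //) v0.
rewrite addr0 in h2.
have -> : f (z + u) - f z - L * u = (f (z + u) - f z - u / v * (f (z + v) - f z)) +
   u * ((f (z + v) - f z) / v - L) by field.
apply: le_trans (cabsD _ _) _; rewrite cabsM.
have h3 : cabs u * cabs ((f (z + v) - f z) / v - L) <= cabs u * (e / K).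
  by rewrite ler_wpM2l ?cabs_ge0 // ltW.
rewrite cv in h2.
have KE : e = K * (e / K) by rewrite mulrC divfK // gt_eqF.
rewrite [X in _ <= _ + X]KE /K -/K.
have h4 : 2 * S * (cabs u / r) * (t / r) <= 2 * S * (cabs u / r) / r * (e / K).
  have -> : 2 * S * (cabs u / r) * (t / r) = 2 * S * (cabs u / r) / r * t by ring.
  by rewrite ler_wpM2l.
move: h2 h3 h4 eK; set q := e / K; set X1 := cabs _; set X2 := cabs _ * cabs _.
rewrite (_ : 2 * S * (cabs u / r) * (cabs u / r + t / r) =
  2 * S * (cabs u / r) ^+ 2 + 2 * S * (cabs u / r) * (t / r)); last by ring.
rewrite /K; move=> h2 h3 h4 eK; rewrite !mulrDl mul1r.
lra.
Qed.

End PolyTaylor.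

(** * Fourier series as limits of polynomials *)

Section Exponential.
Variable R : realType.
Implicit Types (x y z u v : R[i]) (r : R).

Lemma sin_abs_le (y : R) : `|sin y| <= `|y|.
Proof.
wlog y0 : y / 0 <= y => [H|].
  have [|y0] := leP 0 y; first exact: H.
  by rewrite -normrN -sinN -[X in _ <= X]normrN; apply: H; rewrite oppr_ge0 ltW.
have [->|yn] := eqVneq y 0; first by rewrite sin0.
have yp : 0 < y by rewrite lt_neqAle eq_sym yn.
have [|c _ E] := @MVT R sin cos 0 y yp.
  by apply: continuous_subspaceT => x; exact: continuous_sin.
rewrite sin0 !subr0 in E; rewrite E normrM.
by rewrite ler_piMl // cos_max.
Qed.

Lemma cos_near1 (y : R) : `|cos y - 1| <= y ^+ 2.
Proof.
have -> : y = (y / 2) *+ 2 by rewrite -mulr_natr divfK.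
rewrite cos_mulr2n cos2sin2.
have := sin_abs_le (y / 2); set s := sin _; set t := y / 2 => h.
have h2 : s ^+ 2 <= t ^+ 2.
  by rewrite -(real_normK (num_real s)) -(real_normK (num_real t)) ler_pXn2r ?nnegrE.
have -> : (1 - s ^+ 2) *+ 2 - 1 - 1 = - (s ^+ 2 * 2) by ring.
rewrite normrN ger0_norm; last by rewrite mulr_ge0 ?sqr_ge0.
by rewrite exprMn_n; have := sqr_ge0 t; lra.
Qed.

Lemma sin_near (y : R) : `|y| <= 1 -> `|sin y - y| <= y ^+ 2.
Proof.
wlog y0 : y / 0 <= y => [H y1|].
  have [y0|y0] := leP 0 y; first exact: H.
  have := H (- y); rewrite oppr_ge0 normrN sinN sqrrN => /(_ (ltW y0) y1).
  by rewrite -normrN; congr (`| _ | <= _); ring.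
rewrite ger0_norm // => y1.
have [->|yn] := eqVneq y 0; first by rewrite sin0 subrr normr0 sqr_ge0.
have yp : 0 < y by rewrite lt_neqAle eq_sym yn.
have [|c] := @MVT R sin cos 0 y yp.
  by apply: continuous_subspaceT => x; exact: continuous_sin.
rewrite in_itv /= => /andP[c0 cy] E; rewrite sin0 !subr0 in E.
have -> : sin y - y = (cos c - 1) * y by rewrite E; ring.
rewrite normrM (ger0_norm y0) expr2 ler_wpM2r //.
apply: le_trans (cos_near1 c) _; nra.
Qed.

Lemma expR_near1 (x : R) : `|x| <= 1/2 -> `|expR x - 1 - x| <= 2 * x ^+ 2.
Proof.
rewrite ler_norml => /andP[x1 x2].
have h1 := expR_ge1Dx x; have h2 := expR_ge1Dx (- x).
have e0 := expR_gt0 x.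
have E : expR x * expR (- x) = 1 by rewrite -expRD subrr expR0.
rewrite ger0_norm; last by lra.
have h3 : expR x * (1 - x) <= expR x * expR (- x) by rewrite ler_wpM2l // ltW.
rewrite E in h3.
nra.
Qed.

Definition cE (z : R[i]) : R[i] :=
  rC (expR (reC z)) * Complex (cos (imC z)) (sin (imC z)).

Lemma cabs_cis (t : R) : cabs (Complex (cos t) (sin t)) = 1.
Proof. by rewrite /cabs /= cos2Dsin2 sqrtr1. Qed.

Lemma cabs_cE z : cabs (cE z) = expR (reC z).
Proof. by rewrite cabsM cabs_cis mulr1 cabs_rC gtr0_norm ?expR_gt0. Qed.

Lemma cED x y : cE (x + y) = cE x * cE y.
Proof.
rewrite /cE reCD imCD expRD cosD sinD.
apply: complex_eq; rewrite !(reCM, imCM) /=; ring.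
Qed.

Lemma cE0 : cE 0 = 1.
Proof. by rewrite /cE /= expR0 cos0 sin0; apply: complex_eq; rewrite !(reCM, imCM) /=; ring. Qed.

Lemma cEX z n : cE (z *+ n) = cE z ^+ n.
Proof. by elim: n => [|n IH]; rewrite ?mulr0n ?cE0 // mulrS cED IH exprS. Qed.

Lemma cE_near1 z : cabs z <= 1/2 -> cabs (cE z - 1 - z) <= 8 * cabs z ^+ 2.
Proof.
move=> hz.
have := le_trans (reC_le z) hz; have := le_trans (imC_le z) hz.
set a := reC z; set b := imC z => hb ha.
have C2 := cabs_sqr z; rewrite -/a -/b in C2.
have e1 := expR_near1 ha; have c1 := cos_near1 b; have s1 := @sin_near b ltac:(lra).
apply: le_trans (cabs_le _) _.
have -> : reC (cE z - 1 - z) = (expR a - 1 - a) + expR a * (cos b - 1).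
  by rewrite !reCD !reCN /cE reCM /= -/a -/b; ring.
have -> : imC (cE z - 1 - z) = (expR a - 1 - a) * b + a * b + expR a * (sin b - b).
  by rewrite !imCD !imCN /cE imCM /= -/a -/b; ring.
have ea : expR a <= 2.
  move: ha e1; rewrite !ler_norml => /andP[? ?] /andP[_]; nra.
have e0 := expR_ge0 a.
set X := expR a - 1 - a in e1 *.
have h1 : `|expR a * (cos b - 1)| <= 2 * b ^+ 2.
  by rewrite normrM (ger0_norm e0) ler_pM.
have h2 : `|expR a * (sin b - b)| <= 2 * b ^+ 2.
  by rewrite normrM (ger0_norm e0) ler_pM.
have h3 : `|X * b| <= a ^+ 2.
  rewrite normrM; have : `|X| * `|b| <= (2 * a ^+ 2) * (1/2) by rewrite ler_pM.
  lra.
have h4 : `|a * b| <= (a ^+ 2 + b ^+ 2) / 2.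
  have := sqr_ge0 (a + b); have := sqr_ge0 (a - b); rewrite !expr2 => q1 q2.
  by rewrite ler_norml; apply/andP; split; lra.
have t1 := ler_normD X (expR a * (cos b - 1)).
have t2 := ler_normD (X * b + a * b) (expR a * (sin b - b)).
have t3 := ler_normD (X * b) (a * b).
have := sqr_ge0 a; have := sqr_ge0 b; lra.
Qed.

Lemma poly_bdd (p : {poly R[i]}) r : 0 <= r ->
  exists M : R, 0 <= M /\ forall u, cabs u <= r -> cabs p.[u] <= M.
Proof.
move=> r0; exists (\sum_(k < size p) cabs p`_k * r ^+ k); split.
  by apply: sumr_ge0 => k _; rewrite mulr_ge0 ?cabs_ge0 ?exprn_ge0.
move=> u hu; rewrite horner_coef; apply: le_trans (cabs_sum _ _ _) _.
apply: ler_sum => k _; rewrite cabsM cabsX ler_wpM2l ?cabs_ge0 //.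
by rewrite lerXn2r ?nnegrE ?cabs_ge0.
Qed.

Lemma poly_approx_bdd r phi : 0 <= r -> poly_approx r phi ->
  exists M : R, 0 <= M /\ forall u, cabs u <= r -> cabs (phi u) <= M.
Proof.
move=> r0 /(_ 1 ltr01)[p hp]; have [M [M0 hM]] := poly_bdd p r0.
exists (1 + M); split; first by lra.
move=> u hu; have -> : phi u = (phi u - p.[u]) + p.[u] by rewrite subrK.
by apply: le_trans (cabsD _ _) _; rewrite lerD ?hp ?hM.
Qed.

Lemma poly_approx_cst r c : poly_approx r (fun _ => c).
Proof. by move=> e e0; exists c%:P => u _; rewrite hornerC subrr cabs0 ltW. Qed.

Lemma poly_approxD r phi psi : poly_approx r phi -> poly_approx r psi ->
  poly_approx r (fun u => phi u + psi u).
Proof.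
move=> h1 h2 e e0; have e2 : 0 < e / 2 by lra.
have [p hp] := h1 _ e2; have [q hq] := h2 _ e2.
exists (p + q) => u hu; rewrite hornerD opprD addrACA.
by apply: le_trans (cabsD _ _) _; have := hp u hu; have := hq u hu; lra.
Qed.

Lemma poly_approxM r phi psi : 0 <= r -> poly_approx r phi -> poly_approx r psi ->
  poly_approx r (fun u => phi u * psi u).
Proof.
move=> r0 h1 h2 e e0.
have [M1 [M10 hM1]] := poly_approx_bdd r0 h1.
have e1 : 0 < e / (2 * (M1 + 1)) by rewrite divr_gt0 // mulr_gt0 //; lra.
have [q hq] := h2 _ e1.
have [M2 [M20 hM2]] := poly_bdd q r0.
have e2 : 0 < e / (2 * (M2 + 1)) by rewrite divr_gt0 // mulr_gt0 //; lra.
have [p hp] := h1 _ e2.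
exists (p * q) => u hu; rewrite hornerM.
have -> : phi u * psi u - p.[u] * q.[u] = phi u * (psi u - q.[u]) + (phi u - p.[u]) * q.[u] by ring.
apply: le_trans (cabsD _ _) _; rewrite !cabsM.
have a1 : cabs (phi u) * cabs (psi u - q.[u]) <= M1 * (e / (2 * (M1 + 1))).
  by rewrite ler_pM ?cabs_ge0 ?hM1 ?hq.
have a2 : cabs (phi u - p.[u]) * cabs q.[u] <= (e / (2 * (M2 + 1))) * M2.
  by rewrite ler_pM ?cabs_ge0 ?hM2 ?hp.
have b M : 0 <= M -> M * (e / (2 * (M + 1))) <= e / 2.
  move=> M0; have -> : M * (e / (2 * (M + 1))) = (M / (M + 1)) * (e / 2) by field; lra.
  by rewrite ler_piMl //; [lra | rewrite ler_pdivrMr; lra].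
have := b _ M10; have := b _ M20; rewrite (mulrC _ M2) in a2; lra.
Qed.

Lemma poly_approx_sum r n (F : nat -> R[i] -> R[i]) :
  (forall i, (i < n)%N -> poly_approx r (F i)) ->
  poly_approx r (fun u => \sum_(i < n) F i u).
Proof.
elim: n => [|n IH] h e e0.
  have [p hp] := poly_approx_cst r 0 e0; exists p => u hu; rewrite big_ord0; exact: hp.
have h1 := IH (fun i hi => h i (ltnW hi)).
have [p hp] := poly_approxD h1 (h n (ltnSn n)) e0.
by exists p => u hu; rewrite big_ord_recr; exact: hp.
Qed.

Lemma poly_approx_ext r phi psi : (forall u, cabs u <= r -> phi u = psi u) ->
  poly_approx r phi -> poly_approx r psi.
Proof. by move=> E h e e0; have [p hp] := h e e0; exists p => u hu; rewrite -E //; exact: hp. Qed.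

Lemma sub_pow_le (x y : R[i]) (M : R) n : cabs x <= M -> cabs y <= M -> 0 <= M ->
  cabs (x ^+ n.+1 - y ^+ n.+1) <= n.+1%:R * M ^+ n * cabs (x - y).
Proof.
move=> hx hy M0; elim: n => [|n IH]; first by rewrite !expr1 expr0 !mul1r.
have -> : x ^+ n.+2 - y ^+ n.+2 = x * (x ^+ n.+1 - y ^+ n.+1) + (x - y) * y ^+ n.+1.
  by rewrite !(exprS _ n.+1); ring.
apply: le_trans (cabsD _ _) _; rewrite !cabsM cabsX.
have a1 : cabs x * cabs (x ^+ n.+1 - y ^+ n.+1) <= M * (n.+1%:R * M ^+ n * cabs (x - y)).
  by rewrite ler_pM ?cabs_ge0.
have a2 : cabs (x - y) * cabs y ^+ n.+1 <= cabs (x - y) * M ^+ n.+1.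
  by rewrite ler_wpM2l ?cabs_ge0 // lerXn2r ?nnegrE ?cabs_ge0.
apply: le_trans (lerD a1 a2) _; apply: eqW.
by rewrite (natrD _ 1 n.+1) exprS; ring.
Qed.

(** The approximants are [(1 + l u / k)^k]. With [s = l u / k], [e^s] and [1 + s] differ by
    [O(1/k^2)]; taking [k]-th powers costs a factor [k] and leaves [O(1/k)]. *)
Lemma poly_approx_cE r (l : R[i]) : 0 <= r -> poly_approx r (fun u => cE (l * u)).
Proof.
move=> r0 e e0.
pose t := cabs l * r + 1; have t0 : 0 < t by rewrite ltr_wpDl // mulr_ge0 ?cabs_ge0.
pose Q := 8 * expR t * t ^+ 2.
have Q0 : 0 <= Q by rewrite !mulr_ge0 ?expR_ge0 ?sqr_ge0 // ltW.
pose K := (Num.truncn (2 * t + Q / e)).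
have hK : 2 * t + Q / e < K.+1%:R.
  have h : 0 <= 2 * t + Q / e by rewrite addr_ge0 ?divr_ge0 ?mulr_ge0 // ltW.
  by have /andP[] := Num.Theory.truncn_itv h.
pose k : R := K.+1%:R; have k0 : 0 < k by rewrite ltr0n.
exists ((1 + (l / rC k) *: 'X) ^+ K.+1) => u hu.
rewrite horner_exp hornerD hornerC hornerZ hornerX.
pose s := l * u / rC k.
have kC : rC k = K.+1%:R by rewrite /k /rC -[Complex _ 0]/(K.+1%:R%:C)%C rmorph_nat.
have kn0 : (K.+1%:R : R[i]) != 0 by rewrite pnatr_eq0.
have -> : cE (l * u) = cE s ^+ K.+1.
  by rewrite -cEX; congr cE; rewrite /s kC -(mulr_natr (_ / _)); field.
have -> : l / rC k * u = s by rewrite /s; ring.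
have cs : cabs s * k <= t.
  rewrite /s !cabsM cabsV cabs_rC (gtr0_norm k0) divfK ?gt_eqF // /t.
  have : cabs l * cabs u <= cabs l * r by rewrite ler_wpM2l ?cabs_ge0.
  lra.
have cs0 := cabs_ge0 s.
have tk : t / k <= 1/2.
  rewrite ler_pdivrMr //; have : 0 <= Q / e by rewrite divr_ge0 // ltW.
  by rewrite -/k in hK; lra.
have cs2 : cabs s <= t / k by rewrite ler_pdivlMr.
have m1 : cabs (cE s) <= expR (t / k).
  by rewrite cabs_cE ler_expR; apply: le_trans cs2; apply: le_trans (reC_le s); exact: ler_norm.
have m2 : cabs (1 + s) <= expR (t / k).
  apply: le_trans (cabsD _ _) _; rewrite cabs1; by apply: le_trans (expR_ge1Dx _); rewrite lerD2l.
apply: le_trans (sub_pow_le K m1 m2 (expR_ge0 _)) _.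
have n1 : cabs (cE s - (1 + s)) <= 8 * (t / k) ^+ 2.
  have -> : cE s - (1 + s) = cE s - 1 - s by ring.
  apply: le_trans (cE_near1 _) _; first exact: le_trans cs2 tk.
  by rewrite ler_pM2l // ler_pXn2r ?nnegrE // divr_ge0 // ltW.
have eK : expR (t / k) ^+ K <= expR t.
  rewrite -expRM_natr ler_expR -mulrA ler_piMr ?ltW //.
  by rewrite ltr_pdivrMl // mulr1 /k ltr_nat.
rewrite -/k; apply: (@le_trans _ _ (k * expR t * (8 * (t / k) ^+ 2))).
  rewrite ler_pM ?cabs_ge0 ?mulr_ge0 ?exprn_ge0 ?expR_ge0 ?(ltW k0) //.
  by rewrite ler_wpM2l // ltW.
have -> : k * expR t * (8 * (t / k) ^+ 2) = Q / k by rewrite /Q; field; rewrite gt_eqF.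
rewrite ler_pdivrMr // mulrC -ler_pdivrMr //.
by rewrite -/k in hK; lra.
Qed.

End Exponential.

Section QSeries.
Variable R : realType.
Implicit Types (z u : R[i]) (r : R).

Definition twopi : R := 2 * pi.

Lemma twopi_gt0 : 0 < twopi. Proof. by rewrite mulr_gt0 ?pi_gt0. Qed.

Lemma enE n z : en n z = cE (Complex 0 twopi * z *+ n).
Proof.
have E : forall w, reC (w *+ n) = reC w *+ n /\ imC (w *+ n) = imC w *+ n.
  move=> S w; elim: n => [|k [I1 I2]]; first by rewrite !mulr0n.
  by rewrite !mulrS reCD imCD I1 I2.
have [E1 E2] := E R (Complex 0 twopi * z).
rewrite /cE E1 E2 reCM imCM /= /en /twopi.
by congr (rC (expR _) * Complex (cos _) (sin _)); rewrite -mulr_natr; ring.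
Qed.

Lemma cabs_en n z : cabs (en n z) = expR (- (twopi * imC z)) ^+ n.
Proof.
rewrite enE cabs_cE -expRM_natr; congr expR.
have -> : forall w, reC (w *+ n) = reC w *+ n :> R.
  by move=> w; elim: n => [|k I1]; rewrite ?mulr0n // !mulrS reCD I1.
by rewrite reCM /= -mulr_natr; ring.
Qed.

Lemma expR_pow_small (c A e : R) : 0 < c -> 0 <= A -> 0 < e -> exists M : nat,
  A * expR (- c) ^+ M <= e.
Proof.
move=> c0 A0 e0.
pose M := (Num.truncn (A / (e * c))).+1; exists M.
have hM : A / (e * c) < M%:R.
  have h : 0 <= A / (e * c) by rewrite divr_ge0 // mulr_ge0 // ltW.
  by have /andP[] := Num.Theory.truncn_itv h.
have h1 : 1 + c * M%:R <= expR c ^+ M by rewrite -expRM_natr expR_ge1Dx.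
rewrite expRN exprVn ler_pdivrMr ?exprn_gt0 ?expR_gt0 //.
rewrite ltr_pdivrMr ?mulr_gt0 // in hM.
have : e * (1 + c * M%:R) <= e * expR c ^+ M by rewrite ler_wpM2l // ltW.
lra.
Qed.

Section Fixed.
Variables (a : nat -> R[i]) (f : R[i] -> R[i]).
Hypothesis af : fourier_exp a f.

Let Sum z M := \sum_(n < M) a n * en n z.

Lemma coef_bdd z : upper z -> exists A : R, 0 <= A /\ forall n, cabs (a n * en n z) <= A.
Proof.
move=> uz; have [M0 hM] := af uz ltr01.
exists (\sum_(n < M0) cabs (a n * en n z) + 2); split.
  by rewrite addr_ge0 // sumr_ge0 // => i _; exact: cabs_ge0.
move=> n; have [nM|nM] := ltnP n M0.
  rewrite (bigD1 (Ordinal nM)) //= -addrA lerDl addr_ge0 // sumr_ge0 // => i _; exact: cabs_ge0.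
have h1 := hM n nM; have h2 := hM n.+1 (leqW nM).
have -> : a n * en n z = (Sum z n.+1 - f z) - (Sum z n - f z).
  by rewrite /Sum big_ord_recr /=; ring.
have h3 : 0 <= \sum_(n < M0) cabs (a n * en n z) by rewrite sumr_ge0 // => i _; exact: cabs_ge0.
apply: le_trans (cabsD _ _) _; rewrite cabsN /Sum; lra.
Qed.

(** Convergence at the single height [y0 / 2] bounds the terms there; rising to height [y0] gains a
    fixed ratio [q < 1] per term, so the tails are uniformly geometric above [y0]. *)
Lemma qseries_tail (y0 : R) : 0 < y0 -> exists A c : R, 0 <= A /\ 0 < c /\
  forall z M, y0 <= imC z -> cabs (f z - Sum z M) <= A * expR (- c) ^+ M.
Proof.
move=> y00; pose y1 := y0 / 2.
have y10 : 0 < y1 by rewrite /y1; lra.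
have u1 : upper (Complex 0 y1) by exact: y10.
have [A [A0 hA]] := coef_bdd u1.
pose c := twopi * y1; have c0 : 0 < c by rewrite mulr_gt0 ?twopi_gt0.
pose q := expR (- c).
have q0 : 0 < q by exact: expR_gt0.
have q1 : q < 1 by rewrite /q -expR0 ltr_expR oppr_lt0.
exists (A / (1 - q)), c; split; first by rewrite divr_ge0 //; lra.
split=> // z M hz.
have uz : upper z by exact: lt_le_trans hz.
have term n : cabs (a n * en n z) <= A * q ^+ n.
  rewrite cabsM cabs_en.
  have e1 : expR (- (twopi * imC z)) <= expR (- (twopi * y1)) * q.
    rewrite /q -expRD ler_expR /c; have := twopi_gt0; have : y1 + y1 = y0 by rewrite /y1; lra.
    by move=> h1 h2; nra.
  have := hA n; rewrite cabsM cabs_en /= => h.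
  apply: (@le_trans _ _ (cabs (a n) * (expR (- (twopi * y1)) * q) ^+ n)).
    by rewrite ler_wpM2l ?cabs_ge0 // lerXn2r ?nnegrE ?mulr_ge0 ?expR_ge0.
  by rewrite exprMn mulrA ler_wpM2r // exprn_ge0 // ltW.
(* Carrying the exact geometric sum lets the induction close with an equality. *)
have part k : cabs (Sum z (M + k) - Sum z M) <= A / (1 - q) * q ^+ M * (1 - q ^+ k).
  elim: k => [|k IH]; first by rewrite addn0 subrr cabs0 expr0 subrr mulr0.
  have -> : Sum z (M + k.+1) - Sum z M = (Sum z (M + k) - Sum z M) + a (M + k)%N * en (M + k) z.
    by rewrite /Sum addnS big_ord_recr /=; ring.
  apply: le_trans (cabsD _ _) _; apply: le_trans (lerD IH (term _)) _.
  apply: eqW; rewrite exprD exprS; field; lra.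
apply/ler_addgt0Pr => e e0; have [M0 hM] := af uz e0.
have h1 := hM (M + M0)%N (leq_addl _ _); have h2 := part M0.
have -> : f z - Sum z M = (Sum z (M + M0) - Sum z M) - (Sum z (M + M0) - f z) by ring.
apply: le_trans (cabsD _ _) _; rewrite cabsN; apply: lerD; last exact: ltW h1.
apply: le_trans h2 _; rewrite -/q ler_piMr ?mulr_ge0 ?invr_ge0 ?exprn_ge0 ?(ltW q0) //; first by lra.
by rewrite gerBl exprn_ge0 // ltW.
Qed.

Lemma qseries_bdd (y0 : R) : 0 < y0 -> exists A : R, 0 <= A /\
  forall z, y0 <= imC z -> cabs (f z) <= A.
Proof.
move=> y00; have [A [c [A0 [c0 h]]]] := qseries_tail y00.
exists A; split=> // z hz; have := h z 0%N hz.
by rewrite /Sum big_ord0 subr0 expr0 mulr1.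
Qed.

Lemma qseries_approx z r : 0 <= r -> r < imC z -> poly_approx r (fun u => f (z + u)).
Proof.
move=> r0 rz e e0.
have y00 : 0 < imC z - r by lra.
have [A [c [A0 [c0 h]]]] := qseries_tail y00.
have e2 : 0 < e / 2 by lra.
have [M hM] := expR_pow_small c0 A0 e2.
have ap : poly_approx r (fun u => Sum (z + u) M).
  apply: (@poly_approx_sum R r M (fun n u => a n * en n (z + u))) => n _.
  apply: poly_approxM => //; first exact: poly_approx_cst.
  have E u : en n (z + u) = cE (Complex 0 twopi * z *+ n) * cE ((Complex 0 twopi *+ n) * u).
    by rewrite enE -cED; congr cE; rewrite mulrDr mulrnDl mulrnAl.
  apply: poly_approx_ext (fun u _ => esym (E u)) _.
  by apply: poly_approxM => //; [exact: poly_approx_cst|exact: poly_approx_cE].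
have [p hp] := ap _ e2; exists p => u hu.
have hu2 : imC z - r <= imC (z + u).
  rewrite imCD; have := imC_le u; rewrite ler_norml => /andP[]; lra.
have := h _ M hu2; have := hp u hu.
have := cabsBD (f (z + u)) (Sum (z + u) M) p.[u]; lra.
Qed.

End Fixed.
End QSeries.

(** * Behaviour near the maximum *)

Section PowR.
Variable R : realType.
Implicit Types (x y a b : R).

Lemma powR_exp a x : 0 < a -> a `^ x = expR (x * ln a).
Proof. by move=> a0; rewrite /powR gt_eqF. Qed.

Lemma powR_ratio y y' b : 0 < y -> y / 2 <= y' -> y' <= 2 * y ->
  y' `^ b <= 2 `^ `|b| * y `^ b.
Proof.
move=> y0 h1 h2; have y'0 : 0 < y' by lra.
rewrite !powR_exp // -expRD ler_expR.
have l1 : ln y' <= ln 2 + ln y by rewrite -lnM ?posrE // ler_ln ?posrE // mulr_gt0.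
have l2 : ln y <= ln 2 + ln y'.
  by rewrite -lnM ?posrE // ler_ln ?posrE ?mulr_gt0 //; lra.
have : b * (ln y' - ln y) <= `|b| * ln 2.
  apply: le_trans (ler_norm _) _; rewrite normrM ler_wpM2l // ler_norml.
  by apply/andP; split; lra.
by rewrite mulrBr; lra.
Qed.

(** For odd [m] one has [|m / 2| >= 1/2]; thus changing the height by a factor 2 in the right
    direction gains a definite factor, which is what limits the height of a near maximum. *)
Lemma powR_half b : 1 / 2 <= b -> 2 `^ (- b) <= 3 / 4 :> R.
Proof.
move=> hb; apply: (@le_trans _ _ (2 `^ (- (1/2)))).
  by apply: ler_powR; lra.
rewrite powRN div1r powR12_sqrt ?ler0n //.
have h : (4/3 : R) <= Num.sqrt 2.
  by rewrite -[4/3]ger0_norm ?divr_ge0 // -sqrtr_sqr ler_sqrt //; lra.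
rewrite -[3/4]invrK lef_pV2 ?posrE ?sqrtr_gt0 //; last by lra.
Qed.

(** Expansions [1 + a x + O(x^2)] are closed under products with the [a] adding up; it is enough to
    start from [1 + x] and from its inverse. *)
Lemma exprz_near1 (n : int) : exists K : R, 0 <= K /\ forall x : R[i], cabs x <= 1/8 ->
  cabs ((1 + x) ^ n - 1 - n%:~R * x) <= K * cabs x ^+ 2.
Proof.
have ne (x : R[i]) : cabs x <= 1/8 -> 1 + x != 0.
  move=> hx; rewrite -cabs_gt0; have := cabsD (1 + x) (- x).
  by rewrite addrK cabs1 cabsN; lra.
have mulp (phi psi : R[i] -> R[i]) (a b : R[i]) :
  (exists K : R, 0 <= K /\ forall x : R[i], cabs x <= 1/8 -> cabs (phi x - 1 - a * x) <= K * cabs x ^+ 2) ->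
  (exists K : R, 0 <= K /\ forall x : R[i], cabs x <= 1/8 -> cabs (psi x - 1 - b * x) <= K * cabs x ^+ 2) ->
  exists K : R, 0 <= K /\ forall x : R[i], cabs x <= 1/8 ->
     cabs (phi x * psi x - 1 - (a + b) * x) <= K * cabs x ^+ 2.
  move=> [K1 [K10 h1]] [K2 [K20 h2]].
  exists (K1 * (1 + cabs b + K2) + cabs a * cabs b + (1 + cabs a) * K2); split.
    by rewrite !(addr_ge0, mulr_ge0) ?cabs_ge0.
  move=> x hx; have := h1 x hx; have := h2 x hx.
  set e1 := phi x - 1 - a * x; set e2 := psi x - 1 - b * x => k2 k1.
  have -> : phi x * psi x - 1 - (a + b) * x =
     e1 * (1 + b * x + e2) + (a * b * (x * x)) + (1 + a * x) * e2.
    by rewrite /e1 /e2; ring.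
  have x0 := cabs_ge0 x.
  have x2 : cabs x ^+ 2 <= 1 by rewrite expr2; nra.
  have b1 : cabs (1 + b * x + e2) <= 1 + cabs b + K2.
    apply: le_trans (cabsD _ _) _; apply: lerD; last by apply: le_trans k2 _; rewrite ler_piMr.
    apply: le_trans (cabsD _ _) _; rewrite cabs1 cabsM lerD2l ler_piMr ?cabs_ge0 //; lra.
  have b2 : cabs (1 + a * x) <= 1 + cabs a.
    apply: le_trans (cabsD _ _) _; rewrite cabs1 cabsM lerD2l ler_piMr ?cabs_ge0 //; lra.
  rewrite [leRHS]mulrDl [X in _ <= X + _]mulrDl.
  apply: le_trans (cabsD _ _) _; apply: lerD.
    apply: le_trans (cabsD _ _) _; apply: lerD; rewrite !cabsM.
      apply: (@le_trans _ _ ((K1 * cabs x ^+ 2) * (1 + cabs b + K2))).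
        by rewrite ler_pM ?cabs_ge0.
      by apply: eqW; ring.
    by rewrite expr2.
  rewrite cabsM; apply: (@le_trans _ _ ((1 + cabs a) * (K2 * cabs x ^+ 2))).
    by rewrite ler_pM ?cabs_ge0.
  by apply: eqW; ring.
have nat k (phi : R[i] -> R[i]) (a : R[i]) :
  (exists K : R, 0 <= K /\ forall x : R[i], cabs x <= 1/8 -> cabs (phi x - 1 - a * x) <= K * cabs x ^+ 2) ->
  exists K : R, 0 <= K /\ forall x : R[i], cabs x <= 1/8 ->
     cabs (phi x ^+ k - 1 - (a *+ k) * x) <= K * cabs x ^+ 2.
  move=> h; elim: k => [|k IH].
    by exists 0; split=> // x _; rewrite expr0 mulr0n mul0r subrr subr0 cabs0 mul0r.
  have [K [K0 hK]] := mulp _ _ _ _ h IH.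
  by exists K; split=> // x hx; rewrite exprS mulrS; exact: hK.
case: n => k.
  have [] := nat k (fun x : R[i] => 1 + x) 1.
    by exists 0; split=> // x _; rewrite mul1r [1 + x]addrC addrK subrr cabs0 mul0r.
  move=> K [K0 hK]; exists K; split=> // x hx; exact: hK.
have [] := nat k.+1 (fun x : R[i] => (1 + x)^-1) (-1).
  exists 2; split=> // x hx.
  have -> : (1 + x)^-1 - 1 - -1 * x = x * x / (1 + x) by field; exact: ne.
  rewrite !cabsM cabsV expr2 mulrC ler_wpM2r ?mulr_ge0 ?cabs_ge0 //.
  have h : 1/2 <= cabs (1 + x).
    by have := cabsD (1 + x) (- x); rewrite addrK cabs1 cabsN; lra.
  rewrite -[2]invrK lef_pV2 ?posrE //; lra.
move=> K [K0 hK]; exists K; split=> // x hx.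
rewrite NegzE -exprnN -exprVn.
have -> : (- k.+1%:Z)%:~R = (-1 *+ k.+1) :> R[i] by rewrite mulrNz mulNrn.
exact: hK.
Qed.

End PowR.

(** * The action of integer matrices on the upper half plane *)

Section Mobius.
Variable R : realType.
Implicit Types (z w u : R[i]) (s t : mat2).

Lemma zCM (a b : int) : zC R (a * b) = zC R a * zC R b. Proof. by rewrite /zC rmorphM. Qed.
Lemma zCD (a b : int) : zC R (a + b) = zC R a + zC R b. Proof. by rewrite /zC rmorphD. Qed.
Lemma zCN (a : int) : zC R (- a) = - zC R a. Proof. by rewrite /zC rmorphN. Qed.

Lemma jfac_re s w : reC (jfac s w) = (mc s)%:~R * reC w + (md s)%:~R.
Proof. by rewrite /jfac !zCE reCD reCM /= mul0r subr0. Qed.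
Lemma jfac_im s w : imC (jfac s w) = (mc s)%:~R * imC w.
Proof. by rewrite /jfac !zCE imCD imCM /= mul0r !addr0. Qed.

Lemma jfac_neq0 s w : mdet s != 0 -> upper w -> jfac s w != 0.
Proof.
move=> ds uw; apply/eqP => /(congr1 (fun x => (reC x, imC x))).
rewrite jfac_re jfac_im /= => -[h1 /eqP].
rewrite mulf_eq0 (gt_eqF uw) orbF intr_eq0 => /eqP c0.
move: h1 ds; rewrite /mdet c0 mul0r add0r mulr0 subr0 => /eqP.
by rewrite intr_eq0 => /eqP ->; rewrite mulr0 eqxx.
Qed.

Lemma imC_mob s w : mdet s != 0 -> upper w ->
  imC (mob s w) = (mdet s)%:~R * imC w / cabs (jfac s w) ^+ 2.
Proof.
move=> ds uw; have j0 := jfac_neq0 ds uw.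
have cj : cabs (jfac s w) ^+ 2 != 0 by rewrite sqrf_eq0 cabs_eq0.
apply: (mulIf cj); rewrite divfK //.
have E : mob s w * jfac s w = zC R (ma s) * w + zC R (mb s) by rewrite divfK.
move: (mob s w) E => M E.
have := congr1 (fun x => (reC x, imC x)) E; rewrite !(reCM, imCM, reCD, imCD) !zCE /= => -[E1 E2].
rewrite cabs_sqr; move: E1 E2; rewrite jfac_re jfac_im /mdet ?jfac_re ?jfac_im !mul0r subr0 !addr0.
move: (reC M) (imC M) (reC w) (imC w) => u v x y E1 E2.
rewrite rmorphB !rmorphM /=.
set c := (mc s)%:~R in E1 E2 *; set d := (md s)%:~R in E1 E2 *; set a := (ma s)%:~R in E1 E2 *; set b := (mb s)%:~R in E1 E2 *.
have -> : v * ((c * x + d) ^+ 2 + (c * y) ^+ 2) =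
  (c * x + d) * (u * (c * y) + v * (c * x + d)) - (c * y) * (u * (c * x + d) - v * (c * y)) by ring.
by rewrite E1 E2; ring.
Qed.

Lemma upper_mob s w : 0 < mdet s -> upper w -> upper (mob s w).
Proof.
move=> ds uw; rewrite /upper imC_mob ?gt_eqF // !pmulr_lgt0 ?invr_gt0 ?ltr0z //.
by rewrite exprn_gt0 // cabs_gt0 jfac_neq0 // gt_eqF.
Qed.

Lemma SL2Z_det s : SL2Z s -> 0 < mdet s. Proof. by move=> ->. Qed.

Lemma mdetM s t : mdet (mmul s t) = mdet s * mdet t.
Proof. by case: s t => a b c d [a' b' c' d']; rewrite /mdet /=; ring. Qed.

Lemma jfacM s t w : mdet t != 0 -> upper w ->
  jfac (mmul s t) w = jfac s (mob t w) * jfac t w.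
Proof.
move=> dt uw; have j0 := jfac_neq0 dt uw.
rewrite {2}/jfac mulrDl /mob mulrA divfK // /jfac /= !(zCM, zCD).
by ring.
Qed.

Lemma mobM s t w : mdet s != 0 -> 0 < mdet t -> upper w ->
  mob (mmul s t) w = mob s (mob t w).
Proof.
move=> ds dt uw; have dt0 : mdet t != 0 by rewrite gt_eqF.
have j0 := jfac_neq0 dt0 uw; have j1 := jfac_neq0 ds (upper_mob dt uw).
rewrite {1}/mob jfacM // {2}/mob.
have -> : zC R (ma (mmul s t)) * w + zC R (mb (mmul s t)) =
   (zC R (ma s) * mob t w + zC R (mb s)) * jfac t w.
  by rewrite mulrDl /mob mulrA divfK // /jfac /= !(zCM, zCD); ring.
by rewrite -mulf_div divff // mulr1.
Qed.

Lemma mob_id w : mob mid w = w.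
Proof. by rewrite /mob /jfac /mid /= /zC !mul1r mul0r addr0 add0r divr1. Qed.

Lemma jfac_le s w : `|(mc s)%:~R| * imC w <= cabs (jfac s w).
Proof.
by apply: le_trans (imC_le _); rewrite jfac_im normrM ler_wpM2l // ler_norm.
Qed.

Lemma mob_shift s w u : mdet s != 0 -> upper w -> upper (w + u) ->
  mob s (w + u) - mob s w = zC R (mdet s) * u / (jfac s w * jfac s (w + u)).
Proof.
move=> ds uw uwu; have j0 := jfac_neq0 ds uw; have j1 := jfac_neq0 ds uwu.
move: j0 j1; rewrite /mob /jfac /mdet zCD zCN !zCM => j0 j1.
by field; rewrite j0 j1.
Qed.

End Mobius.

(** * Second-order expansion of the slashed square of a form with bounded [F^2] *)

Section LocalTaylor.
Variable R : realType.
Variable m : int.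
Local Notation al := (m%:~R / 2 : R).
Variables (f : R[i] -> R[i]) (B : R).
Hypothesis B0 : 0 <= B.
Hypothesis hf : holo_H f.
Hypothesis apf : forall z (r : R), 0 <= r -> r < imC z -> poly_approx r (fun u => f (z + u)).
Hypothesis supB : forall z, upper z -> imC z `^ al * cabs (f z) ^+ 2 <= B.

Local Notation A2 := (2 `^ `|al|).

Local Notation S2 z := (B * A2 * imC z `^ (- al)).

Lemma S2_ge0 z : 0 <= S2 z.
Proof. by rewrite !mulr_ge0 ?powR_ge0. Qed.

Lemma f_local_bound z v : upper z -> cabs v <= imC z / 2 ->
  cabs (f (z + v)) ^+ 2 <= S2 z.
Proof.
move=> uz hv; rewrite /upper in uz.
have := imC_le v; rewrite ler_norml => /andP[v1 v2].
have y1 : imC z / 2 <= imC (z + v) by rewrite imCD; lra.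
have y2 : imC (z + v) <= 2 * imC z by rewrite imCD; lra.
have uzv : upper (z + v) by rewrite /upper; lra.
have p0 : 0 < imC (z + v) `^ al by rewrite powR_gt0.
have h1 := supB uzv.
have h2 := powR_ratio (- al) uz y1 y2; rewrite normrN in h2.
apply: (@le_trans _ _ (B * imC (z + v) `^ (- al))).
  by rewrite powRN ler_pdivlMr // mulrC.
by rewrite -mulrA ler_wpM2l.
Qed.

Lemma f2_taylor z : upper z -> exists P1 : R[i],
  [/\ cabs (f z) ^+ 2 <= S2 z, cabs P1 * imC z <= 20 * S2 z &
   forall v, cabs v <= imC z / 4 ->
   cabs (f (z + v) ^+ 2 - f z ^+ 2 - P1 * v) <= 160 * S2 z * (cabs v / imC z) ^+ 2].
Proof.
move=> uz; have [L hL] := hf uz; rewrite /upper in uz.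
pose S := Num.sqrt (S2 z).
have S0 : 0 <= S by rewrite sqrtr_ge0.
have SS : S2 z = S ^+ 2 by rewrite sqr_sqrtr // S2_ge0.
have fS u : cabs u <= imC z / 2 -> cabs (f (z + u)) <= S.
  move=> hu; rewrite -(ler_pXn2r (n := 2)) ?nnegrE ?cabs_ge0 // -SS.
  exact: f_local_bound.
have r0 : 0 < imC z / 2 by lra.
have r1 : imC z / 2 < imC z by lra.
have tay := taylor2 r0 (apf (ltW r0) r1) fS hL.
have fz : cabs (f z) <= S by have := fS 0; rewrite addr0 cabs0; apply; lra.
have ty u : cabs u <= imC z / 4 -> cabs (f (z + u) - f z - L * u) <= 8 * S * (cabs u / imC z) ^+ 2.
  move=> hu; apply: le_trans (tay u ltac:(lra)) _; apply: eqW; field; lra.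
(* At the real shift [y / 4] the expansion gives [|L| y / 4 <= 2 S + S / 2]. *)
have Lb : cabs L * imC z <= 10 * S.
  pose u : R[i] := rC (imC z / 4).
  have cu : cabs u = imC z / 4 by rewrite cabs_rC ger0_norm //; lra.
  have h1 := ty u ltac:(rewrite cu //); have h2 := fS u ltac:(rewrite cu; lra).
  have h3 : cabs (L * u) <= S + S + 8 * S * (cabs u / imC z) ^+ 2.
    have -> : L * u = f (z + u) - f z - (f (z + u) - f z - L * u) by ring.
    apply: le_trans (cabsD _ _) _; rewrite cabsN lerD //.
    by apply: le_trans (cabsD _ _) _; rewrite cabsN lerD.
  rewrite cabsM cu (_ : imC z / 4 / imC z = 1 / 4) in h3; last by field; lra.
  rewrite expr2 in h3; lra.
exists (2 * f z * L); split.
- by rewrite SS lerXn2r ?nnegrE ?cabs_ge0.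
- rewrite !cabsM SS -[X in cabs X]/(zC R 2) cabs_zC normr_nat.
  have : cabs (f z) * (cabs L * imC z) <= S * (10 * S).
    by rewrite ler_pM ?cabs_ge0 // mulr_ge0 ?cabs_ge0 // ltW.
  by rewrite expr2; lra.
move=> v hv; have := ty v hv; set e := f (z + v) - f z - L * v => he.
have -> : f (z + v) ^+ 2 - f z ^+ 2 - 2 * f z * L * v =
   (L * v) * (L * v) + (2 * (f z + L * v)) * e + e * e by rewrite /e; ring.
set t := cabs v / imC z in he *.
have t0 : 0 <= t by rewrite divr_ge0 ?cabs_ge0 // ltW.
have t1 : t <= 1/4 by rewrite /t ler_pdivrMr //; lra.
have lv : cabs (L * v) <= 10 * S * t.
  rewrite cabsM; have -> : cabs v = imC z * t by rewrite /t mulrC divfK // gt_eqF.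
  by rewrite mulrA ler_wpM2r.
have fl : cabs (2 * (f z + L * v)) <= 2 * (S + 10 * S * t).
  rewrite cabsM -[X in cabs X]/(zC R 2) cabs_zC normr_nat ler_pM2l //.
  by apply: le_trans (cabsD _ _) _; rewrite lerD.
(* For [t <= 1/4] the three terms are at most 100, [16 + 160 t <= 56] and [64 t^2 <= 4] times
   [S^2 t^2], which add up to the 160 of the statement. *)
apply: le_trans (cabsD _ _) _; rewrite SS.
have q1 : cabs (L * v * (L * v)) <= (10 * S * t) * (10 * S * t).
  by rewrite cabsM ler_pM ?cabs_ge0.
have q2 : cabs (2 * (f z + L * v) * e) <= 2 * (S + 10 * S * t) * (8 * S * t ^+ 2).
  by rewrite cabsM ler_pM ?cabs_ge0.
have q3 : cabs (e * e) <= (8 * S * t ^+ 2) * (8 * S * t ^+ 2).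
  by rewrite cabsM ler_pM ?cabs_ge0.
have q4 := cabsD (L * v * (L * v)) (2 * (f z + L * v) * e).
have q5 : 0 <= S * S * t * t by clearbody S t; rewrite !mulr_ge0.
have q6 : S * S * t * t * t <= S * S * t * t * (1/4) by rewrite ler_wpM2l.
have q7 : S * S * t * t * (t * t) <= S * S * t * t * (1/16).
  rewrite ler_wpM2l //; have : t * t <= 1/4 * (1/4) by rewrite ler_pM.
  by lra.
apply: le_trans (lerD q4 (lexx _)) _; apply: le_trans (lerD (lerD q1 q2) q3) _.
rewrite !expr2; lra.
Qed.

(** The integer-weight slash of [f^2], without the determinant factor; that factor reappears in the
    bound [Bs]. *)
Definition slashed (s : mat2) (w : R[i]) : R[i] := f (mob s w) ^+ 2 * jfac s w ^ (- m).

Local Notation Bs s := (B * (mdet s)%:~R `^ (- al)).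

Lemma S2_jfac s w : 0 < mdet s -> upper w ->
  S2 (mob s w) * cabs (jfac s w) ^ (- m) = A2 * (Bs s * imC w `^ (- al)).
Proof.
move=> ds uw; have ds0 : mdet s != 0 by rewrite gt_eqF.
have j0 : 0 < cabs (jfac s w) by rewrite cabs_gt0 jfac_neq0.
have dR : 0 < (mdet s)%:~R :> R by rewrite ltr0z.
rewrite imC_mob // -powR_intmul ?cabs_ge0 // powRM ?divr_ge0 ?mulr_ge0 ?(ltW uw) ?(ltW dR) ?invr_ge0 ?exprn_ge0 ?cabs_ge0 //.
rewrite powRM ?(ltW uw) ?(ltW dR) //.
have -> : (cabs (jfac s w) ^+ 2)^-1 `^ (- al) = cabs (jfac s w) `^ (m%:~R).
  rewrite -powR_mulrn ?cabs_ge0 // -powRN -powRrM; congr (_ `^ _).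
  by field.
have -> : (- m)%:~R = - m%:~R :> R by rewrite rmorphN.
rewrite (powRN (cabs _)).
have := powR_gt0 m%:~R j0; set q := _ `^ m%:~R => q0.
by field; rewrite gt_eqF.
Qed.

Lemma slashed_norm s w : 0 < mdet s -> upper w ->
  (mdet s)%:~R `^ al * (imC w `^ al * cabs (slashed s w)) =
  imC (mob s w) `^ al * cabs (f (mob s w)) ^+ 2.
Proof.
move=> ds uw; have ds0 : mdet s != 0 by rewrite gt_eqF.
have j0 : 0 < cabs (jfac s w) by rewrite cabs_gt0 jfac_neq0.
have dR : 0 < (mdet s)%:~R :> R by rewrite ltr0z.
rewrite /slashed cabsM cabsX cabsXz imC_mob // -powR_intmul ?cabs_ge0 //.
rewrite powRM ?divr_ge0 ?mulr_ge0 ?(ltW uw) ?(ltW dR) ?invr_ge0 ?exprn_ge0 ?cabs_ge0 //.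
rewrite powRM ?(ltW uw) ?(ltW dR) //.
have -> : (cabs (jfac s w) ^+ 2)^-1 `^ al = cabs (jfac s w) `^ (- m)%:~R.
  rewrite -powR_mulrn ?cabs_ge0 // -powRN -powRrM; congr (_ `^ _).
  by rewrite rmorphN /=; field.
by ring.
Qed.

Lemma slashed_le s w : 0 < mdet s -> upper w ->
  cabs (slashed s w) <= Bs s * imC w `^ (- al).
Proof.
move=> ds uw; have dR : 0 < (mdet s)%:~R :> R by rewrite ltr0z.
have := supB (upper_mob ds uw); rewrite -slashed_norm //.
have := powR_gt0 al dR; have := powR_gt0 al (uw : 0 < imC w).
rewrite !powRN; set p := imC w `^ al; set q := _ `^ al => p0 q0 h.
rewrite -mulrA -invfM ler_pdivlMr ?mulr_gt0 //.
by apply: le_trans h; apply: eqW; ring.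
Qed.

(** With [x = c u / j] the automorphy factor at [w + u] is [j (1 + x)] and the image point is
    [z + v0 / (1 + x)]; the exponents [-m] and [-m - 1] therefore both occur. Since [|x| <= t] and
    [|v0| = t Im z] for [t = |u| / Im w], the relative size of the displacement is preserved and the
    constants do not depend on [s]. *)
Lemma slashed_taylor (K1 K2 : R) (s : mat2) w : 0 <= K1 -> 0 <= K2 ->
  (forall x : R[i], cabs x <= 1/8 ->
    cabs ((1 + x) ^ (- m) - 1 - (- m)%:~R * x) <= K1 * cabs x ^+ 2) ->
  (forall x : R[i], cabs x <= 1/8 ->
    cabs ((1 + x) ^ (- m - 1) - 1 - (- m - 1)%:~R * x) <= K2 * cabs x ^+ 2) ->
  0 < mdet s -> upper w ->
  exists h1 : R[i], forall u, cabs u <= imC w / 8 ->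
    cabs (slashed s (w + u) - slashed s w - h1 * u) <=
    (K1 + 20 * (`|m%:~R| + 1 + K2) + 210 * (1 + `|m%:~R| + K1)) * A2 *
      (cabs u / imC w) ^+ 2 * (Bs s * imC w `^ (- al)).
Proof.
move=> K10 K20 hK1 hK2 ds uw; have ds0 : mdet s != 0 by rewrite gt_eqF.
have j0 := jfac_neq0 ds0 uw; have uz := upper_mob ds uw.
have [P1 [bP0 bP1 tay]] := f2_taylor uz.
set z := mob s w in uz bP0 bP1 tay *; set j := jfac s w in j0 *.
set P0 := f z ^+ 2 in tay.
pose c := zC R (mc s); pose D := zC R (mdet s).
exists ((- m%:~R * P0 * c / j + P1 * D / j ^+ 2) * j ^ (- m)) => u hu.
have yw : 0 < imC w by exact: uw.
pose t := cabs u / imC w; have t0 : 0 <= t by rewrite divr_ge0 ?cabs_ge0 // ltW.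
have t8 : t <= 1/8 by rewrite /t ler_pdivrMr //; lra.
have uwu : upper (w + u).
  by have := imC_le u; rewrite /upper imCD ler_norml => /andP[]; lra.
pose x := c * u / j.
have jc : 0 < cabs j by rewrite cabs_gt0.
have xt : cabs x <= t.
  rewrite /x /t !cabsM cabsV cabs_zC ler_pdivrMr // mulrAC ler_pdivlMr //.
  by have := jfac_le s w; rewrite -/j => h; rewrite mulrAC mulrC ler_wpM2l ?cabs_ge0.
have x8 : cabs x <= 1/8 by exact: le_trans xt t8.
have x1 : 7/8 <= cabs (1 + x).
  by have := cabsD (1 + x) (- x); rewrite addrK cabs1 cabsN; lra.
have x1n : 1 + x != 0 by rewrite -cabs_gt0; lra.
have jE : jfac s (w + u) = j * (1 + x).
  by rewrite /x mulrDr mulr1 [j * _]mulrC divfK // /j /jfac /c; ring.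
pose v0 := D * u / j ^+ 2.
have Ez : mob s (w + u) = z + v0 / (1 + x).
  have := mob_shift ds0 uw uwu; rewrite jE -/j -/z -/D => E.
  rewrite -[LHS](subrK z) E addrC; congr (_ + _); rewrite /v0.
  by field; rewrite x1n j0.
have imz : imC z = (mdet s)%:~R * imC w / cabs j ^+ 2 by exact: imC_mob.
have dR : 0 < (mdet s)%:~R :> R by rewrite ltr0z.
have v0t : cabs v0 = t * imC z.
  rewrite /v0 !cabsM cabsV cabsX /D cabs_zC gtr0_norm // imz /t.
  by field; rewrite !gt_eqF.
have yz : 0 < imC z by exact: uz.
pose v := v0 / (1 + x).
have vt : cabs v <= 8/7 * t * imC z.
  rewrite /v cabsM cabsV v0t ler_pdivrMr; last by lra.
  have : 0 <= t * imC z by rewrite mulr_ge0 // ltW.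
  nra.
have vz : cabs v <= imC z / 4 by apply: le_trans vt _; nra.
have te := tay v vz; set E := f (z + v) ^+ 2 - P0 - P1 * v in te.
(* Division by [1 + x] costs at most [8/7], and [160 (8/7)^2 < 210]. *)
have hE : cabs E <= 210 * t ^+ 2 * S2 z.
  apply: le_trans te _.
  have r1 : cabs v / imC z <= 8/7 * t by rewrite ler_pdivrMr.
  have r0 : 0 <= cabs v / imC z by rewrite divr_ge0 ?cabs_ge0 // ltW.
  have := S2_ge0 z; move: (B * _ * _) => S S0; move: (cabs v / imC z) r0 r1 => r r0 r1.
  have : r * r <= 8/7 * t * (8/7 * t) by rewrite ler_pM.
  have : 0 <= t * t by rewrite mulr_ge0.
  rewrite !expr2 => h0 h; have h1 : 160 * (r * r) <= 210 * (t * t) by lra.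
  have : 160 * (r * r) * S <= 210 * (t * t) * S by rewrite ler_wpM2r.
  lra.
pose e1 := (1 + x) ^ (- m) - 1 - (- m)%:~R * x.
pose e2 := (1 + x) ^ (- m - 1) - 1 - (- m - 1)%:~R * x.
have he1 : cabs e1 <= K1 * t ^+ 2.
  by apply: le_trans (hK1 x x8) _; rewrite ler_wpM2l // lerXn2r ?nnegrE ?cabs_ge0.
have he2 : cabs e2 <= K2 * t ^+ 2.
  by apply: le_trans (hK2 x x8) _; rewrite ler_wpM2l // lerXn2r ?nnegrE ?cabs_ge0.
have p1 : (1 + x) ^ (- m - 1) = (1 + x) ^ (- m) / (1 + x) by rewrite expfzDr.
(* The terms linear in [u] cancel identically; each remaining summand contains two small factors, or
   one of the second-order errors [e1], [e2], [E]. *)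
have key : slashed s (w + u) - slashed s w -
    (- m%:~R * P0 * c / j + P1 * D / j ^+ 2) * j ^ (- m) * u =
    (P0 * e1 + P1 * v0 * ((- m - 1)%:~R * x + e2) + E * (1 + x) ^ (- m)) * j ^ (- m).
  rewrite /slashed jE Ez -/v -/z -/j expfzMl.
  have -> : f (z + v) ^+ 2 = P0 + P1 * v + E by rewrite /E; ring.
  have -> : (- m - 1)%:~R * x + e2 = (1 + x) ^ (- m) / (1 + x) - 1 by rewrite -p1 /e2; ring.
  have -> : (- m%:~R * P0 * c / j + P1 * D / j ^+ 2) * j ^ (- m) * u =
     (- m%:~R * P0 * x + P1 * v0) * j ^ (- m) by rewrite /x /v0; ring.
  rewrite /e1 rmorphN /= /v -/P0.
  move: ((1 + x) ^ (- m)) (j ^ (- m)) => q J; ring.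
rewrite key cabsM cabsXz.
have m0 : 0 <= `|m%:~R| :> R by [].
set am := `|m%:~R| : R in m0 *.
have cm (n : int) : cabs (n%:~R : R[i]) = `|n%:~R| by rewrite -[X in cabs X]/(zC R n) cabs_zC.
have t1 : t ^+ 2 <= t by rewrite expr2; nra.
have hq : cabs ((1 + x) ^ (- m)) <= 1 + am + K1.
  have -> : (1 + x) ^ (- m) = 1 + (- m)%:~R * x + e1 by rewrite /e1; ring.
  apply: le_trans (cabsD _ _) _; apply: lerD; last by apply: le_trans he1 _; nra.
  apply: le_trans (cabsD _ _) _; rewrite cabs1 cabsM cm rmorphN /= normrN -/am.
  by rewrite lerD2l ler_piMr //; lra.
have hr : cabs ((- m - 1)%:~R * x + e2) <= (am + 1 + K2) * t.
  apply: le_trans (cabsD _ _) _; rewrite cabsM cm.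
  have : `|(- m - 1)%:~R : R| <= am + 1.
    rewrite rmorphB rmorphN /=; apply: le_trans (ler_normB _ _) _.
    by rewrite normrN normr1.
  move=> h; have : `|(- m - 1)%:~R : R| * cabs x <= (am + 1) * t by rewrite ler_pM ?cabs_ge0.
  have : K2 * t ^+ 2 <= K2 * t by rewrite ler_wpM2l.
  by rewrite (mulrDl (am + 1)); lra.
have hpv : cabs (P1 * v0) <= 20 * S2 z * t.
  by rewrite cabsM v0t mulrCA mulrC ler_wpM2r.
have S2p := S2_ge0 z.
have J0 : 0 <= cabs j ^ (- m) by rewrite exprz_ge0 ?cabs_ge0.
have main : cabs (P0 * e1 + P1 * v0 * ((- m - 1)%:~R * x + e2) + E * (1 + x) ^ (- m)) <=
   (K1 + 20 * (am + 1 + K2) + 210 * (1 + am + K1)) * t ^+ 2 * S2 z.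
  apply: le_trans (cabsD _ _) _; apply: le_trans (lerD (cabsD _ _) (lexx _)) _.
  have b1 : cabs (P0 * e1) <= S2 z * (K1 * t ^+ 2).
    by rewrite cabsM ler_pM ?cabs_ge0 // /P0 cabsX.
  have b2 : cabs (P1 * v0 * ((- m - 1)%:~R * x + e2)) <= (20 * S2 z * t) * ((am + 1 + K2) * t).
    by rewrite cabsM ler_pM ?cabs_ge0.
  have b3 : cabs (E * (1 + x) ^ (- m)) <= (210 * t ^+ 2 * S2 z) * (1 + am + K1).
    by rewrite cabsM ler_pM ?cabs_ge0.
  apply: le_trans (lerD (lerD b1 b2) b3) _; apply: eqW; ring.
apply: (@le_trans _ _ ((K1 + 20 * (am + 1 + K2) + 210 * (1 + am + K1)) * t ^+ 2 * S2 z * cabs j ^ (- m))).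
  by rewrite ler_wpM2r.
by rewrite -(mulrA _ (S2 z)) S2_jfac // /t /am; apply: eqW; ring.
Qed.

End LocalTaylor.

Section NearMaximum.
Variable R : realType.
Variables (al C2 : R).
Hypotheses (C20 : 0 <= C2) (al12 : 1 / 2 <= `|al|).
Local Notation A2 := (2 `^ `|al|).

(* The quadratic bound replaces Cauchy's estimate for the second derivative of a
   holomorphic function of weight [2 al] whose sup norm is [B] *)
Definition tame (B : R) (h : R[i] -> R[i]) : Prop :=
  (forall w, upper w -> cabs (h w) <= B * imC w `^ (- al)) /\
  (forall w, upper w -> exists h1 : R[i], forall u, cabs u <= imC w / 8 ->
    cabs (h (w + u) - h w - h1 * u) <= C2 * (cabs u / imC w) ^+ 2 * (B * imC w `^ (- al))).

Lemma A2ge1 : 1 <= A2.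
Proof. by rewrite -[leLHS](powRr0 2) ler_powR // ler1n. Qed.

(** At [u = W] periodicity annihilates the difference, so [|h1| W] is itself bounded by the
    quadratic error. *)
Lemma periodic_deriv_le (B W : R) h w (h1 : R[i]) : 0 <= B -> 0 < W -> upper w ->
  (forall u, cabs u <= imC w / 8 ->
    cabs (h (w + u) - h w - h1 * u) <= C2 * (cabs u / imC w) ^+ 2 * (B * imC w `^ (- al))) ->
  h (w + rC W) = h w -> W <= imC w / 8 ->
  cabs h1 * imC w <= C2 * (W / imC w) * (B * imC w `^ (- al)).
Proof.
move=> B0 W0 uw H E hW; have cW : cabs (rC W) = W by rewrite cabs_rC gtr0_norm.
rewrite /upper in uw.
have := H (rC W); rewrite cW E subrr add0r cabsN cabsM cW => /(_ hW) h2.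
have -> : C2 * (W / imC w) * (B * imC w `^ (- al)) =
  C2 * (W / imC w) ^+ 2 * (B * imC w `^ (- al)) * (imC w / W) by field; rewrite !gt_eqF.
have -> : cabs h1 * imC w = cabs h1 * W * (imC w / W) by field; rewrite gt_eqF.
by rewrite ler_wpM2r // divr_ge0 // ltW.
Qed.

(** Each of the [n] steps has relative length at most [2 / n]. Its linear part costs a multiple of
    [(W / y) / n] by periodicity, its quadratic part a multiple of [1 / n^2]; the telescoping sum
    gives [W / y + 1 / n]. *)
Lemma vertical_move (B W y : R) h x (s : R) n : 0 <= B -> 0 < W -> 0 < y ->
  tame B h -> (forall w, upper w -> h (w + rC W) = h w) ->
  (16 <= n)%N -> `|s| * n%:R <= y -> W <= y / 16 ->
  (forall k, (k <= n)%N -> y / 2 <= y + k%:R * s <= 2 * y) ->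
  cabs (h (Complex x (y + n%:R * s)) - h (Complex x y)) <=
    4 * C2 * A2 * (W / y + n%:R^-1) * (B * y `^ (- al)).
Proof.
move=> B0 W0 y0 [hB hT] per n16 sn Wy rng.
have n0 : 0 < n%:R :> R by rewrite ltr0n; lia.
have n16R : 16 <= n%:R :> R by rewrite ler_nat.
pose Q := n%:R^-1 * (4 * C2 * A2 * (W / y + n%:R^-1) * (B * y `^ (- al))).
have step k : (k < n)%N -> cabs (h (Complex x (y + k.+1%:R * s)) - h (Complex x (y + k%:R * s))) <= Q.
  move=> kn; have /andP[r1 r2] := rng k (ltnW kn).
  set w := Complex x (y + k%:R * s); pose u : R[i] := Complex 0 s.
  have yw : imC w = y + k%:R * s by [].
  have -> : Complex x (y + k.+1%:R * s) = w + u.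
    by apply: complex_eq; rewrite ?reCD ?imCD /= -?natr1; ring.
  have uw : upper w by rewrite /upper yw; lra.
  have cu : cabs u = `|s| by rewrite /cabs /= expr0n add0r sqrtr_sqr.
  have su : `|s| <= y / n%:R by rewrite ler_pdivlMr.
  have yn : y / n%:R <= y / 16 by rewrite ler_pM2l // lef_pV2 ?posrE.
  have hu : cabs u <= imC w / 8 by rewrite cu yw; lra.
  have [h1 H] := hT w uw; have := H u hu.
  have := periodic_deriv_le B0 W0 uw H (per w uw) ltac:(rewrite yw; lra).
  have pr := powR_ratio (- al) y0 r1 r2; rewrite normrN -yw in pr.
  set P := B * imC w `^ (- al); set P' := B * y `^ (- al).
  have PP : P <= A2 * P' by rewrite /P /P' mulrCA ler_wpM2l.
  have P0 : 0 <= P by rewrite mulr_ge0 ?powR_ge0.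
  have P'0 : 0 <= P' by rewrite mulr_ge0 ?powR_ge0.
  rewrite cu => d1 d2.
  have yw0 : 0 < imC w by exact: uw.
  have -> : h (w + u) - h w = h1 * u + (h (w + u) - h w - h1 * u) by ring.
  apply: le_trans (cabsD _ _) _; rewrite cabsM cu.
  have iy : (imC w)^-1 <= 2 / y.
    by rewrite -[2 / y]invf_div lef_pV2 ?posrE ?divr_gt0 // yw.
  have iy0 : 0 <= (imC w)^-1 by rewrite invr_ge0 ltW.
  have t1 : `|s| / imC w <= 2 / n%:R.
    apply: (@le_trans _ _ (y / n%:R * (2 / y))); first by rewrite ler_pM.
    by apply: eqW; field; rewrite !gt_eqF.
  have t2 : W / imC w <= 2 * (W / y).
    by rewrite mulrCA ler_wpM2l // ltW.
  have e1 : cabs h1 * `|s| <= 4 * n%:R^-1 * C2 * (W / y) * (A2 * P').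
    have -> : cabs h1 * `|s| = cabs h1 * imC w * (`|s| / imC w) by field; rewrite gt_eqF.
    apply: (@le_trans _ _ (C2 * (2 * (W / y)) * (A2 * P') * (2 / n%:R))); last by apply: eqW; ring.
    have Wy0 : 0 <= W / y by rewrite divr_ge0 // ltW.
    have a0 : 0 <= A2 by rewrite powR_ge0.
    apply: ler_pM => //; rewrite ?mulr_ge0 ?cabs_ge0 ?(ltW yw0) //.
    apply: le_trans d1 _; apply: ler_pM => //; last by rewrite ler_wpM2l.
    by rewrite !mulr_ge0 // ltW.
  have e2 : C2 * (`|s| / imC w) ^+ 2 * P <= C2 * (4 * (n%:R^-1 * n%:R^-1)) * (A2 * P').
    have s0 : 0 <= `|s| / imC w by rewrite mulr_ge0.
    apply: ler_pM => //; first by rewrite mulr_ge0 // sqr_ge0.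
    rewrite ler_wpM2l // expr2.
    apply: le_trans (ler_pM s0 s0 t1 t1) _; apply: eqW; ring.
  apply: le_trans (lerD e1 (le_trans d2 e2)) _.
  by apply: eqW; rewrite /Q -/P'; ring.
have tele k : (k <= n)%N -> cabs (h (Complex x (y + k%:R * s)) - h (Complex x y)) <= k%:R * Q.
  elim: k => [|k IH] kn; first by rewrite mul0r addr0 subrr cabs0 mul0r.
  apply: le_trans (cabsBD _ (h (Complex x (y + k%:R * s))) _) _.
  have -> : k.+1%:R * Q = Q + k%:R * Q by rewrite -natr1 (mulrDl _ _ Q) mul1r addrC.
  apply: lerD; first exact: step.
  exact: IH (ltnW kn).
apply: le_trans (tele n (leqnn n)) _.
by rewrite /Q mulrA mulfV ?mul1r // gt_eqF.
Qed.

(** High above the width, [h] hardly varies between heights [y] and [2 y] (or [y / 2]), while the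
    bound by [B] at the far end, with the weight factor of [y], loses a factor [3/4]. *)
Lemma cusp_small : exists C3 : R, 16 <= C3 /\ forall (B W : R) h, 0 <= B -> 0 < W ->
  tame B h -> (forall w, upper w -> h (w + rC W) = h w) ->
  forall w, upper w -> C3 * W <= imC w -> imC w `^ al * cabs (h w) <= 9 / 10 * B.
Proof.
have a1 := A2ge1.
(* From [W / y <= 1 / n] the variation is at most [8 C2 A2 / n <= 1/10]; together with [3/4] this
   stays below [9/10]. The same [n] serves as the constant [C3]. *)
pose n := (16 + Num.truncn (80 * C2 * A2)).+1.
have CA0 : 0 <= C2 * A2 by rewrite mulr_ge0 // powR_ge0.
have nb : 80 * C2 * A2 <= n%:R.
  have h : 0 <= 80 * C2 * A2 by rewrite -mulrA mulr_ge0.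
  have /andP[_ h2] := Num.Theory.truncn_itv h.
  by apply: le_trans (ltW h2) _; rewrite /n ler_nat; lia.
have n16 : (16 <= n)%N by rewrite /n; lia.
have n0 : 0 < n%:R :> R by rewrite ltr0n; lia.
have n16R : 16 <= n%:R :> R by rewrite ler_nat.
exists (n%:R); split=> // B W h B0 W0 tm per [x y] uw; rewrite /= => hW.
have y0 : 0 < y by exact: uw.
have Wn : W / y <= n%:R^-1.
  rewrite ler_pdivrMr // mulrC ler_pdivlMr //; lra.
have W16 : W <= y / 16.
  have : W * 16 <= n%:R * W by rewrite mulrC ler_pM2r.
  by move=> h16; rewrite ler_pdivlMr //; lra.
have hB := tm.1.
have half : 2 `^ (- `|al|) <= 3 / 4 :> R by exact: powR_half.
(* The move ends at [2 y] for positive weight and at [y / 2] for negative weight; both times the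
   weight ratio is [2^(-|al|)]. *)
pose s := if 0 <= al then y / n%:R else - (y / n%:R / 2).
have yn0 : 0 < y / n%:R by rewrite divr_gt0.
have ynn : y / n%:R * n%:R = y by rewrite divfK // gt_eqF.
have sn : `|s| * n%:R <= y.
  rewrite /s; case: ifP => _; first by rewrite gtr0_norm // ynn.
  rewrite normrN gtr0_norm; last by lra.
  by rewrite mulrAC ynn; lra.
have rng k : (k <= n)%N -> y / 2 <= y + k%:R * s <= 2 * y.
  move=> kn; have kR : k%:R <= n%:R :> R by rewrite ler_nat.
  have : 0 <= k%:R * (y / n%:R) by rewrite mulr_ge0 // ltW.
  have : k%:R * (y / n%:R) <= y by rewrite -[leRHS]ynn mulrC ler_pM2l.
  move=> h1 h2; rewrite /s; case: ifP => _; apply/andP; split; lra.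
have mv := vertical_move x B0 W0 y0 tm per n16 sn W16 rng.
set y' := y + n%:R * s in mv.
have y'0 : 0 < y' by have /andP[] := rng n (leqnn n); rewrite -/y'; lra.
have ey : y `^ al * y' `^ (- al) <= 3 / 4.
  apply: le_trans half; apply: eqW.
  rewrite !powR_exp // -expRD; congr expR.
  have ysy : n%:R * s = if 0 <= al then y else - (y / 2).
    rewrite /s; case: ifP => _; first by rewrite mulrC.
    by rewrite mulrN mulrA [n%:R * _]mulrC ynn.
  rewrite /y' ysy; case: ifPn => al0.
    by rewrite (_ : y + y = 2 * y) ?lnM ?posrE // ?ger0_norm //; ring.
  rewrite ltr0_norm ?ltNge // (_ : y + - (y / 2) = y / 2); last by field.
  by rewrite ln_div ?posrE //; ring.
have hy' := hB (Complex x y') y'0; rewrite /= in hy'.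
have yp : 0 < y `^ al by rewrite powR_gt0.
have h1 : cabs (h (Complex x y)) <= B * y' `^ (- al) + 4 * C2 * A2 * (W / y + n%:R^-1) * (B * y `^ (- al)).
  have -> : h (Complex x y) = h (Complex x y') - (h (Complex x y') - h (Complex x y)) by ring.
  by apply: le_trans (cabsD _ _) _; rewrite cabsN lerD.
apply: (@le_trans _ _ (y `^ al * (B * y' `^ (- al) + 4 * C2 * A2 * (W / y + n%:R^-1) * (B * y `^ (- al))))).
  by rewrite ler_pM2l.
have -> : y `^ al * (B * y' `^ (- al) + 4 * C2 * A2 * (W / y + n%:R^-1) * (B * y `^ (- al)))
  = B * (y `^ al * y' `^ (- al)) + 4 * C2 * A2 * (W / y + n%:R^-1) * B.
  have pp : y `^ al * y `^ (- al) = 1 by rewrite powRN divff // gt_eqF.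
  by move: (4 * C2 * A2 * _) => E; rewrite -[X in _ = _ + X]mulr1 -pp; ring.
have e1 : B * (y `^ al * y' `^ (- al)) <= B * (3/4) by rewrite ler_wpM2l.
have e2 : 4 * C2 * A2 * (W / y + n%:R^-1) <= 1/10.
  apply: (@le_trans _ _ (4 * C2 * A2 * (2 * n%:R^-1))).
    rewrite ler_wpM2l ?mulr_ge0 ?powR_ge0 //; first by lra.
  rewrite mulrA ler_pdivrMr //; lra.
have : 4 * C2 * A2 * (W / y + n%:R^-1) * B <= 1/10 * B by rewrite ler_wpM2r.
lra.
Qed.

(** The coefficient [h1] is bounded by testing the expansion at the real shift [Im w / 8], which
    does not change the height. *)
Lemma tame_lipschitz B h w u : 0 <= B -> tame B h -> upper w -> cabs u <= imC w / 8 ->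
  cabs (h (w + u) - h w) <= (8 * A2 + 8 + C2) * (cabs u / imC w) * (B * imC w `^ (- al)).
Proof.
move=> B0 [hB hT] uw hu; have [h1 H] := hT w uw; have y0 : 0 < imC w by exact: uw.
set P := B * imC w `^ (- al) in H *.
have P0 : 0 <= P by rewrite mulr_ge0 ?powR_ge0.
have h1b : cabs h1 * imC w <= (8 * A2 + 8 + C2 / 8) * P.
  pose v : R[i] := rC (imC w / 8).
  have cv : cabs v = imC w / 8 by rewrite cabs_rC gtr0_norm // divr_gt0.
  have := H v; rewrite cv lexx => /(_ isT) e.
  have uwv : upper (w + v) by rewrite /upper imCD /= addr0.
  have b1 : cabs (h (w + v)) <= A2 * P.
    have := hB _ uwv; rewrite imCD /= addr0 -/P => b.
    by apply: le_trans b _; rewrite ler_peMl // A2ge1.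
  have b0 := hB w uw; rewrite -/P in b0.
  have : cabs (h1 * v) <= A2 * P + P + C2 * (imC w / 8 / imC w) ^+ 2 * P.
    have -> : h1 * v = h (w + v) - h w - (h (w + v) - h w - h1 * v) by ring.
    apply: le_trans (cabsD _ _) _; rewrite cabsN lerD //.
    by apply: le_trans (cabsD _ _) _; rewrite cabsN lerD.
  rewrite cabsM cv (_ : imC w / 8 / imC w = 1 / 8); last by field; rewrite gt_eqF.
  rewrite expr2; lra.
set t := cabs u / imC w.
have t0 : 0 <= t by rewrite divr_ge0 ?cabs_ge0 // ltW.
have t8 : t <= 1 / 8 by rewrite ler_pdivrMr //; lra.
have -> : h (w + u) - h w = h1 * u + (h (w + u) - h w - h1 * u) by ring.
apply: le_trans (cabsD _ _) _; rewrite cabsM.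
have -> : cabs h1 * cabs u = cabs h1 * imC w * t by rewrite /t; field; rewrite gt_eqF.
have e1 : cabs h1 * imC w * t <= (8 * A2 + 8 + C2 / 8) * P * t by rewrite ler_wpM2r.
have e2 : C2 * t ^+ 2 * P <= C2 * P * (t * (1/8)).
  have := ler_wpM2l (mulr_ge0 (mulr_ge0 C20 P0) t0) t8.
  by rewrite expr2; lra.
apply: le_trans (lerD e1 (le_trans (H u hu) e2)) _.
have := mulr_ge0 (mulr_ge0 C20 P0) t0.
lra.
Qed.

(** On the small disc [h] loses at most a quarter of [B], leaving [7/10 B], and the weight factor
    loses at most a half; the resulting [7/20] exceeds [1/4]. *)
Lemma near_max_box : exists c1 : R, [/\ 0 < c1, c1 <= 1 / 8 &
  forall B h w, 0 <= B -> tame B h -> upper w ->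
    19 / 20 * B <= imC w `^ al * cabs (h w) ->
    forall u, cabs u <= c1 * imC w -> B / 4 <= imC (w + u) `^ al * cabs (h (w + u))].
Proof.
pose L := 8 * A2 + 8 + C2.
have a1 := A2ge1.
have L8 : 8 <= L by have C2' := C20; rewrite /L; lra.
have aa : 0 <= `|al| by [].
(* The summand [4 L] controls the variation of [h], the summand [8 |al|] that of the power of the
   height. *)
pose c1 := (4 * L + 8 * `|al|)^-1.
have D0 : 0 < 4 * L + 8 * `|al| by lra.
have c10 : 0 < c1 by rewrite invr_gt0.
have c1L : c1 * L <= 1/4.
  rewrite /c1 mulrC ler_pdivrMr //; lra.
have c1a : c1 * `|al| <= 1/8.
  rewrite /c1 mulrC ler_pdivrMr //; lra.
have c18 : c1 <= 1/8.
  have : c1 * 8 <= c1 * L by rewrite ler_pM2l.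
  by lra.
exists c1; split=> // B h w B0 tm uw hm u hu; have y0 : 0 < imC w by exact: uw.
have hu8 : cabs u <= imC w / 8.
  by apply: le_trans hu _; rewrite mulrC ler_pM2l //; lra.
have := tame_lipschitz B0 tm uw hu8; rewrite -/L => lip.
have := imC_le u; rewrite ler_norml => /andP[u1 u2].
set y := imC w in y0 hm hu hu8 lip *.
have yu : imC (w + u) = y + imC u by rewrite imCD.
have yu0 : 0 < imC (w + u) by rewrite yu; lra.
have pal : 0 < y `^ al by rewrite powR_gt0.
have tb : cabs u / y <= c1 by rewrite ler_pdivrMr.
have t0 : 0 <= cabs u / y by rewrite divr_ge0 ?cabs_ge0 // ltW.
have low : 7/10 * B <= y `^ al * cabs (h (w + u)).
  have l1 : L * (cabs u / y) * (B * y `^ (- al)) <= 1/4 * (B * y `^ (- al)).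
    rewrite ler_wpM2r ?mulr_ge0 ?powR_ge0 //.
    apply: le_trans c1L; rewrite mulrC ler_wpM2r //; lra.
  have l2 : y `^ al * (B * y `^ (- al)) = B by rewrite powRN; field; rewrite gt_eqF.
  have l3 : cabs (h w) - 1/4 * (B * y `^ (- al)) <= cabs (h (w + u)).
    have := cabs_ler (h w) (h (w + u)); rewrite cabsB; lra.
  have : y `^ al * (cabs (h w) - 1/4 * (B * y `^ (- al))) <= y `^ al * cabs (h (w + u)).
    by rewrite ler_pM2l.
  by rewrite mulrBr mulrCA l2; lra.
have ratio : 1/2 * y `^ al <= imC (w + u) `^ al.
  rewrite !powR_exp //.
  pose q := imC (w + u) / y.
  have q0 : 0 < q by rewrite divr_gt0.
  have lq : `|ln q| <= 2 * c1.
    have q1 : q <= 1 + c1 by rewrite /q ler_pdivrMr // yu; lra.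
    have q2 : q^-1 <= 1 + 2 * c1.
      rewrite /q invf_div ler_pdivrMr // yu.
      have : (1 + 2 * c1) * (y - c1 * y) <= (1 + 2 * c1) * (y + imC u) by rewrite ler_pM2l; lra.
      have : 0 <= c1 * y * (1 - 2 * c1) by rewrite !mulr_ge0 ?(ltW c10) ?(ltW y0) //; lra.
      by lra.
    rewrite ler_norml; apply/andP; split.
      rewrite lerNl -lnV ?posrE //; apply: le_trans (le_ln1Dx (x := 2 * c1) _); last by lra.
      by rewrite ler_ln ?posrE ?invr_gt0 //; lra.
    apply: le_trans (_ : c1 <= _); last by lra.
    apply: le_trans (le_ln1Dx (x := c1) _); last by lra.
    by rewrite ler_ln ?posrE //; lra.
  have E : al * ln (imC (w + u)) = al * ln y + al * ln q.
    by rewrite /q ln_div ?posrE //; ring.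
  rewrite E expRD mulrC ler_pM2l ?expR_gt0 //.
  have : - (1/4) <= al * ln q.
    have : `|al * ln q| <= 1/4.
      rewrite normrM; apply: (@le_trans _ _ (`|al| * (2 * c1))); first by rewrite ler_wpM2l.
      lra.
    by rewrite ler_norml => /andP[].
  by have := expR_ge1Dx (al * ln q); lra.
have : 1/2 * y `^ al * cabs (h (w + u)) <= imC (w + u) `^ al * cabs (h (w + u)).
  by rewrite ler_wpM2r ?cabs_ge0.
lra.
Qed.

End NearMaximum.

(** * The hyperbolic measure *)

Section PushDensity.
Local Open Scope classical_set_scope.
Local Open Scope ring_scope.
Context d d' (T1 : measurableType d) (T2 : measurableType d') (R : realType).

Definition push_measure (m : {measure set T1 -> \bar R}) (f : T1 -> T2)
    (mf : measurable_fun [set: T1] f) : {measure set T2 -> \bar R} :=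
  measure_function_pushforward__canonical__measure_function_Measure m mf.

Lemma push_measureE m f (mf : measurable_fun [set: T1] f) A :
  push_measure m mf A = m (f @^-1` A).
Proof. by []. Qed.

Variables (mu : {measure set T1 -> \bar R}) (k : T1 -> \bar R).
Hypotheses (mk : measurable_fun [set: T1] k) (k0 : forall x, (0 <= k x)%E).

(** Integrals with a density are packaged as measures, so that changes of variables follow from
    uniqueness of a measure given on intervals or rectangles. *)
Definition density (A : set T1) : \bar R := (\int[mu]_(x in A) k x)%E.

Let density0 : density set0 = 0%E.
Proof. exact: integral_set0. Qed.
Let density_ge0 A : (0 <= density A)%E.
Proof. by apply: integral_ge0 => x _; exact: k0. Qed.
Let density_sigma_additive : semi_sigma_additive density.
Proof.
move=> F mF tF mUF.
have := @ge0_integral_bigcup _ _ _ mu F k mF (measurable_funTS mk) (fun x _ => k0 x) tF.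
rewrite /= -/(density _) => ->.
apply: is_cvg_nneseries => n _ _; exact: density_ge0.
Qed.

Definition density_measure : {measure set T1 -> \bar R} :=
  HB.pack density (isMeasure.Build _ _ _ density
    density0 density_ge0 density_sigma_additive).

Lemma density_measureE A : density_measure A = (\int[mu]_(x in A) k x)%E.
Proof. by []. Qed.

End PushDensity.

Section LebesgueMaps.
Local Open Scope classical_set_scope.
Local Open Scope ring_scope.
Variable R : realType.
Local Notation T := (measurableTypeR R).
Local Notation leb := (@lebesgue_measure R).

Lemma lebesgue_translate (c : R) (A : set T) : measurable A ->
  leb ((fun x : R => x + c) @^-1` A) = leb A.
Proof.
move=> mA; have mf : measurable_fun [set: T] ((fun x : R => x + c) : T -> T).
  by apply: measurable_funD => //; exact: measurable_id.
have := @lebesgue_measure_unique R (push_measure leb mf) _ A mA.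
rewrite push_measureE => <- // X [[a b] _ <-]; rewrite push_measureE /=.
have -> : (fun x : R => x + c) @^-1` `]a, b] = `](a - c), (b - c)]%classic.
  by apply/seteqP; split => x /=; rewrite !in_itv /= ltrBlDr lerBrDr.
by rewrite !lebesgue_measure_itv /= !lte_fin ltrD2r -!EFinB (_ : b - c - (a - c) = b - a) //; ring.
Qed.

Lemma lebesgue_reflect (c : R) (A : set T) : measurable A ->
  leb ((fun x : R => c - x) @^-1` A) = leb A.
Proof.
move=> mA; have mf : measurable_fun [set: T] ((fun x : R => c - x) : T -> T).
  by apply: measurable_funB => //; exact: measurable_id.
rewrite -(lebesgue_measureN mA) /pushforward.
have mN : measurable ((-%R : R -> R) @^-1` A : set T).
  rewrite -[X in measurable X]setTI.
  have : measurable_fun [set: T] (-%R : T -> T) by exact: oppr_measurable.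
  exact.
rewrite -(lebesgue_translate (- c) mN); congr (leb _).
by apply/seteqP; split => x /=; rewrite opprD opprK addrC.
Qed.

Lemma lebesgue_scale (c : R) (A : set T) : 0 < c -> measurable A ->
  leb ((fun x : R => x * c) @^-1` A) = ((c^-1)%:E * leb A)%E.
Proof.
move=> c0 mA; have mf : measurable_fun [set: T] ((fun x : R => x * c) : T -> T).
  by apply: measurable_funM => //; exact: measurable_id.
have c0' : 0 <= c by exact: ltW.
pose m := mscale (NngNum c0') (push_measure leb mf).
have := @lebesgue_measure_unique R m _ A mA.
rewrite /m /= /mscale /= => ->.
  by rewrite muleA -EFinM mulVf ?mul1e // gt_eqF.
move=> X [[a b] _ <-]; rewrite /mscale /=.
rewrite [X in (_ * X)%E](_ : _ = leb `](a / c), (b / c)]%classic).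
  rewrite !lebesgue_measure_itv /= !lte_fin ltr_pM2r ?invr_gt0 //.
  case: ifP => _; last by rewrite mule0.
  by rewrite -!EFinB -EFinM mulrBr ![c * _]mulrC !divfK // gt_eqF.
congr (leb _); apply/seteqP; split => x /=.
  by rewrite !in_itv /= ltr_pdivrMr // ler_pdivlMr.
by rewrite !in_itv /= ltr_pdivrMr // ler_pdivlMr.
Qed.

Definition pos_ind (y : R) : R := if 0 < y then 1 else 0.

Lemma pos_ind_measurable : measurable_fun [set: T] (pos_ind : T -> T).
Proof.
rewrite (_ : pos_ind = \1_(`]0%R, +oo[%classic : set R)); first exact: measurable_indic.
apply/funext => y; rewrite indicE /pos_ind; case: ifPn => h.
  by rewrite mem_set //= in_itv /= h.
by rewrite memNset //= in_itv /= andbT; exact/negP.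
Qed.

Definition negln (y : R) : R := - ln y.
(** A globally measurable form of [1 / y]; it has the right value only for [y > 0], and [pos_ind]
    removes the rest of the line. *)
Definition invpos (y : R) : R := expR (negln y).

Lemma invposE y : 0 < y -> invpos y = y^-1.
Proof. by move=> y0; rewrite /invpos expRN lnK. Qed.

Lemma negln_measurable : measurable_fun [set: T] (negln : T -> T).
Proof. by apply: measurableT_comp; [exact: oppr_measurable|exact: measurable_ln]. Qed.

Lemma invpos_measurable : measurable_fun [set: T] (invpos : T -> T).
Proof. by apply: measurableT_comp; [exact: measurable_expR|exact: negln_measurable]. Qed.

Definition logden (y : R) : \bar R := (invpos y * pos_ind y)%:E.

Lemma logden_measurable : measurable_fun [set: T] (logden : T -> \bar R).
Proof.
apply/measurable_EFinP/measurable_funM; [exact: invpos_measurable|exact: pos_ind_measurable].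
Qed.

Lemma logden_ge0 y : (0 <= logden y)%E.
Proof. by rewrite lee_fin mulr_ge0 ?expR_ge0 // /pos_ind; case: ifP. Qed.

Lemma integral_inv (a b : R) : 0 < a -> a < b ->
  (\int[leb]_(y in `[a, b]) (y^-1)%:E = (ln b - ln a)%:E)%E.
Proof.
move=> a0 ab; rewrite EFinB; apply: continuous_FTC2 => //.
- apply: continuous_in_subspaceT => y; rewrite in_setE /= in_itv /= => /andP[ay _].
  by apply: inv_continuous; rewrite gt_eqF // (lt_le_trans a0).
- split.
  + move=> y; rewrite in_itv /= => /andP[ay _].
    by have /(_ (lt_trans a0 ay)) := @is_derive1_ln R y; case.
  + by apply: cvg_at_right_filter; apply: continuous_ln.
  + by apply: cvg_at_left_filter; apply: continuous_ln; exact: lt_trans ab.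
move=> y; rewrite in_itv /= => /andP[ay _].
have D := @is_derive1_ln R y (lt_trans a0 ay).
by rewrite derive1E; have [_ ->] := D.
Qed.

(** The substitution [v = - ln y] turns [dv] into [dy / y]; by uniqueness only half-open intervals
    are checked, where this is the integral of [1 / y]. *)
Lemma lebesgue_log (A : set T) : measurable A ->
  (leb A = \int[leb]_(y in negln @^-1` A) logden y)%E.
Proof.
move=> mA.
pose m := density_measure leb logden_measurable logden_ge0.
have := @lebesgue_measure_unique R (push_measure m negln_measurable) _ A mA.
rewrite push_measureE density_measureE => -> // X [[a b] _ <-].
rewrite push_measureE density_measureE /=.
have [ab|ba] := ltP a b; last first.
  by rewrite set_itv_ge ?measure0 ?preimage_set0 ?integral_set0 // bnd_simp -leNgt.
have E : negln @^-1` `]a, b] `&` `]0, +oo[ = `[expR (- b), expR (- a)[%classic.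
  apply/seteqP; split => y /=; rewrite !in_itv /= andbT /negln.
    move=> [/andP[h1 h2] y0]; rewrite -(lnK y0) ler_expR ltr_expR; apply/andP; split; lra.
  move=> /andP[h1 h2]; have y0 : 0 < y by apply: lt_le_trans h1; exact: expR_gt0.
  split=> //; move: h1 h2; rewrite -{1 2}(lnK y0) ler_expR ltr_expR => h1 h2.
  apply/andP; split; lra.
transitivity (\int[leb]_(y in `[expR (- b), expR (- a)[) (y^-1)%:E)%E; last first.
  rewrite -E integral_mkcondr; apply: eq_integral => y _; rewrite patchE /logden /pos_ind.
  case: ifPn => [|].
    by rewrite in_setE /= in_itv /= andbT => y0; rewrite y0 mulr1 invposE.
  rewrite notin_setE /= in_itv /= andbT => /negP/negbTE ->.
  by rewrite mulr0.
rewrite lebesgue_measure_itv /= lte_fin ab integral_itv_bndo_bndc.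
  rewrite integral_inv ?expR_gt0 ?ltr_expR ?ltrN2 // !expRK -EFinB.
  by congr (_%:E); ring.
have := logden_measurable.
move=> /(measurable_funTS (D := `[expR (- b), expR (- a)[%classic)).
apply: eq_measurable_fun => y; rewrite in_setE /= in_itv /= => /andP[h1 _].
have y0 : 0 < y by apply: lt_le_trans h1; exact: expR_gt0.
by rewrite /logden /pos_ind y0 mulr1 invposE.
Qed.

End LebesgueMaps.

Section HyperbolicMeasure.
Local Open Scope classical_set_scope.
Local Open Scope ring_scope.
Variable R : realType.
Local Notation T := (measurableTypeR R).
Local Notation leb := (@lebesgue_measure R).
Local Notation lam := (leb \x leb)%E.

(* coordinates [x + i y = e^(-v) (Y + i)], in which [dx dy / y^2] is [dv dY] *)
Definition horo (q : R * R) : R * R := (q.2 * expR (- q.1), expR (- q.1)).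
Definition horo_inv (p : R * R) : R * R := (negln p.2, p.1 * invpos p.2).

Lemma horoK q : horo_inv (horo q) = q.
Proof.
case: q => v Y; rewrite /horo /horo_inv /invpos /negln /= expRK opprK -mulrA -expRD.
by rewrite addrC subrr expR0 mulr1.
Qed.

Lemma horo_invK p : 0 < p.2 -> horo (horo_inv p) = p.
Proof.
case: p => x y /= y0; rewrite /horo /horo_inv /invpos /negln /= opprK lnK // expRN lnK //.
by rewrite divfK // gt_eqF.
Qed.

Lemma horo_upper q : 0 < (horo q).2. Proof. exact: expR_gt0. Qed.

Lemma horo_measurable : measurable_fun [set: T * T] (horo : T * T -> T * T).
Proof.
have mE : measurable_fun [set: T * T] ((fun q => expR (- q.1)) : T * T -> T).
  apply: (@measurableT_comp _ _ _ _ _ _ (expR : T -> T)); first exact: measurable_expR.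
  by apply: (@measurableT_comp _ _ _ _ _ _ (-%R : T -> T)); [exact: oppr_measurable|exact: measurable_fst].
apply/measurable_fun_pairP; split=> //.
by apply: measurable_funM => //; exact: measurable_snd.
Qed.

Lemma horo_inv_measurable : measurable_fun [set: T * T] (horo_inv : T * T -> T * T).
Proof.
have mN : measurable_fun [set: T * T] ((fun p => negln p.2) : T * T -> T).
  exact: (measurableT_comp (@negln_measurable R) measurable_snd).
apply/measurable_fun_pairP; split=> //.
apply: measurable_funM; first exact: measurable_fst.
exact: (measurableT_comp (@invpos_measurable R) measurable_snd).
Qed.

Definition hypden (p : R * R) : \bar R := (invpos p.2 ^+ 2 * pos_ind p.2)%:E.

Lemma hypden_measurable : measurable_fun [set: T * T] (hypden : T * T -> \bar R).
Proof.
apply/measurable_EFinP/measurable_funM.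
  apply: measurable_funX; apply: measurableT_comp; [exact: invpos_measurable|exact: measurable_snd].
by apply: measurableT_comp; [exact: pos_ind_measurable|exact: measurable_snd].
Qed.

Lemma hypden_ge0 p : (0 <= hypden p)%E.
Proof. by rewrite lee_fin mulr_ge0 ?exprn_ge0 ?expR_ge0 // /pos_ind; case: ifP. Qed.

(** Tonelli with [x] inside: rescaling [x] to [Y = x / y] uses up one factor [1 / y], and the
    remaining [dy / y] is [dv]. *)
Lemma hyp_rect (A B : set T) : measurable A -> measurable B ->
  (\int[lam]_(p in horo_inv @^-1` (A `*` B)) hypden p = leb A * leb B)%E.
Proof.
move=> mA mB.
pose a y : R := \1_A (negln y).
pose F (p : T * T) : \bar R := ((hypden p) * (a p.2 * \1_B (p.1 * invpos p.2))%:E)%E.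
have mF : measurable_fun [set: T * T] F.
  apply: emeasurable_funM; first exact: hypden_measurable.
  apply/measurable_EFinP/measurable_funM.
    apply: measurableT_comp; last exact: measurable_snd.
    by apply: (measurableT_comp (measurable_indic mA)); exact: negln_measurable.
  apply: (measurableT_comp (measurable_indic mB)).
  apply: measurable_funM; first exact: measurable_fst.
  by apply: measurableT_comp; [exact: invpos_measurable|exact: measurable_snd].
have F0 p : (0 <= F p)%E.
  by rewrite mule_ge0 ?hypden_ge0 // lee_fin mulr_ge0.
transitivity (\int[lam]_p F p)%E.
  rewrite integral_mkcond; apply: eq_integral => -[x y] _; rewrite patchE /F /a !indicE.
  case: ifPn; rewrite ?in_setE ?notin_setE /=.
    by move=> [h1 h2]; rewrite !mem_set // mulr1 mule1.
  move=> h; case: (boolP (negln y \in A)); rewrite ?in_setE => h1; last by rewrite mul0r mule0.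
  rewrite memNset ?mulr0 ?mule0 //= => h2; apply: h; split=> //.
rewrite fubini_tonelli1 // (fubini_tonelli F) //.
transitivity (\int[leb]_y (logden y * (a y)%:E * leb B))%E.
  apply: eq_integral => y _.
  have [y0|y0] := ltP 0 y; last first.
    have P : pos_ind y = 0 by rewrite /pos_ind ltNge y0.
    rewrite /logden P mulr0 !mul0e; apply: integral0_eq => x _.
    by rewrite /F /hypden /= P mulr0 mul0e.
  rewrite (eq_integral (fun x : T => ((invpos y ^+ 2 * a y)%:E * (\1_B (x * invpos y))%:E)%E)); last first.
    by move=> x _; rewrite /F /hypden /pos_ind /= y0 mulr1 -!EFinM mulrA.
  have iv : 0 < invpos y by rewrite expR_gt0.
  have mS : measurable ((fun x : R => x * invpos y) @^-1` B : set T).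
    have mf : measurable_fun [set: T] ((fun x : R => x * invpos y) : T -> T).
      by apply: measurable_funM => //; exact: measurable_id.
    by rewrite -[X in measurable X]setTI; exact: mf.
  rewrite ge0_integralZl //; last 2 first.
  - apply/measurable_EFinP; exact: (measurable_indic mS).
  - by rewrite lee_fin /a indicE mulr_ge0 // exprn_ge0 // ltW.
  rewrite (_ : (fun x => (\1_B (x * invpos y))%:E) = fun x => (\1_((fun x : R => x * invpos y) @^-1` B) x)%:E) //.
  have I : (\int[leb]_x (\1_((fun x : R => x * invpos y) @^-1` B) x)%:E =
      leb ((fun x : R => (x * invpos y)%R) @^-1` B))%E by rewrite integral_indic // setIT.
  rewrite I lebesgue_scale // muleA; congr (_ * _)%E.
  rewrite -!EFinM; congr (_%:E); rewrite /pos_ind y0; field; exact: lt0r_neq0.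
have La : measurable_fun [set: T] (fun y => (logden y * (a y)%:E)%E).
  apply: emeasurable_funM; first exact: logden_measurable.
  by apply/measurable_EFinP; apply: (measurableT_comp (measurable_indic mA)); exact: negln_measurable.
have La0 y : (0 <= logden y * (a y)%:E)%E.
  by rewrite mule_ge0 ?logden_ge0 // lee_fin /a indicE.
rewrite ge0_integralZr // (lebesgue_log mA); congr (_ * _)%E.
rewrite [RHS]integral_mkcond; apply: eq_integral => y _; rewrite patchE /a indicE.
rewrite (_ : (y \in @negln R @^-1` A) = (negln y \in A)).
  by case: ifPn => _; rewrite ?mule1 ?mule0.
by apply/idP/idP; rewrite !in_setE.
Qed.

Lemma hyp_area (A : set (T * T)) : measurable A -> (forall p, A p -> 0 < p.2) ->
  (\int[lam]_(p in A) (p.2 ^- 2)%:E = lam (horo @^-1` A))%E.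
Proof.
move=> mA hA.
have mPA : measurable (horo @^-1` A : set (T * T)).
  by rewrite -[X in measurable X]setTI; exact: horo_measurable.
pose m := push_measure (density_measure lam hypden_measurable hypden_ge0) horo_inv_measurable.
have -> := @product_measure_unique _ _ _ _ _ leb leb m _ _ mPA; last first.
  by move=> X Y mX mY; rewrite /m push_measureE density_measureE hyp_rect.
rewrite /m push_measureE density_measureE [LHS]integral_mkcond [RHS]integral_mkcond.
apply: eq_integral => -[x y] _; rewrite !patchE /hypden /pos_ind /=.
have [y0|y0] := boolP (0 < y).
  rewrite mulr1 invposE // exprVn.
  suff -> : ((x, y) \in A) = ((x, y) \in horo_inv @^-1` (horo @^-1` A)) by [].
  by apply/idP/idP; rewrite !in_setE /= horo_invK.
rewrite mulr0 if_same memNset // => /hA /=; exact/negP.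
Qed.

Definition area_preserving (tau : T * T -> T * T) : Prop :=
  measurable_fun [set: T * T] tau /\
  forall A : set (T * T), measurable A -> lam (tau @^-1` A) = lam A.

Lemma area_preserving_comp (s t : T * T -> T * T) :
  area_preserving s -> area_preserving t -> area_preserving (s \o t).
Proof.
move=> [ms ps] [mt pt]; split; first exact: measurableT_comp.
move=> A mA; rewrite -(ps A mA).
have mB : measurable (s @^-1` A) by rewrite -[X in measurable X]setTI; exact: ms.
by rewrite -(pt _ mB).
Qed.

Lemma lam_xsection (A : set (T * T)) : lam A = (\int[leb]_x leb (xsection A x))%E.
Proof. by []. Qed.

Lemma lam_ysection (A : set (T * T)) : measurable A ->
  lam A = (\int[leb]_y leb (ysection A y))%E.
Proof.
move=> mA; have := @indic_fubini_tonelli _ _ _ _ _ leb leb A mA.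
by rewrite indic_fubini_tonelli_FE // indic_fubini_tonelli_GE.
Qed.

(** On each fibre [v = const] the map is a translation, so the sections keep their measure. *)
Lemma shear_x_area (k : R -> R) : measurable_fun [set: T] (k : T -> T) ->
  area_preserving (fun q => (q.1, q.2 + k q.1)).
Proof.
move=> mk.
have ms : measurable_fun [set: T * T] ((fun q => (q.1, q.2 + k q.1)) : T * T -> T * T).
  apply/measurable_fun_pairP; split; first exact: measurable_fst.
  apply: measurable_funD; first exact: measurable_snd.
  exact: (measurableT_comp mk measurable_fst).
split=> // A mA; rewrite !lam_xsection; apply: eq_integral => v _.
have mS := measurable_xsection v mA.
rewrite -(lebesgue_translate (k v) mS); congr (leb _).
Qed.

Lemma reflect_y_area (k : R -> R) : measurable_fun [set: T] (k : T -> T) ->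
  area_preserving (fun q => (k q.2 - q.1, q.2)).
Proof.
move=> mk.
have ms : measurable_fun [set: T * T] ((fun q => (k q.2 - q.1, q.2)) : T * T -> T * T).
  apply/measurable_fun_pairP; split; last exact: measurable_snd.
  apply: measurable_funB; last exact: measurable_fst.
  exact: (measurableT_comp mk measurable_snd).
split=> // A mA.
have mB : measurable ((fun q : T * T => (k q.2 - q.1, q.2) : T * T) @^-1` A).
  by rewrite -[X in measurable X]setTI; exact: ms.
rewrite (lam_ysection mB) (lam_ysection mA); apply: eq_integral => Y _.
have mS := measurable_ysection Y mA.
rewrite -(lebesgue_reflect (k Y) mS); congr (leb _).
Qed.

Lemma reflect_x_area : area_preserving (fun q => (q.1, - q.2)).
Proof.
have ms : measurable_fun [set: T * T] ((fun q => (q.1, - q.2)) : T * T -> T * T).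
  apply/measurable_fun_pairP; split; first exact: measurable_fst.
  apply: (measurableT_comp (@oppr_measurable R _)); exact: measurable_snd.
split=> // A mA; rewrite !lam_xsection; apply: eq_integral => v _.
have mS := measurable_xsection v mA.
rewrite -(lebesgue_reflect 0 mS); congr (leb _).
by apply/seteqP; split => Y; rewrite /xsection /= !in_setE /= sub0r.
Qed.

Lemma shift_x_area (c : R) : area_preserving (fun q => (q.1 + c, q.2)).
Proof.
have ms : measurable_fun [set: T * T] ((fun q => (q.1 + c, q.2)) : T * T -> T * T).
  apply/measurable_fun_pairP; split; last exact: measurable_snd.
  by apply: measurable_funD => //; exact: measurable_fst.
split=> // A mA.
have mB : measurable ((fun q : T * T => (q.1 + c, q.2) : T * T) @^-1` A).
  by rewrite -[X in measurable X]setTI; exact: ms.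
rewrite (lam_ysection mB) (lam_ysection mA); apply: eq_integral => Y _.
have mS := measurable_ysection Y mA.
rewrite -(lebesgue_translate c mS); congr (leb _).
Qed.

(** This is [z -> -1/z] in the coordinates [(v, Y)], because [|z|^2 = e^(-2 v) (1 + Y^2)]. *)
Definition inversion (q : R * R) : R * R := (ln (1 + q.2 ^+ 2) - q.1, - q.2).

Lemma inversion_area : area_preserving inversion.
Proof.
have mk : measurable_fun [set: T] ((fun Y => ln (1 + Y ^+ 2)) : T -> T).
  apply: (measurableT_comp (@measurable_ln R)).
  by apply: measurable_funD => //; apply: measurable_funX; exact: measurable_id.
exact: (area_preserving_comp reflect_x_area (reflect_y_area mk)).
Qed.

End HyperbolicMeasure.

(** * Unfolding over the modular group *)

Section HoroAction.
Local Open Scope classical_set_scope.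
Local Open Scope ring_scope.
Variable R : realType.
Local Notation T := (measurableTypeR R).
Local Notation leb := (@lebesgue_measure R).
Local Notation lam := (leb \x leb)%E.
Implicit Types (q : R * R) (M : mat2).

Definition hpt q : R[i] := toC (horo q).

Lemma hpt_upper q : upper (hpt q). Proof. exact: expR_gt0. Qed.

Definition tau M q : R * R := horo_inv (ofC (mob M (hpt q))).

Lemma toC_ofC (z : R[i]) : toC (ofC z) = z. Proof. by case: z. Qed.
Lemma ofC_toC (p : R * R) : ofC (toC p) = p. Proof. by case: p. Qed.

Lemma hpt_inv z : upper z -> hpt (horo_inv (ofC z)) = z.
Proof. by move=> uz; rewrite /hpt horo_invK ?toC_ofC. Qed.

Lemma hptK q : horo_inv (ofC (hpt q)) = q.
Proof. by rewrite /hpt ofC_toC horoK. Qed.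

Lemma hpt_inj q q' : hpt q = hpt q' -> q = q'.
Proof. by move=> E; rewrite -(hptK q) E hptK. Qed.

Lemma hpt_tau M q : 0 < mdet M -> hpt (tau M q) = mob M (hpt q).
Proof. by move=> dM; rewrite /tau hpt_inv //; apply: upper_mob => //; exact: hpt_upper. Qed.

Lemma tauM M M' q : 0 < mdet M -> 0 < mdet M' -> tau (mmul M M') q = tau M (tau M' q).
Proof.
move=> dM dM'; apply: hpt_inj; rewrite !hpt_tau ?mdetM ?mulr_gt0 //.
by rewrite mobM ?gt_eqF //; exact: hpt_upper.
Qed.

Lemma tau_id q : tau mid q = q.
Proof. by rewrite /tau mob_id hptK. Qed.

Lemma minvK M : SL2Z M -> mmul (minv M) M = mid.
Proof.
case: M => a b c d; rewrite /SL2Z /mdet /mmul /minv /mid /= => h.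
by congr Mat2; lia.
Qed.

Lemma minvKr M : SL2Z M -> mmul M (minv M) = mid.
Proof.
case: M => a b c d; rewrite /SL2Z /mdet /mmul /minv /mid /= => h.
by congr Mat2; lia.
Qed.

Lemma SL2Z_minv M : SL2Z M -> SL2Z (minv M).
Proof. by case: M => a b c d; rewrite /SL2Z /mdet /minv /= => h; lia. Qed.

Lemma SL2Z_mul M M' : SL2Z M -> SL2Z M' -> SL2Z (mmul M M').
Proof. by move=> h h'; rewrite /SL2Z mdetM h h' mulr1. Qed.

Lemma tauVK M q : SL2Z M -> tau (minv M) (tau M q) = q.
Proof.
by move=> h; rewrite -tauM ?minvK ?tau_id // SL2Z_det //; exact: SL2Z_minv.
Qed.

Lemma tauKV M q : SL2Z M -> tau M (tau (minv M) q) = q.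
Proof.
by move=> h; rewrite -tauM ?minvKr ?tau_id // SL2Z_det //; exact: SL2Z_minv.
Qed.

Definition shear (k : R) q : R * R := (q.1, q.2 + k * expR q.1).
Definition dilate (c : R) q : R * R := (q.1 + c, q.2).

Lemma hpt_shear k q : hpt (shear k q) = hpt q + rC k.
Proof.
apply: complex_eq; rewrite ?reCD ?imCD /= ?addr0 // mulrDl -mulrA -expRD subrr expR0.
by rewrite mulr1.
Qed.

Lemma hpt_dilate c q : hpt (dilate c q) = hpt q * rC (expR (- c)).
Proof.
by apply: complex_eq; rewrite ?reCM ?imCM /= opprD expRD; ring.
Qed.

Lemma hpt_inversion q : hpt (inversion q) = - (hpt q)^-1.
Proof.
have h0 : hpt q != 0 by apply: upper_neq0; exact: hpt_upper.
apply: (mulIf h0); rewrite mulNr mulVf //.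
case: q {h0} => v Y; have p0 : 0 < 1 + Y ^+ 2 by rewrite ltr_pwDl // sqr_ge0.
have E : expR (- (ln (1 + Y ^+ 2) - v)) * expR (- v) = (1 + Y ^+ 2)^-1.
  by rewrite -expRD opprB addrC addrA addNr add0r expRN lnK.
have n0 : 1 + Y ^+ 2 != 0 by rewrite gt_eqF.
apply: complex_eq; rewrite ?reCM ?imCM ?reCN ?imCN /=.
  rewrite (_ : _ - _ = - ((1 + Y ^+ 2) * (expR (- (ln (1 + Y ^+ 2) - v)) * expR (- v)))); last by ring.
  by rewrite E mulfV.
ring.
Qed.

Lemma shear_area k : area_preserving (shear k).
Proof.
apply: (@shear_x_area R (fun v => k * expR v)).
by apply: measurable_funM => //; exact: measurable_expR.
Qed.

Lemma dilate_area c : area_preserving (dilate c).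
Proof. exact: shift_x_area. Qed.

Lemma rC_intr (a : int) : rC (a%:~R : R) = zC R a. Proof. by rewrite zCE. Qed.
Lemma rCM (x y : R) : rC (x * y) = rC x * rC y.
Proof. by apply: complex_eq; rewrite ?reCM ?imCM /=; ring. Qed.
Lemma rCV (x : R) : rC (x^-1) = (rC x)^-1.
Proof. by rewrite /rC -![Complex _ 0]/(_%:C)%C fmorphV. Qed.

(** Bruhat decomposition: for [c != 0] the map is [a / c - 1 / (c^2 (z + d / c))], a product of
    translations, a dilation and the inversion; for [c = 0] it is the translation by [a b], since
    [a = d = 1] or [a = d = -1]. *)
Lemma tau_area M : SL2Z M -> area_preserving (tau M).
Proof.
move=> hM; have dM := SL2Z_det hM; have := hM; rewrite /SL2Z /mdet => hd.
have [c0|c0] := eqVneq (mc M) 0.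
  suff -> : tau M = shear (ma M * mb M)%:~R by exact: shear_area.
  apply/funext => q; apply: hpt_inj; rewrite hpt_tau // hpt_shear rC_intr /mob /jfac c0.
  have ad : ma M * md M = 1 by lia.
  have d2 : md M * md M = 1.
    have : `|md M|%N = 1%N.
      have /eqP := congr1 absz ad; rewrite abszM muln_eq1 => /andP[_ /eqP]; exact.
    by move=> h; have [->|->] : md M = 1 \/ md M = -1 by lia.
  have amd : ma M = md M by rewrite -[ma M]mulr1 -d2 mulrA ad mul1r.
  rewrite {1}/zC mul0r add0r zCM amd.
  have dd : zC R (md M) * zC R (md M) = 1 by rewrite -zCM d2.
  have dn : zC R (md M) != 0.
    by apply/eqP => h; move: dd; rewrite h mul0r => /eqP; rewrite eq_sym oner_eq0.
  have -> : (zC R (md M))^-1 = zC R (md M) by apply: (mulIf dn); rewrite mulVf.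
  by rewrite mulrDl mulrAC dd mul1r [zC _ (mb M) * _]mulrC.
pose c : R := (mc M)%:~R; have cn : c != 0 by rewrite intr_eq0.
have c2 : 0 < c ^+ 2 by rewrite exprn_even_gt0.
suff -> : tau M = shear ((ma M)%:~R / c) \o (dilate (ln (c ^+ 2)) \o (@inversion R \o shear ((md M)%:~R / c))).
  apply: area_preserving_comp; first exact: shear_area.
  apply: area_preserving_comp; first exact: dilate_area.
  apply: area_preserving_comp; [exact: inversion_area|exact: shear_area].
apply/funext => q; apply: hpt_inj; rewrite hpt_tau //= hpt_shear hpt_dilate hpt_inversion hpt_shear.
rewrite expRN lnK ?posrE // rCV expr2 !rCM !rCV !rC_intr.
have j0 : jfac M (hpt q) != 0 by apply: jfac_neq0; [rewrite gt_eqF|exact: hpt_upper].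
have cC : zC R (mc M) != 0 by rewrite -cabs_gt0 cabs_zC normr_gt0 intr_eq0.
have hz : zC R (ma M) * zC R (md M) - zC R (mb M) * zC R (mc M) = 1.
  by rewrite -!zCM -zCN -zCD hd.
have eB : zC R (mb M) = (zC R (ma M) * zC R (md M) - 1) / zC R (mc M).
  by apply: (mulIf cC); rewrite divfK // -hz; ring.
rewrite /mob eB; move: j0; rewrite /jfac => j0.
have j1 : hpt q + zC R (md M) / zC R (mc M) != 0.
  apply: contraNneq j0 => E; have := congr1 (fun x => zC R (mc M) * x) E.
  by rewrite mulr0 mulrDr mulrCA divff // mulr1 => ->.
move: cC j0; move: (zC R (ma M)) (zC R (mc M)) (zC R (md M)) (hpt q) => A C D z C0 J0.
have J0' : z * C + D != 0 by rewrite mulrC.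
by field; rewrite ?C0 ?J0 ?J0'.
Qed.

Lemma tau_preimage_measurable M (A : set (T * T)) : SL2Z M -> measurable A ->
  measurable (tau M @^-1` A : set (T * T)).
Proof. by move=> hM mA; have [mt _] := tau_area hM; rewrite -[X in measurable X]setTI; exact: mt. Qed.

End HoroAction.

Section Counting.
Local Open Scope classical_set_scope.
Local Open Scope ring_scope.
Variables (I : countType) (R : realType).
Implicit Types (P Q : I -> Prop).
Local Open Scope ereal_scope.

(** An indicator along the enumeration of [I]; a cardinality, possibly infinite, thus becomes a
    series that can be integrated term by term. *)
Definition hit P (n : nat) : bool :=
  if pickle_inv n is Some t then `[< P t >] else false.

Definition countE P : \bar R := \sum_(n <oo) ((hit P n)%:R)%:E.

Lemma hitP P n : reflect (exists2 t, P t & pickle t = n) (hit P n).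
Proof.
rewrite /hit; case E : pickle_inv => [t|].
  have En : pickle t = n by have := @pickle_invK I n; rewrite /oapp E.
  apply: (iffP (asboolP _)) => [Pt|[t' Pt' En']]; first by exists t.
  by have -> : t = t' by apply: (pcan_inj pickleK); rewrite En.
by constructor => -[t Pt En]; move: E; rewrite -En pickleK_inv.
Qed.

Lemma partial_hit P N :
  \sum_(0 <= n < N) ((hit P n)%:R : R)%:E = ((count (hit P) (iota 0 N))%:R)%:E.
Proof.
elim: N => [|N IH]; first by rewrite big_geq.
have E : iota 0 N.+1 = iota 0 N ++ [:: N] by rewrite -addn1 iotaD.
by rewrite big_nat_recr // IH E count_cat /= addn0 -EFinD natrD.
Qed.

Lemma countE_ge P (s : seq I) : uniq s -> (forall t, t \in s -> P t) ->
  ((size s)%:R)%:E <= countE P.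
Proof.
move=> us Ps; pose N := (\max_(t <- s) pickle t).+1.
apply: (@le_trans _ _ (\sum_(0 <= n < N) ((hit P n)%:R)%:E)); last first.
  by apply: nneseries_lim_ge => n _ _; rewrite lee_fin ler0n.
rewrite partial_hit lee_fin ler_nat -(size_map pickle) -size_filter.
apply: uniq_leq_size; first by rewrite map_inj_uniq //; exact: pcan_inj pickleK.
move=> n /mapP[t ts ->]; rewrite mem_filter mem_iota /= add0n ltnS.
apply/andP; split; first by apply/hitP; exists t => //; exact: Ps.
exact: leq_bigmax_seq.
Qed.

Lemma countE_le P (k : R) :
  (forall s : seq I, uniq s -> (forall t, t \in s -> P t) -> ((size s)%:R <= k)%R) ->
  countE P <= k%:E.
Proof.
move=> H; apply: lime_le.
  by apply: is_cvg_nneseries => n _ _; rewrite lee_fin ler0n.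
near=> N; rewrite partial_hit lee_fin.
pose s := pmap (@pickle_inv I) (seq.filter (hit P) (iota 0 N)).
have sz : size s = count (hit P) (iota 0 N).
  rewrite size_pmap -[RHS]size_filter; apply/eqP; rewrite -all_count.
  by apply/allP => n; rewrite mem_filter => /andP[]; rewrite /hit; case: pickle_inv.
rewrite -sz; apply: H.
  apply: (pmap_uniq (@pickle_invK I)); exact: filter_uniq (iota_uniq _ _).
move=> t; rewrite mem_pmap => /mapP[n]; rewrite mem_filter => /andP[hn _] E.
by move: hn; rewrite /hit -E => /asboolP.
Unshelve. all: by end_near. Qed.

End Counting.

(* [mat2] is a bare record; [mcode] equips it with a countable type structure *)
Definition mcode := (int * int * int * int)%type.
Definition dec (t : mcode) : mat2 := let: (a, b, c, d) := t in Mat2 a b c d.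
Definition enc (M : mat2) : mcode := (ma M, mb M, mc M, md M).

Lemma encK M : dec (enc M) = M. Proof. by case: M. Qed.
Lemma decK t : enc (dec t) = t. Proof. by case: t => [[[a b] c] d]. Qed.
Section Unfolding.
Local Open Scope classical_set_scope.
Local Open Scope ring_scope.
Variable R : realType.
Local Notation T := (measurableTypeR R).
Local Notation leb := (@lebesgue_measure R).
Local Notation lam := (leb \x leb)%E.
Local Open Scope ereal_scope.

Definition orbit_count (E : set (R * R)) (q : R * R) : \bar R :=
  countE R (fun t : mcode => SL2Z (dec t) /\ E (tau (dec t) q)).

Definition orbit_count_inv (E : set (R * R)) (q : R * R) : \bar R :=
  countE R (fun t : mcode => SL2Z (dec t) /\ E (tau (minv (dec t)) q)).

Lemma hit_measurable (phi : mat2 -> mat2) (E : set (T * T)) n :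
  (forall M, SL2Z M -> SL2Z (phi M)) -> measurable E ->
  measurable_fun [set: T * T]
   ((fun q => ((hit (fun t : mcode => SL2Z (dec t) /\ E (tau (phi (dec t)) q)) n)%:R)%:E) : T * T -> \bar R).
Proof.
move=> hphi mE; rewrite /hit; case: pickle_inv => [t|]; last exact: measurable_cst.
have [ht|ht] := pselect (SL2Z (dec t)); last first.
  rewrite (_ : (fun _ => _) = cst 0); first exact: measurable_cst.
  by apply/funext => q; case: asboolP => // -[].
have mS := tau_preimage_measurable (hphi _ ht) mE.
rewrite (_ : (fun _ => _) = (fun q => (\1_(tau (phi (dec t)) @^-1` E : set (T * T)) q)%:E)).
  by apply/measurable_EFinP; exact: measurable_indic.
apply/funext => q; rewrite indicE; congr ((_ : bool)%:R%:E).
apply/asboolP/idP; rewrite in_setE /=; first by case.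
by move=> h; split.
Qed.

(** For each matrix [M] the points of [E] sent into [F] and the points of [F] sent into [E] by the
    inverse correspond under the area-preserving [tau M]; then sum over [M]. *)
Lemma unfolding (E F : set (T * T)) : measurable E -> measurable F ->
  \int[lam]_(q in E) orbit_count F q = \int[lam]_(q in F) orbit_count_inv E q.
Proof.
move=> mE mF; rewrite /orbit_count /orbit_count_inv /countE.
pose f1 n (q : T * T) : \bar R := ((hit (fun t : mcode => SL2Z (dec t) /\ F (tau (dec t) q)) n)%:R)%:E.
pose f2 n (q : T * T) : \bar R := ((hit (fun t : mcode => SL2Z (dec t) /\ E (tau (minv (dec t)) q)) n)%:R)%:E.
have m1 n : measurable_fun E (f1 n).
  by apply: measurable_funTS; exact: (hit_measurable (phi := id)).
have m2 n : measurable_fun F (f2 n).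
  by apply: measurable_funTS; apply: (hit_measurable (phi := minv)) => // M; exact: SL2Z_minv.
have p1 n x : E x -> 0 <= f1 n x by rewrite lee_fin ler0n.
have p2 n x : F x -> 0 <= f2 n x by rewrite lee_fin ler0n.
rewrite (integral_nneseries lam mE m1 p1) (integral_nneseries lam mF m2 p2).
rewrite /f1 /f2 {m1 m2 p1 p2 f1 f2}.
apply: eq_eseriesr => n _; rewrite /hit; case: pickle_inv => [t|]; last first.
  by rewrite !integral0.
have [ht|ht] := pselect (SL2Z (dec t)); last first.
  rewrite [LHS]integral0_eq ?[RHS]integral0_eq //.
    by move=> q _; case: asboolP => // -[].
  by move=> q _; case: asboolP => // -[].
have [_ pi] := tau_area R (SL2Z_minv ht).
have mS := tau_preimage_measurable ht mF.
have mS' := tau_preimage_measurable (SL2Z_minv ht) mE.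
transitivity (lam (tau (dec t) @^-1` F `&` E)).
  rewrite -integral_indic //; apply: eq_integral => q _; rewrite indicE.
  congr ((_ : bool)%:R%:E); apply/asboolP/idP; rewrite in_setE /=; first by case.
  by move=> h; split.
transitivity (lam (tau (minv (dec t)) @^-1` E `&` F)); last first.
  rewrite -integral_indic //; apply: eq_integral => q _; rewrite indicE.
  congr ((_ : bool)%:R%:E); apply/idP/asboolP; rewrite in_setE /=; last by case.
  by move=> h; split.
rewrite -(pi (_ `&` _)); last exact: measurableI.
congr (lam _); apply/seteqP; split => q /=; rewrite tauKV // => -[h1 h2]; split => //.
Qed.

End Unfolding.

(** * Coset counting *)

Lemma mmulA M1 M2 M3 : mmul M1 (mmul M2 M3) = mmul (mmul M1 M2) M3.
Proof. by case: M1 M2 M3 => a b c d [? ? ? ?] [? ? ? ?]; rewrite /mmul /=; congr Mat2; ring. Qed.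

Lemma mmulm1 M : mmul M mid = M.
Proof. by case: M => a b c d; rewrite /mmul /=; congr Mat2; ring. Qed.

Lemma mmul1m M : mmul mid M = M.
Proof. by case: M => a b c d; rewrite /mmul /=; congr Mat2; ring. Qed.

Lemma minv_mul M M' : minv (mmul M M') = mmul (minv M') (minv M).
Proof. by case: M M' => a b c d [? ? ? ?]; rewrite /mmul /minv /=; congr Mat2; ring. Qed.

Lemma minv_inj M M' : minv M = minv M' -> M = M'.
Proof. by case: M M' => a b c d [? ? ? ?] [-> /oppr_inj -> /oppr_inj -> ->]. Qed.

(** * Reduction theory for a strip in place of the standard modular domain *)

Section Strip.
Variable R : realType.
Implicit Types (z w : R[i]) (M : mat2).

Definition transl (k : int) : mat2 := Mat2 1 k 0 1.
Definition weyl : mat2 := Mat2 0 (-1) 1 0.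

Lemma SL2Z_transl k : SL2Z (transl k). Proof. by rewrite /SL2Z /mdet /=; lia. Qed.
Lemma SL2Z_weyl : SL2Z weyl. Proof. by []. Qed.
Lemma SL2Z_id : SL2Z mid. Proof. by []. Qed.

Lemma mob_transl k z : mob (transl k) z = z + zC R k.
Proof. by rewrite /mob /jfac /transl /= /zC !mul1r mul0r add0r divr1. Qed.

Lemma mobM_SL M M' z : SL2Z M -> SL2Z M' -> upper z ->
  mob (mmul M M') z = mob M (mob M' z).
Proof. by move=> h h' uz; rewrite mobM ?h' ?h. Qed.

(** Every orbit is brought into this set by at least one and at most nine matrices, and its area is
    2; up to constants it does the work of a fundamental domain, with straight sides. *)
Definition strip z : Prop := [/\ 0 <= reC z, reC z < 1 & 1 / 2 < imC z].

Lemma imC_mob_SL M z : SL2Z M -> upper z -> imC (mob M z) = imC z / cabs (jfac M z) ^+ 2.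
Proof. by move=> hM uz; rewrite imC_mob ?hM // mul1r. Qed.

Lemma imC_orbit_le M z : SL2Z M -> upper z -> imC (mob M z) <= imC z + (imC z)^-1.
Proof.
move=> hM uz; rewrite imC_mob_SL //; rewrite /upper in uz.
have j0 : 0 < cabs (jfac M z) ^+ 2.
  by rewrite exprn_gt0 // cabs_gt0 jfac_neq0 // hM.
rewrite ler_pdivrMr //; have [c0|c0] := eqVneq (mc M) 0.
  have : (1 <= cabs (jfac M z) ^+ 2).
    rewrite cabs_sqr jfac_re jfac_im c0 mul0r add0r mul0r expr0n addr0 -rmorphXn /=.
    have := hM; rewrite /SL2Z /mdet c0 mulr0 subr0 => h.
    have d0 : md M != 0 by apply: contraPneq h => ->; rewrite mulr0.
    by rewrite ler1z -gtz0_ge1 exprn_even_gt0.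
  have y1 : 0 < (imC z)^-1 by rewrite invr_gt0.
  nra.
have : imC z ^+ 2 <= cabs (jfac M z) ^+ 2.
  rewrite lerXn2r ?nnegrE ?cabs_ge0 ?(ltW uz) //.
  apply: le_trans (jfac_le M z); rewrite ler_peMl ?(ltW uz) // -intr_norm ler1z.
  by rewrite -gtz0_ge1 normr_gt0.
move=> h; apply: (@le_trans _ _ ((imC z + (imC z)^-1) * imC z ^+ 2)).
  have -> : (imC z + (imC z)^-1) * imC z ^+ 2 = imC z ^+ 3 + imC z by field; rewrite gt_eqF.
  by rewrite lerDr exprn_ge0 // ltW.
by rewrite ler_wpM2l // addr_ge0 ?invr_ge0 ?(ltW uz).
Qed.

(** If [|x| <= 1/2] and [y <= 1/2] then [|z|^2 <= 1/2], so inversion at least doubles the height.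
    Heights in an orbit are bounded by [B], and [n] counts the doublings still possible. *)
Lemma strip_cover z : upper z -> exists M, SL2Z M /\ strip (mob M z).
Proof.
move=> uz; pose B := imC z + (imC z)^-1.
suff H n : forall M, SL2Z M -> B < 2 ^+ n * imC (mob M z) -> exists M', SL2Z M' /\ strip (mob M' z).
  have y0 : 0 < imC z by exact: uz.
  pose n := (Num.truncn (B / imC z)).+1.
  have B0 : 0 <= B / imC z by rewrite divr_ge0 ?addr_ge0 ?invr_ge0 ?ltW.
  have /andP[_ hn] := Num.Theory.truncn_itv B0.
  apply: (H n mid SL2Z_id); rewrite mob_id.
  rewrite ltr_pdivrMr // in hn; apply: (lt_le_trans hn).
  by rewrite ler_pM2r // -natrX ler_nat ltnW // ltn_expl.
elim: n => [|n IH] M hM; first by rewrite mul1r ltNge imC_orbit_le.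
set w := mob M z => hB.
have uw : upper w by apply: upper_mob => //; exact: SL2Z_det.
pose k := Num.floor (reC w + 1/2).
have /andP[k1 k2] := Num.Theory.floor_itv (reC w + 1/2).
have [hy|hy] := ltP (1/2) (imC w).
  pose l := Num.floor (reC w); have /andP[l1 l2] := Num.Theory.floor_itv (reC w).
  exists (mmul (transl (- l)) M); split; first by apply: SL2Z_mul => //; exact: SL2Z_transl.
  rewrite mobM ?SL2Z_det ?(SL2Z_transl _) // mob_transl -/w zCE.
  by rewrite /strip reCD imCD /= addr0 rmorphN /=; split=> //; rewrite ?rmorphD /= in l2 *; lra.
pose M' := mmul weyl (mmul (transl (- k)) M).
have hM' : SL2Z M' by apply: SL2Z_mul => //; apply: SL2Z_mul => //; exact: SL2Z_transl.
apply: (IH M' hM'); apply: (lt_le_trans hB).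
pose w1 := w + zC R (- k).
have uw1 : upper w1 by rewrite /upper /w1 zCE imCD /= addr0.
have hTM : SL2Z (mmul (transl (- k)) M) by apply: SL2Z_mul => //; exact: SL2Z_transl.
have -> : mob M' z = mob weyl w1.
  rewrite mobM ?SL2Z_det ?SL2Z_weyl //.
  by rewrite mobM ?SL2Z_det ?(SL2Z_transl _) // mob_transl.
rewrite imC_mob_SL // exprS -mulrA (mulrC 2) -mulrA ler_pM2l ?exprn_gt0 //.
have i1 : imC w1 = imC w by rewrite /w1 zCE imCD /= addr0.
have j1 : cabs (jfac weyl w1) ^+ 2 = reC w1 ^+ 2 + imC w1 ^+ 2.
  by rewrite cabs_sqr jfac_re jfac_im /= !mul1r addr0.
have r1 : `|reC w1| <= 1/2.
  rewrite /w1 zCE reCD /= rmorphN /= ler_norml; rewrite rmorphD /= in k2.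
  by rewrite -/k in k1 k2; apply/andP; split; lra.
have jb : cabs (jfac weyl w1) ^+ 2 <= 1/2.
  have y0 : 0 < imC w by exact: uw.
  rewrite j1 i1; move: r1; rewrite ler_norml => /andP[? ?]; rewrite !expr2; nra.
have jp : 0 < cabs (jfac weyl w1) ^+ 2.
  by rewrite exprn_gt0 // cabs_gt0 jfac_neq0.
rewrite i1 ler_pdivlMr //; have y0 : 0 < imC w by exact: uw.
nra.
Qed.

(** Height above [1/2] at the image means [(c x + d)^2 + c^2 y^2 < 2 y]. With [y > 1/2] this forces
    [c^2 < 4]; for [c = 1] or [c = -1] it gives [|c x + d| < 1], whence the bound on [d] as
    [0 <= x < 1]. *)
Lemma strip_return M z : SL2Z M -> strip z -> strip (mob M z) ->
  (`|mc M| <= 1)%N && (`|md M| <= 1)%N.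
Proof.
move=> hM [x0 x1 y2] [_ _ y2']; have uz : upper z by rewrite /upper; lra.
have j0 : 0 < cabs (jfac M z) ^+ 2 by rewrite exprn_gt0 // cabs_gt0 jfac_neq0 // hM.
rewrite imC_mob_SL // ltr_pdivlMr // cabs_sqr jfac_re jfac_im in y2'.
set c : R := (mc M)%:~R in y2'; set d : R := (md M)%:~R in y2'.
set x := reC z in x0 x1 y2'; set y := imC z in y2 y2'.
have sq : 0 <= (c * x + d) ^+ 2 by rewrite sqr_ge0.
have c4 : c ^+ 2 < 4.
  have : c ^+ 2 * y ^+ 2 < 2 * y by rewrite -exprMn; lra.
  rewrite !expr2 => h; have : c * c * y < 2 by rewrite -(ltr_pM2r (x := y)); lra.
  have : 0 <= c * c by rewrite -expr2 sqr_ge0.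
  nra.
have cI : (`|mc M| <= 1)%N.
  rewrite leqNgt; apply/negP => h.
  have : (4 <= mc M * mc M)%R by nia.
  rewrite -(ler_int R) rmorphM /= -/c -expr2; lra.
rewrite cI /=.
have [c0|c0] := eqVneq (mc M) 0.
  have := hM; rewrite /SL2Z /mdet c0 mulr0 subr0 => h.
  have /eqP := congr1 absz h; rewrite abszM muln_eq1 => /andP[_ /eqP ->]; exact.
have cc : c = 1 \/ c = -1.
  have : mc M = 1 \/ mc M = -1 by lia.
  by rewrite /c => -[->|->]; [left|right].
have s1 : (c * x + d) ^+ 2 < 1.
  have : (c * x + d) ^+ 2 + y ^+ 2 < 2 * y.
    by case: cc y2' => ->; rewrite ?mul1r ?mulN1r ?sqrrN; lra.
  have := sqr_ge0 (y - 1); rewrite !expr2; lra.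
have s2 : `|c * x + d| < 1.
  by rewrite -(ltr_pXn2r (n := 2)) ?nnegrE // expr1n real_normK ?num_real.
rewrite leqNgt; apply/negP => h.
have dd : (2 <= md M)%R || (md M <= -2)%R by lia.
move: s2; rewrite ltr_norml => /andP[s2 s3].
case/orP: dd; rewrite -(ler_int R) /= -/d ?rmorphN /= => hd; case: cc s2 s3 => -> s2 s3; lra.
Qed.

Lemma strip_unique M M' z : SL2Z M -> SL2Z M' -> upper z ->
  mc M = mc M' -> md M = md M' -> strip (mob M z) -> strip (mob M' z) -> M = M'.
Proof.
move=> hM hM' uz Ec Ed [x0 x1 _] [x0' x1' _].
pose n := ma M * mb M' - mb M * ma M'.
have E : M' = mmul (transl n) M.
  move: hM hM' Ec Ed; rewrite /n; case: M {x0 x1 n} => a b c d; case: M' {x0' x1'} => a' b' c' d'.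
  rewrite /SL2Z /mdet /mmul /= => h h' Ec Ed; rewrite -Ec -Ed in h' *.
  rewrite !mul1r !mul0r !add0r; congr Mat2.
    transitivity (a' * (a * d - b * c) + a * (1 - (a' * d - b' * c))); last by ring.
    by rewrite h h' subrr mulr0 addr0 mulr1.
  transitivity (b' * (a * d - b * c) + b * (1 - (a' * d - b' * c))); last by ring.
  by rewrite h h' subrr mulr0 addr0 mulr1.
have Ez : mob M' z = mob M z + zC R n.
  by rewrite E mobM ?SL2Z_det ?(SL2Z_transl _) // mob_transl.
move: x0' x1'; rewrite Ez zCE reCD /= => x0' x1'.
have n0 : n = 0.
  have h1 : (n%:~R : R) < 1 by lra.
  have h2 : (-1 : R) < n%:~R by lra.
  rewrite -(mulr1z (1 : R)) ltr_int in h1.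
  rewrite -(mulrN1z (1 : R)) ltr_int in h2.
  lia.
by rewrite E n0; case: M {hM Ec Ed E Ez x0 x1 n n0 x0' x1'} => a b c d; rewrite /mmul /=; congr Mat2; lia.
Qed.

(** Relative to the first element, a matrix is determined by its bottom row, whose two entries lie
    in [{-1, 0, 1}]; hence 9. *)
Lemma strip_mult z (s : seq mcode) : upper z -> uniq s ->
  (forall t, t \in s -> SL2Z (dec t) /\ strip (mob (minv (dec t)) z)) -> (size s <= 9)%N.
Proof.
move=> uz us hs; case: s us hs => [|t0 s0] // us hs.
set s := t0 :: s0 in us hs *.
have [h0 w0] := hs t0 (mem_head _ _).
pose w := mob (minv (dec t0)) z.
pose g t := mmul (minv (dec t)) (dec t0).
have hg t : t \in s -> SL2Z (g t) /\ strip (mob (g t) w).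
  move=> ts; have [ht wt] := hs t ts; have hi := SL2Z_minv ht.
  split; first exact: SL2Z_mul.
  rewrite /g mobM_SL //; last by apply: upper_mob => //; exact: (SL2Z_det (SL2Z_minv h0)).
  by rewrite /w -(mobM_SL h0) ?minvKr ?mob_id //; exact: SL2Z_minv.
have uw : upper w by apply: upper_mob => //; exact: (SL2Z_det (SL2Z_minv h0)).
pose key t := (mc (g t), md (g t)).
pose box := [seq (x, y) | x <- [:: -1; 0; 1 : int], y <- [:: -1; 0; 1 : int]].
rewrite -(size_map key) -[9%N]/(size box); apply: uniq_leq_size.
  rewrite map_inj_in_uniq // => t t' ts ts' [Ec Ed].
  have [a1 a2] := hg t ts; have [b1 b2] := hg t' ts'.
  have E := strip_unique a1 b1 uw Ec Ed a2 b2.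
  have [ht _] := hs t ts; have [ht' _] := hs t' ts'.
  rewrite -(decK t) -(decK t'); congr enc; apply: minv_inj.
  by rewrite -(mmulm1 (minv (dec t))) -(minvKr h0) mmulA -/(g t) E /g -mmulA minvKr // mmulm1.
move=> k /mapP[t ts ->]; have [a1 a2] := hg t ts.
have /andP[] := strip_return a1 w0 a2; rewrite /key => hc hd.
have hc' : mc (g t) = -1 \/ mc (g t) = 0 \/ mc (g t) = 1 by lia.
have hd' : md (g t) = -1 \/ md (g t) = 0 \/ md (g t) = 1 by lia.
by case: hc' => [->|[->|->]]; case: hd' => [->|[->|->]].
Qed.

End Strip.

(** * Subgroups of the modular group seen modulo a common level *)

Section Quotient.
Variable L : nat.
Hypothesis L1 : (1 < L)%N.

Definition Zmat := ('Z_L * 'Z_L * 'Z_L * 'Z_L)%type.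
Implicit Types (x y : Zmat) (M : mat2).

Definition zmul x y : Zmat :=
  let: (a, b, c, d) := x in let: (a', b', c', d') := y in
  (a * a' + b * c', a * b' + b * d', c * a' + d * c', c * b' + d * d').
Definition zinv x : Zmat := let: (a, b, c, d) := x in (d, - b, - c, a).
Definition red M : Zmat := ((ma M)%:~R, (mb M)%:~R, (mc M)%:~R, (md M)%:~R).

Lemma zmulA x y z : zmul x (zmul y z) = zmul (zmul x y) z.
Proof.
case: x y z => [[[a b] c] d] [[[? ?] ?] ?] [[[? ?] ?] ?]; rewrite /zmul.
by congr (_, _, _, _); ring.
Qed.

Lemma red_mul M M' : red (mmul M M') = zmul (red M) (red M').
Proof. by rewrite /red /zmul /= !rmorphD !rmorphM. Qed.
Lemma red_inv M : red (minv M) = zinv (red M).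
Proof. by rewrite /red /zinv /= !rmorphN. Qed.

Lemma red_id_mul x : zmul (red mid) x = x.
Proof. by case: x => [[[a b] c] d]; rewrite /red /zmul /=; congr (_, _, _, _); ring. Qed.
Lemma red_mul_id x : zmul x (red mid) = x.
Proof. by case: x => [[[a b] c] d]; rewrite /red /zmul /=; congr (_, _, _, _); ring. Qed.

Lemma zinvK M x : SL2Z M -> zmul (zinv (red M)) (zmul (red M) x) = x.
Proof. by move=> h; rewrite zmulA -red_inv -red_mul minvK // red_id_mul. Qed.
Lemma zmulK M x : SL2Z M -> zmul (zmul x (red M)) (zinv (red M)) = x.
Proof. by move=> h; rewrite -zmulA -red_inv -red_mul minvKr // red_mul_id. Qed.

Lemma intr_Zp_eq0 (n : int) : (n%:~R == 0 :> 'Z_L) = (L%:Z %| n)%Z.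
Proof.
have natE (k : nat) : (k%:R == 0 :> 'Z_L) = (L %| k)%N.
  by rewrite -val_eqE /= val_Zp_nat // /dvdn.
case: n => k; first by rewrite dvdzE /= -natE.
by rewrite NegzE rmorphN oppr_eq0 dvdzE abszN -natE.
Qed.

Lemma red_eq_id M : red M = red mid -> SL2Z M -> Gamma_princ L M.
Proof.
move=> [/eqP a /eqP b /eqP c /eqP d] h; split=> //.
- by rewrite -intr_Zp_eq0 rmorphB subr_eq0.
- by rewrite -intr_Zp_eq0.
- by rewrite -intr_Zp_eq0.
- by rewrite -intr_Zp_eq0 rmorphB subr_eq0.
Qed.

Lemma red_eq M M' : SL2Z M -> SL2Z M' -> red M = red M' -> Gamma_princ L (mmul M (minv M')).
Proof.
move=> h h' E; apply: red_eq_id; last by apply: SL2Z_mul => //; exact: SL2Z_minv.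
by rewrite red_mul red_inv E -red_inv -red_mul minvKr.
Qed.

(** For a subgroup containing the principal one of level [L], the ratio of [#|img SL2Z|] to the size
    of its image is its index; cosets are thus counted in a finite set. *)
Definition img (P : mat2 -> Prop) : {set Zmat} := [set x | `[< exists2 M, P M & red M = x >]].

Lemma imgP P x : reflect (exists2 M, P M & red M = x) (x \in img P).
Proof. by rewrite inE; exact: asboolP. Qed.

Definition level_subgroup (G : mat2 -> Prop) : Prop :=
  [/\ (forall M, G M -> SL2Z M), G mid,
      (forall M M', G M -> G M' -> G (mmul M M')),
      (forall M, G M -> G (minv M))
    & (forall M, Gamma_princ L M -> G M)].

Lemma img_mem G M : level_subgroup G -> SL2Z M -> red M \in img G -> G M.
Proof.
move=> [sG _ mG _ pG] h /imgP[M' GM' E].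
have := pG _ (red_eq h (sG _ GM') (esym E)) => k.
by rewrite -(mmulm1 M) -(minvK (sG _ GM')) mmulA; apply: mG.
Qed.

Lemma red_surj_eq M M' : SL2Z M -> SL2Z M' -> red M = red M' ->
  exists2 K, Gamma_princ L K & M = mmul K M'.
Proof.
move=> h h' E; exists (mmul M (minv M')); first exact: red_eq.
by rewrite -mmulA minvK // mmulm1.
Qed.

Section OrbitCounts.
Variables (G : mat2 -> Prop) (A : mat2 -> Prop).
Hypothesis hG : level_subgroup G.

Lemma img_gt0 : (0 < #|img G|)%N.
Proof. by apply/card_gt0P; exists (red mid); apply/imgP; exists mid => //; case: hG. Qed.

(** Double counting of pairs of [t] in [s] and [x] in [img G * red t]: each [t] has [#|img G|]
    partners, and the hypothesis on fibres allows each [x] at most two. *)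
Lemma orbit_count_upper (s : seq mcode) :
  (forall M s', SL2Z M -> uniq s' ->
     (forall t, t \in s' -> SL2Z (dec t) /\ A (dec t) /\ G (mmul (dec t) (minv M))) -> (size s' <= 2)%N) ->
  uniq s -> (forall t, t \in s -> SL2Z (dec t) /\ A (dec t)) ->
  (#|img G| * size s <= 2 * #|img SL2Z|)%N.
Proof.
move=> H us hs; have [sG G1 mG iG pG] := hG.
have part t : t \in s -> (#|img G| = \sum_(x in img SL2Z) (x \in [set zmul g (red (dec t)) | g in img G]))%N.
  move=> ts; have [ht _] := hs t ts.
  rewrite -(card_in_imset (f := fun g => zmul g (red (dec t)))) /=; last first.
    by move=> g g' _ _ E; rewrite -(zmulK g ht) E zmulK.
  rewrite -sum1_card big_mkcond [RHS]big_mkcond /=; apply: eq_bigr => x _.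
  case: ifPn => [/imsetP[g /imgP[M GM <-] ->]|_]; last by case: ifP.
  rewrite ifT //; apply/imgP; exists (mmul M (dec t)); rewrite ?red_mul //.
  by apply: SL2Z_mul => //; exact: sG.
have -> : (#|img G| * size s = \sum_(t <- s) #|img G|)%N by rewrite big_const_seq count_predT iter_addn_0.
rewrite (eq_big_seq _ part) exchange_big /=.
rewrite mulnC -sum_nat_const; apply: leq_sum => x /imgP[M hM <-].
rewrite -big_mkcond /= sum1_count -size_filter; apply: (H M) => //; first exact: filter_uniq.
move=> t; rewrite mem_filter => /andP[/imsetP[g /imgP[N GN <-] E] ts].
have [ht hA] := hs t ts; split=> //; split=> //.
have hN := sG _ GN.
apply: img_mem => //; first by apply: SL2Z_mul => //; exact: SL2Z_minv.
apply/imgP; exists (minv N); first exact: iG.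
by rewrite red_mul (red_inv M) E -red_mul -red_inv -red_mul minv_mul mmulA minvKr // mmul1m.
Qed.

(** In the application [X] holds the matrices carrying a fixed point to where [F^2] is large, and
    [A] those which moreover land in the domain of [G]. The image of [X] is a union of cosets for
    both groups: it contains [#ks] disjoint cosets of [Gp], and it is covered by cosets of [G]
    indexed by elements of [A]. *)
Lemma orbit_count_lower (Gp X : mat2 -> Prop) (s0 : mat2) (ks : seq int) :
  level_subgroup Gp -> SL2Z s0 -> uniq ks ->
  (forall M N, G M \/ Gp M -> SL2Z N -> X N -> X (mmul M N)) ->
  (forall N, SL2Z N -> X N -> exists2 M, G M & A (mmul M N)) ->
  (forall k, k \in ks -> X (mmul s0 (transl k))) ->
  (forall k k', k \in ks -> k' \in ks ->
     Gp (mmul (mmul s0 (transl k)) (minv (mmul s0 (transl k')))) -> k = k') ->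
  exists s : seq mcode, [/\ uniq s, (forall t, t \in s -> SL2Z (dec t) /\ A (dec t))
    & (#|img Gp| * size ks <= #|img G| * size s)%N].
Proof.
move=> hGp h0 uks hX hA hk inj.
have [sG _ mG iG pG] := hG; have [sP _ mP iP pP] := hGp.
pose J := img (fun N => SL2Z N /\ X N).
have hT k : SL2Z (mmul s0 (transl k)) by apply: SL2Z_mul => //; exact: SL2Z_transl.
pose S k := [set zmul g (red (mmul s0 (transl k))) | g in img Gp].
have cS k : #|S k| = #|img Gp|.
  by rewrite card_in_imset // => g g' _ _ E; rewrite -(zmulK g (hT k)) E zmulK.
have SJ k : k \in ks -> S k \subset J.
  move=> kks; apply/fintype.subsetP => x /imsetP[g /imgP[M GM <-] ->].
  apply/imgP; exists (mmul M (mmul s0 (transl k))); rewrite ?red_mul //; split.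
    by apply: SL2Z_mul => //; exact: sP.
  by apply: hX => //; [right|exact: hk].
have low : (#|img Gp| * size ks <= #|J|)%N.
  have -> : (#|img Gp| * size ks = \sum_(k <- ks) \sum_(x in J) (x \in S k))%N.
    have -> : (#|img Gp| * size ks = \sum_(k <- ks) #|img Gp|)%N.
      by rewrite big_const_seq count_predT iter_addn_0.
    apply: eq_big_seq => k kks; rewrite -(cS k) -sum1_card big_mkcond [RHS]big_mkcond /=.
    apply: eq_bigr => x _; case: ifPn => [xS|xS]; last by case: ifP.
    by rewrite (fintype.subsetP (SJ k kks)).
  rewrite exchange_big /= -sum1_card; apply: leq_sum => x _.
  rewrite -big_mkcond /= sum1_count -size_filter.
  set f := seq.filter _ _.
  have uf : uniq f by exact: filter_uniq.
  have hf k k' : k \in f -> k' \in f -> k = k'.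
    rewrite !mem_filter => /andP[/imsetP[g /imgP[M GM <-] E] kk] /andP[/imsetP[g' /imgP[M' GM' <-] E'] kk'].
    apply: inj => //; apply: (img_mem hGp).
      by apply: SL2Z_mul => //; exact: SL2Z_minv.
    apply/imgP; exists (mmul (minv M) M'); first by apply: mP => //; exact: iP.
    have EE : red (mmul s0 (transl k)) = red (mmul (mmul (minv M) M') (mmul s0 (transl k'))).
      by rewrite -mmulA !(red_mul _ (mmul _ _)) -E' E -!red_mul mmulA minvK ?mmul1m //; exact: sP.
    by rewrite (red_mul (mmul s0 (transl k))) EE -red_mul -mmulA minvKr // mmulm1.
  clear -uf hf; case: f uf hf => [|a [|b f]] //= /andP[ab _] hf.
  have E : a = b by apply: hf; rewrite !inE eqxx ?orbT.
  by rewrite E inE eqxx in ab.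
(* Each class in [J] is moved into [A] by some [M] of [G], so it belongs to the coset of the chosen
   [t]; these choices, without repetitions, form the list. *)
have ex x : exists t : mcode, x \in J -> [/\ SL2Z (dec t), A (dec t)
     & x \in [set zmul (zinv g) (red (dec t)) | g in img G]].
  have [/imgP[N [hN XN] E]|xJ] := boolP (x \in J); last by exists (enc mid).
  have [M GM AM] := hA N hN XN; have hM := sG _ GM.
  exists (enc (mmul M N)) => _; rewrite encK; split=> //; first exact: SL2Z_mul.
  apply/imsetP; exists (red M); first by apply/imgP; exists M.
  by rewrite red_mul zinvK.
have [f hf] := choice ex.
exists (undup [seq f x | x <- enum J]); split; first exact: undup_uniq.
  by move=> t; rewrite mem_undup => /mapP[x]; rewrite mem_enum => /hf[h1 h2 _] ->.
set s := undup _; apply: (leq_trans low).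
apply: (@leq_trans (\sum_(x in J) \sum_(t <- s) (x \in [set zmul (zinv g) (red (dec t)) | g in img G]))%N).
  rewrite -sum1_card; apply: leq_sum => x xJ; have [h1 h2 h3] := hf x xJ.
  have fs : f x \in s by rewrite mem_undup map_f // mem_enum.
  by rewrite (big_rem (f x)) //= h3.
rewrite exchange_big /=.
have -> : (#|img G| * size s = \sum_(t <- s) #|img G|)%N by rewrite big_const_seq count_predT iter_addn_0.
apply: leq_sum => t _.
apply: (@leq_trans #|[set zmul (zinv g) (red (dec t)) | g in img G]|); last exact: leq_imset_card.
rewrite -big_mkcondr /= sum1_card; apply: subset_leq_card; apply/fintype.subsetP => x.
by rewrite unfold_in => /andP[].
Qed.

End OrbitCounts.

(** Each fibre of [key] lies in a single coset of [Gp]. *)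
Lemma img_index_le (Gp : mat2 -> Prop) (K : finType) (key : mat2 -> K) :
  level_subgroup Gp ->
  (forall M M', SL2Z M -> SL2Z M' -> key M = key M' -> Gp (mmul M (minv M'))) ->
  (#|img SL2Z| <= #|K| * #|img Gp|)%N.
Proof.
move=> hGp hkey; pose F k := img (fun M => SL2Z M /\ key M = k).
apply: (@leq_trans (\sum_(x in img SL2Z) \sum_k (x \in F k))%N).
  rewrite -sum1_card; apply: leq_sum => x /imgP[M hM E].
  rewrite (bigD1 (key M)) //=; suff -> : x \in F (key M) by [].
  by apply/imgP; exists M.
rewrite exchange_big /= -sum_nat_const; apply: leq_sum => k _.
rewrite -big_mkcondr /= sum1_card.
apply: (@leq_trans #|F k|).
  by apply: subset_leq_card; apply/fintype.subsetP => x; rewrite unfold_in => /andP[].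
have [->|[x0 /imgP[M0 [h0 k0] _]]] := set_0Vmem (F k); first by rewrite cards0.
apply: (@leq_trans #|[set zmul g (red M0) | g in img Gp]|); last exact: leq_imset_card.
apply: subset_leq_card; apply/fintype.subsetP => x /imgP[M [hM kM] <-].
apply/imsetP; exists (red (mmul M (minv M0))).
  by apply/imgP; exists (mmul M (minv M0)) => //; apply: hkey; rewrite ?kM ?k0.
by rewrite -red_mul -mmulA minvK // mmulm1.
Qed.

End Quotient.

Section Index.

Definition Gamma8 (N : nat) (M : mat2) : Prop := Gamma_princ 8 M /\ (N%:Z %| mc M)%Z.

Lemma Gamma8_level N L : (8 %| L)%N -> (N %| L)%N -> level_subgroup L (Gamma8 N).
Proof.
move=> h8 hN; have dz (a b : nat) : (a %| b)%N -> (a%:Z %| b%:Z)%Z by [].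
split.
- by move=> M [[]].
- by split; first split.
- move=> [a b c d] [a' b' c' d'] [[h1 h2 h3 h4 h5] h6] [[k1 k2 k3 k4 k5] k6].
  move: h1 h2 h3 h4 h5 h6 k1 k2 k3 k4 k5 k6 => /=.
  move=> h1 h2 h3 h4 h5 h6 k1 k2 k3 k4 k5 k6; split; last first.
    by apply: rpredD; [exact: dvdz_mulr|exact: dvdz_mull].
  split => /=; first exact: SL2Z_mul.
  + have -> : a * a' + b * c' - 1 = (a - 1) * a' + (a' - 1) + b * c' by ring.
    by apply: rpredD; [apply: rpredD => //; exact: dvdz_mulr|first [exact: dvdz_mull|exact: dvdz_mulr]].
  + by apply: rpredD; [exact: dvdz_mull|exact: dvdz_mulr].
  + by apply: rpredD; [exact: dvdz_mulr|exact: dvdz_mull].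
  have -> : c * b' + d * d' - 1 = (d - 1) * d' + (d' - 1) + c * b' by ring.
  by apply: rpredD; [apply: rpredD => //; exact: dvdz_mulr|first [exact: dvdz_mull|exact: dvdz_mulr]].
- move=> [a b c d] [[h1 h2 h3 h4 h5] h6]; split; last by rewrite /= rpredN.
  by split => //=; rewrite ?rpredN //; exact: SL2Z_minv.
move=> [a b c d] [h1 h2 h3 h4 h5]; split; first split => //=.
- exact: dvdz_trans (dz _ _ h8) h2.
- exact: dvdz_trans (dz _ _ h8) h3.
- exact: dvdz_trans (dz _ _ h8) h4.
- exact: dvdz_trans (dz _ _ h8) h5.
exact: dvdz_trans (dz _ _ hN) h4.
Qed.

Lemma squarefree_dvd N n : (0 < N)%N -> squarefree N ->
  (forall p, prime p -> (p %| N)%N -> (p %| n)%N) -> (N %| n)%N.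
Proof.
move=> N0 sf H; apply/dvdn_partP => // p; rewrite mem_primes => /and3P[pp _ pN].
have -> : (N`_p = p)%N.
  rewrite p_part; have := sf p pp.
  rewrite pfactor_dvdn // -ltnNge ltnS => h.
  have : (0 < logn p N)%N by rewrite logn_gt0 mem_primes pp N0 pN.
  by move=> h'; have -> : logn p N = 1%N by lia.
exact: H.
Qed.

(** Since [N] is squarefree, [c] is invertible modulo [N' = N / gcd(N, c)], and every prime of [N]
    not dividing [c] divides [N']. With [u] an inverse of [c] there, [t] is [d u] reduced modulo
    [N]. *)
Lemma slope_exists N M : (0 < N)%N -> squarefree N -> SL2Z M ->
  exists t : 'I_N, forall p, prime p -> (p %| N)%N -> ~~ (p%:Z %| mc M)%Z ->
    (p%:Z %| mc M * t%:Z - md M)%Z.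
Proof.
move=> N0 sf hM; pose c := mc M; pose g := gcdn N `|c|; pose N' := (N %/ g)%N.
have gN : (g %| N)%N by exact: dvdn_gcdl.
have g0 : (0 < g)%N by rewrite gcdn_gt0 N0.
have NE : (N = N' * g)%N by rewrite divnK.
have cop : coprimez c N'.
  rewrite coprimezE /= /coprime; case: (ltngtP (gcdn `|c| N') 1) => // h.
    have N'0 : (0 < N')%N by move: N0; rewrite NE muln_gt0 => /andP[].
    have : (0 < gcdn `|c| N')%N by rewrite gcdn_gt0 N'0 orbT.
    by lia.
  have pp := pdiv_prime h; set p := pdiv _ in pp.
  have : (p %| gcdn `|c| N')%N by exact: pdiv_dvd.
  rewrite dvdn_gcd => /andP[pc pN'].
  have pg : (p %| g)%N by rewrite dvdn_gcd pc andbT NE dvdn_mulr.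
  by have := sf p pp; rewrite NE -mulnn dvdn_mul.
have [[u v] /= uv] : exists uv : int * int, uv.1 * c + uv.2 * N'%:Z = 1.
  by move/coprimezP: cop => [[u v] h]; exists (u, v).
pose t := (md M * u %% N%:Z)%Z.
have Nn0 : N%:Z != 0 by rewrite eqz_nat -lt0n.
have t0 : 0 <= t by exact: modz_ge0.
have tN : t < N%:Z.
  by have := ltz_mod (md M * u) Nn0; rewrite /t; case: N {NE gN g g0 N' cop uv t t0 sf} Nn0 N0 => // n _ _; exact.
have tE : (`|t|%N : int) = t by rewrite gez0_abs.
have tlt : (`|t| < N)%N by rewrite -ltz_nat tE.
exists (Ordinal tlt) => p pp pN pc /=; rewrite tE.
have pN' : (p%:Z %| N'%:Z)%Z.
  rewrite dvdzE /=; move: pN; rewrite NE Euclid_dvdM // => /orP[//|].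
  by move=> /dvdn_trans /(_ (dvdn_gcdr N `|c|)); move: pc; rewrite dvdzE /= => /negPf ->.
have dt : (N%:Z %| t - md M * u)%Z.
  by rewrite /t [X in _ - X](divz_eq (md M * u) N%:Z) opprD addrCA subrr addr0 rpredN dvdz_mull.
have -> : mc M * t - md M = c * (t - md M * u) + md M * (u * c + v * N' - 1) - md M * v * N'.
  by rewrite /c; ring.
rewrite uv subrr mulr0 addr0; apply: rpredB; last exact: dvdz_mull.
by apply: dvdz_mull; apply: dvdz_trans dt; rewrite dvdzE.
Qed.

(* A coset of [Gamma8 N] is determined by [M] modulo 8, the set of primes dividing
   both [N] and [c], and the slope [d / c] modulo the other primes dividing [N] *)
Definition slope_key N := ((size (primes N)).-tuple bool * 'I_N * Zmat 8)%type.

Lemma card_slope_key N : #|{: slope_key N}| = (2 ^ size (primes N) * N * 8 ^ 4)%N.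
Proof.
rewrite !card_prod card_tuple card_bool card_ord; congr (_ * _)%N.
by rewrite /Zp_trunc /= card_ord.
Qed.

(** The lower-left entry of the quotient of [M] by [M'] is [c d' - d c']. A prime of [N] dividing
    [c] also divides [c']; for any other prime the equal slopes make the two products congruent. *)
Lemma Gamma8_index N L : (0 < N)%N -> squarefree N -> (1 < L)%N -> (8 %| L)%N -> (N %| L)%N ->
  (#|img L SL2Z| <= 2 ^ size (primes N) * N * 8 ^ 4 * #|img L (Gamma8 N)|)%N.
Proof.
move=> N0 sf L1 h8 hN.
have ex M : exists t : 'I_N, SL2Z M -> forall p, prime p -> (p %| N)%N -> ~~ (p%:Z %| mc M)%Z ->
    (p%:Z %| mc M * t%:Z - md M)%Z.
  have [h|h] := pselect (SL2Z M); last by exists (Ordinal N0).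
  by have [t ht] := slope_exists N0 sf h; exists t.
have [sl hsl] := choice ex.
pose key M : slope_key N :=
  ([tuple of map (fun p : nat => (p%:Z %| mc M)%Z) (in_tuple (primes N))], sl M, red 8 M).
rewrite -card_slope_key; apply: (@img_index_le L (Gamma8 N) (slope_key N : finType) key); first exact: Gamma8_level.
move=> M M' hM hM' [E1 E2 E3 E4 E5 E6]; split.
  apply: (@red_eq 8) => //; rewrite /red; congr (_, _, _, _) => //.
have Em p : prime p -> (p %| N)%N -> (p%:Z %| mc M)%Z = (p%:Z %| mc M')%Z.
  move=> pp pN; move/eq_in_map: E1 => /(_ p); apply.
  by rewrite mem_primes pp N0.
rewrite /= dvdzE /=; apply: squarefree_dvd => // p pp pN.
rewrite -[X in (X %| _)%N]/(`|p%:Z|%N) -dvdzE.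
have [pc|pc] := boolP (p%:Z %| mc M)%Z.
  have pc' : (p%:Z %| mc M')%Z by rewrite -Em.
  by rewrite mulrN; apply: rpredD; [exact: dvdz_mulr|rewrite rpredN dvdz_mull].
have pc' : ~~ (p%:Z %| mc M')%Z by rewrite -Em.
have a := hsl M hM p pp pN pc; have b := hsl M' hM' p pp pN pc'.
rewrite -E2 in b.
have -> : mc M * md M' + md M * - mc M' =
  mc M' * (mc M * (sl M)%:Z - md M) - mc M * (mc M' * (sl M)%:Z - md M') by ring.
by apply: rpredB; exact: dvdz_mull.
Qed.

End Index.

(** * Characters and conjugation *)

Section PrimeFactors.
Variable R : realType.

(** A factor with base at least [P] pays for its own 2, because its [eps]-th power is at least 2;
    only the smaller bases are charged to the constant. *)
Lemma two_pow_size_le (P : nat) (eps : R) (s : seq (nat * nat)) : (0 < P)%N -> 0 < eps ->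
  2 <= P%:R `^ eps -> (forall f, f \in s -> (0 < f.1 ^ f.2)%N /\ (f.1 <= f.1 ^ f.2)%N) ->
  2 ^+ size s <= 2 ^+ count (fun f => f.1 < P)%N s * (\prod_(f <- s) (f.1 ^ f.2))%N%:R `^ eps :> R.
Proof.
move=> P0 eps0 hP; elim: s => [|[p k] s IH] H.
  by rewrite big_nil /= powR1 mulr1.
have [h0 h1] := H (p, k) (mem_head _ _); rewrite /= in h0 h1.
have IH' := IH (fun f fs => H f (mem_behead (s := (p, k) :: s) fs)).
rewrite big_cons /= natrM powRM ?ler0n // exprS.
set A := _ `^ eps in IH' *; set D := count _ s in IH' *.
have A0 : 0 <= A by exact: powR_ge0.
rewrite exprD; have D0 : (0 : R) <= 2 ^+ D by rewrite exprn_ge0.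
case: ltnP => hp /=.
  have : 1 <= (p ^ k)%:R `^ eps :> R.
    by rewrite -[leLHS](powRr0 (p ^ k)%:R) ler_powR ?(ltW eps0) // -[1]/(1%:R) ler_nat.
  move: IH'; set z := _ `^ eps; set S := 2 ^+ size s; rewrite expr1; set q := 2 ^+ D in D0 * => IH' h.
  have : q * A <= q * A * z by rewrite ler_peMr // mulr_ge0.
  lra.
have : 2 <= (p ^ k)%:R `^ eps :> R.
  apply: le_trans hP _; apply: ge0_ler_powR; rewrite ?nnegrE ?ler0n ?(ltW eps0) //.
  by rewrite ler_nat (leq_trans hp).
move: IH'; set z := _ `^ eps; set S := 2 ^+ size s; rewrite expr0 mul1r; set q := 2 ^+ D in D0 * => IH' h.
have : 2 * (q * A) <= z * (q * A) by rewrite ler_wpM2r // mulr_ge0.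
lra.
Qed.

Lemma two_pow_omega (eps : R) : 0 < eps -> exists C : R, 0 < C /\ forall N, (0 < N)%N ->
  2 ^+ size (primes N) <= C * N%:R `^ eps.
Proof.
move=> eps0; pose P := (Num.truncn (2 `^ (eps^-1) : R)).+1.
have hP : 2 <= P%:R `^ eps :> R.
  have -> : 2 = (2 `^ (eps^-1)) `^ eps :> R.
    by rewrite -powRrM mulVf ?powRr1 ?gt_eqF.
  apply: ge0_ler_powR; rewrite ?nnegrE ?ler0n ?powR_ge0 ?(ltW eps0) //.
  by have /andP[_ /ltW] := Num.Theory.truncn_itv (powR_ge0 (2 : R) eps^-1).
exists (2 ^+ P); split; first exact: exprn_gt0.
move=> N N0; pose s := prime_decomp N.
have sz : size (primes N) = size s by rewrite /primes size_map.
have hs f : f \in s -> prime f.1 /\ (0 < f.2)%N.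
  by case: f => p k /mem_prime_decomp[].
rewrite sz; apply: (le_trans (@two_pow_size_le P eps s _ eps0 hP _)) => //.
  move=> f /hs[pf kf]; rewrite expn_gt0 prime_gt0 //; split=> //.
  by rewrite -[X in (X <= _)%N]expn1 leq_exp2l // prime_gt1.
rewrite -prod_prime_decomp //; apply: ler_wpM2r; first exact: powR_ge0.
apply: ler_weXn2l; first by lra.
rewrite -(count_map fst (fun p => p < P)%N) -/(primes N) -size_filter.
rewrite -[X in (_ <= X)%N](size_iota 0 P); apply: uniq_leq_size.
  by rewrite filter_uniq // primes_uniq.
by move=> p; rewrite mem_filter mem_iota => /andP[].
Qed.

End PrimeFactors.

Section Characters.
Variable R : realType.

Lemma char_mod q (eta : int -> R[i]) : dirichlet_char q eta ->
  forall a b, (q%:Z %| a - b)%Z -> eta a = eta b.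
Proof.
move=> [per _ _ _] a b /dvdzP[k ab].
have {ab} -> : a = b + k * q%:Z by lia.
have H n c : eta (c + n%:Z * q%:Z) = eta c.
  elim: n c => [|n IH] c; first by rewrite mul0r addr0.
  by rewrite -[RHS](IH c) -[RHS]per; congr eta; lia.
case: k => n; first exact: H.
rewrite -(H n.+1 (b + Negz n * q%:Z)); congr eta; rewrite NegzE; lia.
Qed.

(** By Euler's theorem [eta a] is a root of unity of order dividing [totient q]. *)
Lemma char_norm q (eta : int -> R[i]) a : (0 < q)%N -> dirichlet_char q eta ->
  coprime (absz a) q -> cabs (eta a) = 1.
Proof.
move=> q0 he cop; have [per mul one z0] := he.
have etaX b n : eta (b ^+ n) = eta b ^+ n.
  by elim: n => [|n IH]; rewrite ?expr0 ?one // !exprS mul IH.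
pose b := absz (a %% q%:Z)%Z.
have qn : q%:Z != 0 by rewrite eqz_nat -lt0n.
have bE : b%:Z = (a %% q%:Z)%Z by rewrite gez0_abs // modz_ge0.
have copb : coprime b q.
  move: cop; rewrite -!/(coprimez _ q%:Z) => cop.
  rewrite -[b]/(absz b%:Z) bE -[X in coprime _ X]/(absz q%:Z) -coprimezE.
  rewrite /coprimez gcdz_modl -/(coprimez _ _) coprimezE //.
have E : eta (b%:Z ^+ totient q) = 1.
  rewrite -one; apply: (char_mod he).
  have := cyclic.Euler_exp_totient copb => E.
  have -> : b%:Z ^+ totient q = (b ^ totient q)%N%:Z by rewrite -!natz natrX.
  by rewrite -eqz_mod_dvd -[1 : int]/(1%N%:Z) !modz_nat E.
have : cabs (eta a) ^+ totient q = 1.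
  rewrite -cabsX -etaX -[RHS](@cabs1 R) -E !etaX (_ : eta a = eta b%:Z) //.
  apply: (char_mod he); rewrite bE [X in X - _](divz_eq a q) addrK; exact: dvdz_mull.
by move=> /eqP; rewrite pexpr_eq1 ?cabs_ge0 ?totient_gt0 // => /eqP.
Qed.

Lemma legendre_sqr a p : ~~ (p%:Z %| a)%Z -> legendre a p ^+ 2 = 1.
Proof. by rewrite /legendre => /negPf ->; case: ifP. Qed.

Lemma jacobi_sqr a n : coprime (absz a) n -> jacobi a n ^+ 2 = 1.
Proof.
move=> cop; rewrite /jacobi -prodrXl big_seq; apply: big1 => -[p k].
move=> /mem_prime_decomp[pp k0 /= dn].
rewrite exprAC legendre_sqr ?expr1n //; apply/negP; rewrite dvdzE /= => pa.
have pn : (p %| n)%N by apply: dvdn_trans dn; rewrite dvdn_exp.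
have := coprime_dvdr pn (coprime_dvdl pa cop).
by rewrite /coprime gcdnn => /eqP p1; rewrite p1 in pp.
Qed.

Lemma kron_sqr c d : coprimez c d -> kron c d ^+ 2 = 1.
Proof.
rewrite coprimezE => h; rewrite /kron; case: ifP => _; rewrite ?sqrrN; exact: jacobi_sqr.
Qed.

Lemma SL2Z_coprime M : SL2Z M -> coprimez (mc M) (md M).
Proof.
move=> h; apply/coprimezP; exists (- mb M, ma M) => /=.
by rewrite -h /mdet; ring.
Qed.

Lemma cabs_epsd d : cabs (epsd R d) = 1.
Proof.
rewrite /epsd; case: ifP => _; first exact: cabs1.
by rewrite /cabs /= expr0n expr1n add0r sqrtr1.
Qed.

Lemma sqrtc_exp2 (w : R[i]) (n : int) : (sqrtc w ^ n) ^+ 2 = w ^ n.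
Proof.
have E : sqrtc w ^+ 2 = w by exact: sqr_sqrtc.
by rewrite [LHS]exprnP exprz_exp mulrC -exprz_exp -exprnP E.
Qed.

Variables (m : int) (N : nat) (eta : int -> R[i]) (f : R[i] -> R[i]).
Hypotheses (N0 : (0 < N)%N) (he : dirichlet_char (4 * N) eta) (hf : automorphic m N eta f).
Local Notation al := (m%:~R / 2 : R).

Lemma Gamma0_coprime P : Gamma0 (4 * N) P -> coprime (absz (md P)) (4 * N).
Proof.
move=> [hP hc]; have := SL2Z_coprime hP; rewrite coprimezE => h.
rewrite dvdzE /= in hc.
by rewrite coprime_sym; apply: coprime_dvdl hc h.
Qed.

Lemma automorphic_norm P z : Gamma0 (4 * N) P -> upper z ->
  imC (mob P z) `^ al * cabs (f (mob P z)) ^+ 2 = imC z `^ al * cabs (f z) ^+ 2.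
Proof.
move=> hP uz; have [hS _] := hP.
have dP : 0 < mdet P by exact: SL2Z_det.
have -> : cabs (f (mob P z)) ^+ 2 = cabs (jfac P z) ^ m * cabs (f z) ^+ 2.
  rewrite hf // !cabsM !exprMn (char_norm _ he (Gamma0_coprime hP)) ?muln_gt0 //.
  rewrite cabsXz cabs_epsd exp1rz !expr1n !mul1r -(cabsX (sqrtc _ ^ _)) sqrtc_exp2 cabsXz.
  have -> : cabs (zC R (kron (mc P) (md P))) ^+ 2 = 1.
    have := kron_sqr (SL2Z_coprime hS) => k.
    by rewrite -cabsX /zC -rmorphXn /= k cabs1.
  by rewrite mul1r.
have j0 : 0 < cabs (jfac P z) by rewrite cabs_gt0 jfac_neq0 // gt_eqF.
rewrite imC_mob_SL // -powR_intmul ?cabs_ge0 // powRM ?invr_ge0 ?exprn_ge0 ?cabs_ge0 ?(ltW uz) //.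
have -> : (cabs (jfac P z) ^+ 2)^-1 `^ al = (cabs (jfac P z) `^ m%:~R)^-1.
  rewrite -powR_mulrn ?cabs_ge0 // -powRN -powRrM -powRN; congr (_ `^ _).
  by field.
by rewrite -!mulrA mulKf // gt_eqF // powR_gt0.
Qed.

(** The congruence on [d] makes both [eta d] and [epsd d] equal to 1, while squaring kills the sign
    of the symbol and the branch of the root. *)
Lemma automorphic_sqr P z : Gamma0 (4 * N) P -> ((4 * N)%:Z %| md P - 1)%Z -> upper z ->
  f (mob P z) ^+ 2 = jfac P z ^ m * f z ^+ 2.
Proof.
move=> hP hd uz; have [hS _] := hP; rewrite hf // !exprMn sqrtc_exp2.
have [_ _ one _] := he.
rewrite (char_mod he hd) one expr1n mul1r /epsd.
have -> : (md P %% 4)%Z == 1.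
  have : (4 %| md P - 1)%Z by apply: dvdz_trans hd; rewrite PoszM dvdz_mulr.
  by rewrite -eqz_mod_dvd => /eqP ->.
rewrite exp1rz expr1n mul1r /zC -rmorphXn /= (kron_sqr (SL2Z_coprime hS)).
by rewrite mul1r.
Qed.

End Characters.

(** * Conjugation of [Gamma8] and widths of cusps *)

Section Level.
Variable N : nat.
Hypotheses (N0 : (0 < N)%N) (oN : odd N) (sfN : squarefree N).

(** The common features of the identity, [A], [W(2)] and [A W(2)], so that the four kinds of
    elements of B' are treated at once. *)
Definition base_det (M : mat2) : Prop := (mdet M = 1 \/ mdet M = 2) /\ (N%:Z %| mc M)%Z.

Lemma cop8N : coprime 8 N.
Proof. by rewrite -[8%N]/(2 ^ 3)%N coprimeXl // coprime2n. Qed.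

(* Conjugation by [M] of determinant 2 divides the level 8 by 2 *)
Lemma base_conj M g : base_det M -> Gamma8 N g ->
  exists P, Gamma0 (4 * N) P /\ mmul P M = mmul M g.
Proof.
case: M => a b c d; case: g => ga gb gc gd.
move=> [dM Nc] [[hg /dvdzP[p hp] /dvdzP[q hq] /dvdzP[r hr] /dvdzP[s hs]] Ngc].
rewrite /= in Nc Ngc hp hq hr hs.
pose D := a * d - b * c.
(* Writing [g = 1 + 8 h], the conjugate [P] is [1 + e M h adj(M)] with [e = 8 / D] equal to 8 or 4,
   still divisible by 4. *)
have [e De] : exists e : int, e * D = 8 /\ (4 %| e)%Z.
  by move: dM; rewrite /mdet /= -/D => -[->|->]; [exists 8|exists 4].
have [De8 e4] := De.
pose P := Mat2 (1 + e * ((a * p + b * r) * d - (a * q + b * s) * c))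
  (e * (- (a * p + b * r) * b + (a * q + b * s) * a))
  (e * ((c * p + d * r) * d - (c * q + d * s) * c))
  (1 + e * (- (c * p + d * r) * b + (c * q + d * s) * a)).
have gaE : ga = 1 + p * (e * D) by rewrite De8 -hp; ring.
have gdE : gd = 1 + s * (e * D) by rewrite De8 -hs; ring.
have gbE : gb = q * (e * D) by rewrite De8.
have gcE : gc = r * (e * D) by rewrite De8.
have PM : mmul P (Mat2 a b c d) = mmul (Mat2 a b c d) (Mat2 ga gb gc gd).
  by rewrite /mmul /= gaE gdE gbE gcE /D; congr Mat2; ring.
have D0 : D != 0 by move: dM; rewrite /mdet /= -/D => -[->|->].
have detP : mdet P = 1.
  have := congr1 mdet PM; rewrite !mdetM hg mulr1 -[RHS]mul1r.
  by move/(mulIf (D0 : mdet (Mat2 a b c d) != 0)).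
exists P; split => //; split => //.
rewrite /P /= PoszM; have /dvdzP[k ek] := e4.
have -> : e * ((c * p + d * r) * d - (c * q + d * s) * c) =
  4 * (k * ((c * p + d * r) * d - (c * q + d * s) * c)) by rewrite ek; ring.
apply: dvdz_mul; first exact: dvdzz.
apply: dvdz_mull; 
have Nr : (N%:Z %| r)%Z.
  move: Ngc; rewrite hr !dvdzE abszM /= Gauss_dvdl // coprime_sym; exact: cop8N.
by apply: rpredB; [apply: dvdz_mulr; apply: rpredD; [apply: dvdz_mulr|apply: dvdz_mull]|apply: dvdz_mull].
Qed.

Definition width (c : int) : nat := (8 * (N %/ gcdn N `|c|))%N.

Lemma width_gt0 c : (0 < width c)%N.
Proof. by rewrite /width muln_gt0 /= divn_gt0 ?gcdn_gt0 ?N0 // dvdn_leq ?dvdn_gcdl. Qed.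

Lemma width_dvd c : (N%:Z %| (width c)%:Z * c)%Z.
Proof.
rewrite dvdzE abszM /= /width -mulnA; apply: dvdn_mull.
rewrite -{1}(divnK (dvdn_gcdl N `|c|)); apply: dvdn_mul => //; exact: dvdn_gcdr.
Qed.

(** The conjugate of the translation by [W] under [s] is [1 + (W / D) h], where [h] has rows
    [(-a c, a^2)] and [(-c^2, a c)]. The factor 8 in [W] leaves a factor 4 after division by [D],
    and [N] divides [W c]. *)
Lemma width_shift M s0 : base_det M -> SL2Z s0 ->
  let s := mmul M s0 in exists P, [/\ Gamma0 (4 * N) P, ((4 * N)%:Z %| md P - 1)%Z
    & mmul P s = mmul s (transl (width (mc s0))%:Z)].
Proof.
case: M => a' b' c' d'; case: s0 => a0 b0 c0 d0 [dM Nc] h0.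
set W := (width _)%:Z; set s := mmul _ _ => /=.
have dS : mdet s = 1 \/ mdet s = 2 by rewrite mdetM h0 mulr1.
have hNW : (N%:Z %| W * mc s)%Z.
  rewrite /s /= mulrDr; apply: rpredD.
    by apply: dvdz_mull; apply: dvdz_mulr.
  by rewrite mulrCA; apply: dvdz_mull; exact: width_dvd.
have h8W : (8 %| W)%Z by rewrite dvdzE /= dvdn_mulr.
case: s dS hNW => a b c d dS /= hNW.
pose D := a * d - b * c.
have /dvdzP[k hk] := h8W.
have [e [De8 /dvdzP[e' he']]] : exists e : int, e * D = 8 /\ (4 %| e)%Z.
  by move: dS; rewrite /mdet /= -/D => -[->|->]; [exists 8|exists 4].
have Nkc : (N%:Z %| k * c)%Z.
  move: hNW; rewrite hk mulrAC !dvdzE (abszM (k * c)) /= Gauss_dvdl // coprime_sym; exact: cop8N.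
pose P := Mat2 (1 - e * (k * c) * a) (e * k * a ^+ 2) (- (e * (k * c) * c)) (1 + e * (k * c) * a).
have PM : mmul P (Mat2 a b c d) = mmul (Mat2 a b c d) (transl W).
  have WE : W = k * (e * D) by rewrite De8.
  by rewrite /mmul /= WE /D; congr Mat2; ring.
have D0 : D != 0 by move: dS; rewrite /mdet /= -/D => -[->|->].
have detP : mdet P = 1.
  have := congr1 mdet PM; rewrite !mdetM SL2Z_transl mulr1 -[RHS]mul1r.
  by move/(mulIf (D0 : mdet (Mat2 a b c d) != 0)).
have dd x : ((4 * N)%N%:Z %| e * (k * c) * x)%Z.
  apply: dvdz_mulr; rewrite PoszM he'; apply: dvdz_mul => //; exact: dvdz_mull.
exists P; split => //; first by split => //=; rewrite rpredN.
by rewrite /P /= addrC addKr.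
Qed.

(** The conjugated translation has entries built from [a c], [a^2], [c^2] times [k - k']. From
    [u a + v c = 1], squared, follows [8 | k - k']; and [N | (k - k') c^2] gives divisibility by
    [N / gcd(N, c)], which is prime to [c] as [N] is squarefree. *)
Lemma width_inj s0 (k k' : int) : SL2Z s0 ->
  Gamma8 N (mmul (mmul s0 (transl k)) (minv (mmul s0 (transl k')))) ->
  ((width (mc s0))%:Z %| k - k')%Z.
Proof.
case: s0 => a b c d h0 [[_ h1 h2 h3 h4] h5].
move: h1 h2 h3 h5; rewrite /=.
set X1 := _ - 1; set X2 := (_ + _); set X3 := (_ + _).
have E1 : X1 = - ((k - k') * (a * c)) + ((a * d - b * c) - 1) by rewrite /X1; ring.
have E2 : X2 = (k - k') * (a * a) by rewrite /X2; ring.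
have E3 : X3 = - ((k - k') * (c * c)) by rewrite /X3; ring.
have := h0; rewrite /SL2Z /mdet /= => hd.
rewrite E1 E2 E3 hd subrr addr0 !rpredN => {E1 E2 E3 X1 X2 X3} h1 h2 h3 h5.
rewrite /width PoszM.
have [u [v uv1]] : exists u v : int, u * a + v * c = 1.
  by exists d, (- b); rewrite -hd; ring.
have d8 : (8 %| k - k')%Z.
  have -> : k - k' = u * u * ((k - k') * (a * a)) + 2 * u * v * ((k - k') * (a * c))
      + v * v * ((k - k') * (c * c)).
    transitivity ((k - k') * (u * a + v * c) ^+ 2); last by ring.
    by rewrite uv1 expr1n mulr1.
  by apply: rpredD; [apply: rpredD|]; exact: dvdz_mull.
have g0 : (0 < gcdn N `|c|)%N by rewrite gcdn_gt0 N0.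
have NE : (N = N %/ gcdn N `|c| * gcdn N `|c|)%N by rewrite divnK // dvdn_gcdl.
set N' := (N %/ _)%N in NE *.
have N'N : (N' %| N)%N by rewrite NE dvdn_mulr.
have copN : coprime N' `|c|.
  have N'0 : (0 < N')%N by rewrite divn_gt0 // dvdn_leq ?dvdn_gcdl.
  rewrite /coprime; case: (ltngtP (gcdn N' `|c|) 1) => // h.
    by have : (0 < gcdn N' `|c|)%N by [rewrite gcdn_gt0 N'0|]; lia.
  have pp := pdiv_prime h; set p := pdiv _ in pp.
  have : (p %| gcdn N' `|c|)%N by exact: pdiv_dvd.
  rewrite dvdn_gcd => /andP[pN' pc].
  have pg : (p %| gcdn N `|c|)%N by rewrite dvdn_gcd pc andbT NE dvdn_mulr.
  by have := sfN pp; rewrite NE -mulnn dvdn_mul.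
have dN : (N'%:Z %| k - k')%Z.
  have : (N'%:Z %| (k - k') * (c * c))%Z by apply: dvdz_trans h5; rewrite dvdzE.
  by rewrite !dvdzE !abszM /= Gauss_dvdl // coprimeMr copN.
rewrite dvdzE /= Gauss_dvd; last by apply: coprime_dvdr N'N cop8N.
by move: d8 dN; rewrite !dvdzE /= => -> ->.
Qed.

Lemma width_eq s0 (k k' : nat) : SL2Z s0 -> (k < width (mc s0))%N -> (k' < width (mc s0))%N ->
  Gamma8 N (mmul (mmul s0 (transl k%:Z)) (minv (mmul s0 (transl k'%:Z)))) -> k = k'.
Proof.
move=> h0 kW k'W /(width_inj h0); rewrite -eqz_mod_dvd !modz_nat !modn_small //.
by move=> /eqP[].
Qed.

End Level.

(** * The point where the supremum is approached *)

Section Bounded.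
Variable R : realType.
Implicit Types (z w : R[i]).

Lemma powR_between (x y0 y1 b : R) : 0 < y0 -> y0 <= x -> x <= y1 ->
  x `^ b <= y0 `^ b + y1 `^ b.
Proof.
move=> h0 h1 h2; have hx : 0 < x by exact: lt_le_trans h1.
have hy : 0 < y1 by exact: lt_le_trans h2.
have [b0|b0] := leP 0 b.
  apply: (@le_trans _ _ (y1 `^ b)); last by rewrite lerDr powR_ge0.
  by rewrite !powR_exp // ler_expR ler_wpM2l // ler_ln ?posrE.
apply: (@le_trans _ _ (y0 `^ b)); last by rewrite lerDl powR_ge0.
by rewrite !powR_exp // ler_expR ler_wnM2l ?(ltW b0) // ler_ln ?posrE.
Qed.

Lemma powR_quarter_sqr (m : int) (y t : R) :
  (y `^ (m%:~R / 4) * t) ^+ 2 = y `^ (m%:~R / 2) * t ^+ 2.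
Proof.
rewrite exprMn; congr (_ * _); rewrite -powR_mulrn ?powR_ge0 // -powRrM; congr (_ `^ _).
by field.
Qed.

Variables (m : int) (N : nat) (eta : int -> R[i]) (f : R[i] -> R[i]) (a : nat -> R[i]).
Hypotheses (N0 : (0 < N)%N) (he : dirichlet_char (4 * N) eta).
Hypotheses (hf : cusp_form m N eta f) (ha : fourier_exp a f).
Local Notation al := (m%:~R / 2 : R).
Local Notation F z := (imC z `^ al * cabs (f z) ^+ 2).

(** High in the strip the cusp condition bounds [F] by 1. Elsewhere [s w] has height between two
    positive constants, where the [q]-expansion is bounded. *)
Lemma strip_bounded s : SL2Z s -> exists A : R, 0 <= A /\
  forall w, strip w -> F (mob s w) <= A.
Proof.
move=> hs; have [_ _ cusp] := hf; have [Y hY] := cusp s hs 1 ltr01.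
pose Y' := `|Y| + 1; have Y'Y : Y <= Y' by rewrite /Y' (le_trans (ler_norm Y)) // lerDl.
have Y'1 : 1 <= Y' by rewrite /Y' lerDr.
pose cc : R := `|(mc s)%:~R|; pose dd : R := `|(md s)%:~R|.
have cc0 : 0 <= cc by exact: normr_ge0.
have dd0 : 0 <= dd by exact: normr_ge0.
pose J := cc * (1 + Y') + dd + 1; have J1 : 1 <= J by rewrite /J lerDr addr_ge0 // mulr_ge0 //; lra.
pose y0 := 1 / 2 / J ^+ 2; pose y1 := Y' + 2.
have J20 : 0 < J ^+ 2 by rewrite exprn_gt0 //; lra.
have y00 : 0 < y0 by rewrite divr_gt0 //; lra.
have [A [A0 hA]] := qseries_bdd ha y00.
exists (1 + (y0 `^ al + y1 `^ al) * A ^+ 2); split.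
  by rewrite addr_ge0 // mulr_ge0 ?addr_ge0 ?powR_ge0 ?exprn_ge0.
move=> w [x0 x1 hy]; have uw : upper w by rewrite /upper; lra.
have uw' := upper_mob (SL2Z_det hs) uw.
have r0 : 0 <= (y0 `^ al + y1 `^ al) * A ^+ 2.
  by rewrite mulr_ge0 ?addr_ge0 ?powR_ge0 ?exprn_ge0.
have [hYw|hYw] := ltP Y (imC w).
  have h := hY w uw hYw; rewrite -powR_quarter_sqr.
  apply: (@le_trans _ _ 1); last by rewrite lerDl.
  by rewrite exprn_ile1 ?mulr_ge0 ?powR_ge0 ?cabs_ge0 ?(ltW h).
have yY : imC w <= Y' by lra.
have j0 : 0 < cabs (jfac s w) by rewrite cabs_gt0 jfac_neq0 // hs.
have jJ : cabs (jfac s w) <= J.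
  apply: le_trans (cabsD _ _) _; rewrite cabsM !cabs_zC -/cc -/dd.
  have : cabs w <= 1 + Y'.
    by apply: le_trans (cabs_le w) _; rewrite !ger0_norm //; lra.
  move=> /(ler_wpM2l cc0); rewrite /J; lra.
have h0 : y0 <= imC (mob s w).
  rewrite imC_mob_SL // /y0; apply: ler_pM => //; rewrite ?invr_ge0 ?exprn_ge0 //; try lra.
  rewrite lef_pV2 ?posrE ?exprn_gt0 //; last by lra.
  by rewrite lerXn2r ?nnegrE ?cabs_ge0 //; lra.
have h1 : imC (mob s w) <= y1.
  apply: le_trans (imC_orbit_le hs uw) _; rewrite /y1.
  have : (imC w)^-1 <= 2.
    by rewrite -[2]invrK lef_pV2 ?posrE //; lra.
  lra.
apply: (@le_trans _ _ ((y0 `^ al + y1 `^ al) * A ^+ 2)); last by rewrite lerDr.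
apply: ler_pM; rewrite ?powR_ge0 ?exprn_ge0 ?cabs_ge0 //; first exact: powR_between.
by rewrite lerXn2r ?nnegrE ?cabs_ge0 ?hA.
Qed.

(** Modulo [4 N] only finitely many matrices have to be considered, and [F] is unchanged by the
    principal subgroup; the sum of the finitely many bounds dominates each of them. *)
Lemma form_bounded : exists B : R, forall z, upper z -> F z <= B.
Proof.
have L1 : (1 < 4 * N)%N by lia.
have [_ haut _] := hf.
have ex (x : Zmat (4 * N)) : exists A : R, 0 <= A /\ forall M, SL2Z M -> red (4 * N) M = x ->
    forall w, strip w -> F (mob M w) <= A.
  have [[s [hs sx]]|no] := pselect (exists s, SL2Z s /\ red (4 * N) s = x); last first.
    by exists 0; split=> // M hM Mx; case: no; exists M.
  have [A [A0 hA]] := strip_bounded hs; exists A; split=> // M hM Mx w hw.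
  have uw : upper w by case: hw => _ _; rewrite /upper; lra.
  have [K hK ->] := red_surj_eq L1 hM hs (etrans Mx (esym sx)).
  have [hK1 _ _ hKc _] := hK.
  rewrite mobM_SL // (automorphic_norm N0 he haut) //; first exact: hA.
  by apply: upper_mob => //; exact: SL2Z_det.
have [A hA] := choice ex; exists (\sum_x A x) => z uz.
have [M [hM hw]] := strip_cover uz.
have hi := SL2Z_minv hM.
have -> : z = mob (minv M) (mob M z) by rewrite -mobM_SL // minvK // mob_id.
rewrite (bigD1 (red (4 * N) (minv M))) //=.
apply: (@le_trans _ _ (A (red (4 * N) (minv M)))).
  by have [_ h] := hA (red (4 * N) (minv M)); apply: h.
by rewrite lerDl sumr_ge0 // => x _; case: (hA x).
Qed.

End Bounded.

(** * A disc around a near maximum, with constants uniform in the level *)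

Section Core.
Variable R : realType.
Implicit Types (z w u : R[i]).

(** [minv] is the adjugate: for determinant 2 the product is a scalar matrix, which still acts
    trivially. *)
Lemma mob_minv M z : 0 < mdet M -> upper z -> upper (mob (minv M) z) /\ mob M (mob (minv M) z) = z.
Proof.
move=> dM uz; have di : mdet (minv M) = mdet M by case: M {dM} => a b c d; rewrite /mdet /=; ring.
split; first by apply: upper_mob => //; rewrite di.
rewrite -mobM ?di // ?gt_eqF //.
have -> : mmul M (minv M) = Mat2 (mdet M) 0 0 (mdet M).
  by case: M {dM di} => a b c d; rewrite /mmul /mdet /=; congr Mat2; ring.
have z0 : zC R (mdet M) != 0 by rewrite -cabs_gt0 cabs_zC normr_gt0 intr_eq0 gt_eqF.
by rewrite /mob /jfac /= {2 3}/zC mul0r addr0 add0r mulrAC divff // mul1r.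
Qed.

(** [B] is the supremum for [f] itself, hence also after [M], which acts bijectively. A point above
    [19/20 B] is moved into the strip by some [g], and [s0] is the inverse of [g]. The Lipschitz
    clause serves the measurability of [F^2]. *)
Lemma near_maximum (m : int) : odd (absz m) -> exists c C3 : R, [/\ 0 < c, c <= 1 / 8, 1 <= C3 &
  forall (N : nat) eta (f : R[i] -> R[i]) a M, (0 < N)%N -> odd N -> dirichlet_char (4 * N) eta ->
  cusp_form m N eta f -> fourier_exp a f -> base_det N M ->
  exists B : R, [/\ 0 <= B,
    (forall z, upper z -> imC (mob M z) `^ (m%:~R / 2) * cabs (f (mob M z)) ^+ 2 <= B),
    (exists K : R, 0 <= K /\ forall z u, upper z -> cabs u <= imC z / 8 ->
       cabs (slashed m f M (z + u) - slashed m f M z) <= K * (cabs u / imC z) * imC z `^ (- (m%:~R / 2)))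
    & 0 < B -> exists s0 w, [/\ SL2Z s0, strip w, imC w < C3 * (width N (mc s0))%:R &
      forall u, cabs u <= c * imC w ->
        B / 4 <= imC (mob M (mob s0 (w + u))) `^ (m%:~R / 2) * cabs (f (mob M (mob s0 (w + u)))) ^+ 2]]].
Proof.
move=> om; have [K1 [K10 hK1]] := exprz_near1 R (- m).
have [K2 [K20 hK2]] := exprz_near1 R (- m - 1).
pose al : R := m%:~R / 2.
have hal : 1 / 2 <= `|al|.
  rewrite /al normrM (ger0_norm (_ : 0 <= 2^-1)) // ler_pdivrMr // mulfVK //.
  rewrite -intr_norm ler1z; lia.
pose C2 := (K1 + 20 * (`|m%:~R| + 1 + K2) + 210 * (1 + `|m%:~R| + K1)) * 2 `^ `|al|.
have C20 : 0 <= C2.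
  rewrite mulr_ge0 ?powR_ge0 //; have := normr_ge0 (m%:~R : R); lra.
have [c [c0 c8 hc]] := near_max_box al C20.
have [C3 [C316 hC3]] := cusp_small C20 hal.
exists c, C3; split=> //; first by lra.
move=> N eta f a M N0 oN he hf ha hM.
have [holf autf _] := hf.
have dM : 0 < mdet M by case: hM => -[->|->].
have dR : 0 < (mdet M)%:~R :> R by rewrite ltr0z.
have [B1 hB1] := form_bounded N0 he hf ha.
pose S := [set imC z `^ al * cabs (f z) ^+ 2 | z in [set z : R[i] | upper z]]%classic.
have ui : upper (ci R) by rewrite /upper /=.
have supS : has_sup S.
  split; first by exists (imC (ci R) `^ al * cabs (f (ci R)) ^+ 2), (ci R).
  by exists B1 => _ [z uz <-]; exact: hB1.
pose B := sup S.
have hB z : upper z -> imC z `^ al * cabs (f z) ^+ 2 <= B.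
  by move=> uz; apply: (ub_le_sup supS.2); exists z.
have B0 : 0 <= B by apply: le_trans (hB _ ui); rewrite mulr_ge0 ?powR_ge0 ?exprn_ge0 ?cabs_ge0.
have apf z (r : R) : 0 <= r -> r < imC z -> poly_approx r (fun u => f (z + u)).
  by move=> r0 rz; exact: (qseries_approx ha).
pose B' := B * (mdet M)%:~R `^ (- al).
have B'0 : 0 <= B' by rewrite mulr_ge0 ?powR_ge0.
have tameS s : mdet s = mdet M -> tame al C2 B' (slashed m f s).
  move=> Es; have ds : 0 < mdet s by rewrite Es.
  split=> w uw; first by rewrite /B' -Es; exact: (slashed_le hB).
  have [h1 H] := slashed_taylor B0 holf apf hB K10 K20 hK1 hK2 ds uw.
  exists h1 => u hu; apply: le_trans (H u hu) _.
  by rewrite Es.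
exists B; split => //.
- by move=> z uz; apply: hB; exact: upper_mob.
- pose L := 8 * 2 `^ `|al| + 8 + C2.
  have L0 : 0 <= L by rewrite /L; have := powR_ge0 (2 : R) `|al|; lra.
  exists (L * B'); split; first exact: mulr_ge0.
  move=> z u uz hu; have := tame_lipschitz C20 B'0 (tameS M erefl) uz hu.
  by move=> h; apply: le_trans h _; apply: eqW; rewrite -/L -/al; ring.
move=> Bp; have B'p : 0 < B' by rewrite mulr_gt0 ?powR_gt0.
have [_ [z1 /= uz1 <-] hz1] : exists2 x, S x & 19 / 20 * B < x.
  have e0 : 0 < B / 20 by lra.
  have [x Sx hx] := sup_adherent e0 supS; exists x => //; move: hx; rewrite -/B; lra.
have [uz2 Ez2] := mob_minv dM uz1; set z2 := mob (minv M) z1 in uz2 Ez2.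
have [g [hg hw]] := strip_cover uz2.
pose s0 := minv g; have h0 : SL2Z s0 by exact: SL2Z_minv.
pose w := mob g z2; have uw : upper w by apply: upper_mob => //; exact: SL2Z_det.
have Ez : mob M (mob s0 w) = z1 by rewrite /w -(mobM_SL h0 hg uz2) minvK // mob_id.
pose s := mmul M s0; have ds : mdet s = mdet M by rewrite mdetM h0 mulr1.
have dsp : 0 < mdet s by rewrite ds.
have msE x : upper x -> mob s x = mob M (mob s0 x).
  by move=> ux; rewrite /s mobM ?gt_eqF //; exact: SL2Z_det.
have normS x : upper x -> imC x `^ al * cabs (slashed m f s x) =
    (mdet M)%:~R `^ (- al) * (imC (mob M (mob s0 x)) `^ al * cabs (f (mob M (mob s0 x))) ^+ 2).
  move=> ux; rewrite -msE // -slashed_norm // ds powRN mulKf // gt_eqF // powR_gt0 //.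
have hw2 : 19 / 20 * B' <= imC w `^ al * cabs (slashed m f s w).
  rewrite normS // Ez; apply: le_trans (ler_wpM2l (powR_ge0 _ _) (ltW hz1)).
  by apply: eqW; rewrite /B'; ring.
pose W := width N (mc s0).
have W0 : 0 < (W%:R : R) by rewrite ltr0n width_gt0.
have per x : upper x -> slashed m f s (x + rC W%:R) = slashed m f s x.
  move=> ux; have [P [hP hPd PE]] := width_shift oN hM h0.
  have [hP1 _] := hP.
  have dP : 0 < mdet P by exact: SL2Z_det.
  have dT : 0 < mdet (transl W%:Z) by rewrite SL2Z_transl.
  have Ex : x + rC W%:R = mob (transl W%:Z) x by rewrite mob_transl -rC_intr.
  have usx : upper (mob s x) by exact: upper_mob.
  have e1 : mob s (x + rC W%:R) = mob P (mob s x).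
    by rewrite Ex -mobM ?gt_eqF // -PE mobM ?gt_eqF.
  have e2 : jfac s (x + rC W%:R) = jfac P (mob s x) * jfac s x.
    rewrite -(jfacM P) ?gt_eqF // PE jfacM ?gt_eqF // -Ex.
    have -> : jfac (transl W%:Z) x = 1 by rewrite /jfac /transl /= /zC mul0r add0r.
    by rewrite mulr1.
  (* The factor [j_P^m] from modularity cancels the [j_P^(-m)] from the cocycle relation. *)
  rewrite /slashed e1 e2 (automorphic_sqr he autf) // expfzMl mulrACA -expfzDr.
    by rewrite subrr expr0z mul1r.
  by apply: jfac_neq0 => //; rewrite gt_eqF.
exists s0, w; split=> //.
  (* At height [C3 W] or above, [cusp_small] would allow at most [9/10 B'], against [19/20 B'] at
     [w], and [B' > 0]. *)
  rewrite ltNge; apply/negP => hle.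
  have := hC3 B' W%:R (slashed m f s) B'0 W0 (tameS s ds) per w uw hle.
  lra.
move=> u hu; have := hc B' (slashed m f s) w B'0 (tameS s ds) uw hw2 u hu.
have uwu : upper (w + u).
  have y0 : 0 < imC w by exact: uw.
  rewrite /upper imCD; have := imC_le u; rewrite ler_norml => /andP[k1 k2].
  have : c * imC w <= 1 / 8 * imC w by rewrite ler_wpM2r // ltW.
  lra.
rewrite normS // /B' mulrAC [X in X <= _]mulrC ler_pM2l ?powR_gt0 //.
Qed.

Lemma mdet_AW_eq (N : nat) : mdet (matA N) = 1.
Proof. by rewrite /mdet /=; ring. Qed.

Lemma slash_norm (m : int) M (f g : R[i] -> R[i]) z : 0 < mdet M -> slash_of m M f g -> upper z ->
  imC z `^ (m%:~R / 2) * cabs (g z) ^+ 2 =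
  imC (mob M z) `^ (m%:~R / 2) * cabs (f (mob M z)) ^+ 2.
Proof.
move=> dM [v [v1 hv]] uz; rewrite -slashed_norm //.
have -> : cabs (g z) = (mdet M)%:~R `^ (m%:~R / 4) * cabs (sqrtc (jfac M z) ^ (- m) * f (mob M z)).
  by rewrite hv // -mulrA cabsM (cabsM v) v1 mul1r cabs_rC (ger0_norm (powR_ge0 _ _)).
rewrite powR_quarter_sqr mulrCA; congr (_ * (_ * _)).
by rewrite -cabsX exprMn sqrtc_exp2 /slashed mulrC.
Qed.

Lemma in_B'_norm (m : int) (N : nat) al be ga de (g : R[i] -> R[i]) :
  mdet (matW N al be ga de) = 2 -> in_B' m N (matW N al be ga de) g ->
  exists eta f a M, [/\ dirichlet_char (4 * N) eta, cusp_form m N eta f, fourier_exp a f, base_det N M &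
    forall z, upper z -> imC z `^ (m%:~R / 2) * cabs (g z) ^+ 2 =
      imC (mob M z) `^ (m%:~R / 2) * cabs (f (mob M z)) ^+ 2].
Proof.
move=> dW [f [[eta [he [bs [[hbs _ _] fbs]]]] hg]].
have [hf [a [ha _]]] := hbs f fbs.
have dvW : (N%:Z %| mc (matW N al be ga de))%Z.
  by rewrite /= -mulrA mulrCA dvdz_mulr.
have dvA : (N%:Z %| mc (matA N))%Z by rewrite /= dvdz_mull.
exists eta, f, a; case: hg => hg.
- exists mid; split=> //; first by split; [left|].
  by move=> z uz; rewrite mob_id hg.
- exists (matA N); split=> //; first by split; [left; exact: mdet_AW_eq|].
  by move=> z uz; apply: slash_norm => //; rewrite mdet_AW_eq.
- exists (matW N al be ga de); split=> //; first by split; [right|].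
  by move=> z uz; apply: slash_norm => //; rewrite dW.
have dAW : mdet (mmul (matA N) (matW N al be ga de)) = 2 by rewrite mdetM mdet_AW_eq dW.
exists (mmul (matA N) (matW N al be ga de)); split=> //.
  split; first by right.
  rewrite /= mul1r; apply: rpredD => //.
  by apply: dvdz_mulr; exact: dvdz_mull.
by move=> z uz; apply: slash_norm => //; rewrite dAW.
Qed.

End Core.

(** * Measurability and null sets *)

Section PlaneMeasure.
Local Open Scope classical_set_scope.
Local Open Scope ring_scope.
Variable R : realType.
Local Notation T := (measurableTypeR R).
Local Notation leb := (@lebesgue_measure R).
Local Notation lam := (leb \x leb)%E.
Implicit Types (q p : R * R) (M : mat2).

Lemma countable_union_measurable (I : countType) (S : I -> set (T * T)) :
  (forall i, measurable (S i)) -> measurable [set q | exists i, S i q].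
Proof.
move=> mS; rewrite (_ : [set q | _] =
  \bigcup_n (if @pickle_inv I n is Some i then S i else set0)).
  by apply: bigcupT_measurable => n; case: pickle_inv.
apply/seteqP; split => [q [i Sq]|q [n _]]; first by exists (pickle i) => //; rewrite pickleK_inv.
by case: pickle_inv => // i Sq; exists i.
Qed.

Lemma countable_union_negligible (I : countType) (S : I -> set (T * T)) :
  (forall i, lam.-negligible (S i)) -> lam.-negligible [set q | exists i, S i q].
Proof.
move=> mS; rewrite (_ : [set q | _] =
  \bigcup_n (if @pickle_inv I n is Some i then S i else set0)).
  by apply: negligible_bigcup => n; case: pickle_inv => [i|]; [exact: mS|exact: negligible_set0].
apply/seteqP; split => [q [i Sq]|q [n _]]; first by exists (pickle i) => //; rewrite pickleK_inv.
by case: pickle_inv => // i Sq; exists i.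
Qed.

Lemma dist3 (x a y t r : R) : `|x - a| < t -> `|y - a| < t -> 2 * t < r -> `|x - y| < r.
Proof. by rewrite !ltr_norml => /andP[? ?] /andP[? ?] ?; apply/andP; split; lra. Qed.

Lemma measurable_square (a b r : R) : measurable [set q : T * T | `|q.1 - a| < r /\ `|q.2 - b| < r].
Proof.
rewrite (_ : [set q : T * T | _] = `]a - r, a + r[%classic `*` `]b - r, b + r[%classic).
  by apply: measurableX; exact: measurable_itv.
by apply/seteqP; split => q /=; rewrite !in_itv /= -!ltr_distl.
Qed.

(** The open squares with rational centre and radius [1 / (n + 1)] contained in [U] are countably
    many and cover it. *)
Lemma locally_square_measurable (U : set (T * T)) :
  (forall q, U q -> exists r : R, 0 < r /\ forall q' : R * R,
     `|q'.1 - q.1| < r -> `|q'.2 - q.2| < r -> U q') -> measurable U.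
Proof.
move=> hU.
pose sq (i : rat * rat * nat) : set (T * T) :=
  [set q | `|q.1 - ratr i.1.1| < (i.2.+1%:R : R)^-1 /\ `|q.2 - ratr i.1.2| < (i.2.+1%:R : R)^-1].
pose S i : set (T * T) := if `[< sq i `<=` U >] then sq i else set0.
rewrite (_ : U = [set q | exists i, S i q]).
  apply: countable_union_measurable => i; rewrite /S; case: ifP => // _.
  exact: measurable_square.
apply/seteqP; split => q; last first.
  by move=> [j]; rewrite /S; case: ifP => [/asboolP h|//]; exact: h.
move=> Uq; have [r [r0 hr]] := hU q Uq.
pose n := Num.truncn (2 / r); have n0 : 0 < (n.+1%:R : R)^-1 by rewrite invr_gt0.
have nr : 2 * (n.+1%:R : R)^-1 < r.
  have /andP[_ h] := Num.Theory.truncn_itv (divr_ge0 (ler0n R 2) (ltW r0)).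
  by rewrite ltr_pdivrMr // in h; rewrite ltr_pdivrMr // mulrC.
have [a /itvP ha] : exists a : rat, ratr a \in `]q.1 - (n.+1%:R : R)^-1, q.1 + (n.+1%:R : R)^-1[.
  by apply: rat_in_itvoo; rewrite ltrD2l (lt_trans _ n0) // oppr_lt0.
have [b /itvP hb] : exists a : rat, ratr a \in `]q.2 - (n.+1%:R : R)^-1, q.2 + (n.+1%:R : R)^-1[.
  by apply: rat_in_itvoo; rewrite ltrD2l (lt_trans _ n0) // oppr_lt0.
have ka1 : q.1 - n.+1%:R^-1 < ratr a by rewrite ha.
have ka2 : ratr a < q.1 + n.+1%:R^-1 by rewrite ha.
have kb1 : q.2 - n.+1%:R^-1 < ratr b by rewrite hb.
have kb2 : ratr b < q.2 + n.+1%:R^-1 by rewrite hb.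
have sU : sq (a, b, n) `<=` U.
  by move=> q' [/= h1 h2]; apply: hr; [apply: (dist3 h1)|apply: (dist3 h2)] => //;
    rewrite ltr_distlC; apply/andP.
exists (a, b, n); rewrite /S asboolT //=; split => /=.
  by rewrite ltr_distlC; apply/andP.
by rewrite ltr_distlC; apply/andP.
Qed.

Definition upper_half : set (T * T) := [set p | 0 < p.2].

Lemma upper_half_measurable : measurable upper_half.
Proof.
rewrite (_ : upper_half = setT `*` `]0%R, +oo[%classic).
  by apply: measurableX => //; exact: measurable_itv.
by apply/seteqP; split => p; rewrite /upper_half /= in_itv /= andbT; [by move=> ?; split|by case].
Qed.

(** The local Lipschitz bound makes the sets where [|h| > t] open. *)
Lemma lipschitz_measurable (h : R[i] -> R[i]) (K be : R) : 0 <= K ->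
  (forall z u, upper z -> cabs u <= imC z / 8 ->
     cabs (h (z + u) - h z) <= K * (cabs u / imC z) * imC z `^ be) ->
  measurable_fun upper_half ((fun p => cabs (h (toC p))) : T * T -> T).
Proof.
move=> K0 hL; apply: (measurability _ (@RGenOInfty.measurableE R)) => // _ [_ [t ->] <-].
apply: locally_square_measurable => p [/= p0 ht].
rewrite in_itv /= andbT in ht.
pose y := p.2; pose g := cabs (h (toC p)) - t; have g0 : 0 < g by rewrite /g; lra.
pose Q := K / y * y `^ be; have Q0 : 0 <= Q by rewrite mulr_ge0 ?powR_ge0 // divr_ge0 // ltW.
pose r := Num.min (y / 16) (g / (4 * (Q + 1))).
have r0 : 0 < r by rewrite lt_min !divr_gt0 //; lra.
have r1 : r <= y / 16 by rewrite ge_min lexx.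
have r2 : r <= g / (4 * (Q + 1)) by rewrite ge_min lexx orbT.
exists r; split=> // p' h1 h2.
pose u : R[i] := Complex (p'.1 - p.1) (p'.2 - p.2).
have hu : cabs u < 2 * r by apply: le_lt_trans (cabs_le u) _; rewrite /=; lra.
have Ep : toC p' = toC p + u by apply: complex_eq; rewrite ?reCD ?imCD /= addrC subrK.
have uu : cabs u <= imC (toC p) / 8 by rewrite /= -/y; lra.
have := hL (toC p) u p0 uu; rewrite -Ep /= -/y => H.
split; first by move: h2; rewrite ltr_norml -/y => /andP[]; rewrite /upper_half /=; have : 0 < y := p0; lra.
rewrite /= in_itv /= andbT.
have H' : cabs (h (toC p') - h (toC p)) <= Q * cabs u.
  by apply: le_trans H _; apply: eqW; rewrite /Q; ring.
have := cabs_ler (h (toC p)) (h (toC p')); rewrite cabsB => k.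
have Qu : Q * cabs u <= Q * (2 * r) by rewrite ler_wpM2l // ltW.
rewrite ler_pdivlMr in r2; last by lra.
have : 2 * (Q * r) <= g / 2 by nra.
rewrite /g; lra.
Qed.

Lemma powR_im_measurable (b : R) : measurable_fun upper_half ((fun p => p.2 `^ b) : T * T -> T).
Proof.
apply: (eq_measurable_fun ((fun p => expR (b * ln p.2)) : T * T -> T)).
  by move=> p; rewrite inE => p0; rewrite powR_exp.
apply: measurable_funTS.
apply: (@measurableT_comp _ _ _ _ _ _ (expR : T -> T)); first exact: measurable_expR.
apply: measurable_funM => //.
exact: (measurableT_comp (@measurable_ln R) measurable_snd).
Qed.

Lemma horo_preimage_measurable (A : set (T * T)) : measurable A -> measurable (@horo R @^-1` A : set (T * T)).
Proof. by move=> mA; rewrite -[X in measurable X]setTI; exact: horo_measurable. Qed.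

Lemma horo_negligible (Z : set (T * T)) : lam.-negligible Z -> lam.-negligible (@horo R @^-1` Z : set (T * T)).
Proof.
move=> [A [mA A0 ZA]].
pose A' := A `&` upper_half.
have mA' : measurable A' by apply: measurableI => //; exact: upper_half_measurable.
exists (@horo R @^-1` A'); split; first exact: horo_preimage_measurable.
  rewrite -hyp_area //; last by move=> p [].
  have A'0 : lam A' = 0%E by apply/eqP; rewrite -measure_le0 -A0 le_measure ?inE //; exact: subIsetl.
  apply: null_set_integral => //; apply: (eq_measurable_fun (@hypden R)).
    by move=> p; rewrite inE => -[_ p0]; rewrite /hypden invposE // /pos_ind p0 mulr1 exprVn.
  by apply: measurable_funTS; exact: hypden_measurable.
by move=> q Zq; split; [exact: ZA|exact: horo_upper].
Qed.

Lemma tau_negligible M (Z : set (T * T)) : SL2Z M -> lam.-negligible Z ->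
  lam.-negligible (@tau R M @^-1` Z : set (T * T)).
Proof.
move=> hM [A [mA A0 ZA]]; have [_ pt] := tau_area R hM.
exists (@tau R M @^-1` A); split; last by move=> q; exact: ZA.
  exact: tau_preimage_measurable.
by rewrite pt.
Qed.

(** This is the vertical line [x = r] in the coordinates [(v, Y)]; each section at fixed [v] is one
    point. *)
Lemma line_negligible (r : R) : lam.-negligible [set q : T * T | q.2 * expR (- q.1) = r].
Proof.
pose A : set (T * T) := [set q | q.2 * expR (- q.1) = r].
have mA : measurable A.
  rewrite (_ : A = @horo R @^-1` ([set r] `*` setT)).
    by apply: horo_preimage_measurable; apply: measurableX => //; exact: measurable_set1.
  by apply/seteqP; split => q; rewrite /A /=; [by move=> ?; split|by case].
exists A; split=> //; rewrite lam_xsection; apply: integral0_eq => v _.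
rewrite (_ : xsection A v = [set r * expR v]); first exact: lebesgue_measure_set1.
apply/seteqP; split => Y /=; rewrite /xsection /= inE /A /=.
  by move=> <-; rewrite -mulrA -expRD addNr expR0 mulr1.
by move=> ->; rewrite -mulrA -expRD subrr expR0 mulr1.
Qed.

(** The imaginary part of [a z + b = z (c z + d)] puts the fixed points on the line
    [Re z = (a - d) / (2 c)]; for [c = 0] only plus and minus the identity fix a point. *)
Lemma fixed_negligible M : SL2Z M -> M <> mid -> M <> Mat2 (-1) 0 0 (-1) ->
  lam.-negligible [set q : T * T | tau M q = q].
Proof.
move=> hM n1 n2; have [c0|c0] := eqVneq (mc M) 0.
  rewrite (_ : [set q : T * T | _] = set0); first exact: negligible_set0.
  apply/seteqP; split => // q /= E; have := congr1 (@hpt R) E.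
  rewrite hpt_tau ?hM // => Ez.
  have ad : ma M * md M = 1 by move: hM; rewrite /SL2Z /mdet c0 mulr0 subr0.
  have amd : ma M = md M /\ (ma M = 1 \/ ma M = -1).
    have : `|md M|%N = 1%N.
      have /eqP := congr1 absz ad; rewrite abszM muln_eq1 => /andP[_ /eqP]; exact.
    move=> h; have [h'|h'] : md M = 1 \/ md M = -1 by lia.
    by rewrite h' in ad *; lia.
    by rewrite h' in ad *; lia.
  have [ea e1] := amd.
  have d0 : zC R (md M) != 0.
    by rewrite -cabs_gt0 cabs_zC normr_gt0 intr_eq0; apply/eqP => h; rewrite h mulr0 in ad.
  have b0 : zC R (mb M) = 0.
    move: Ez; rewrite /mob /jfac c0 {2}/zC mul0r add0r => /(congr1 (fun x => x * zC R (md M))).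
    rewrite divfK // ea mulrC => /eqP; rewrite -subr_eq0 addrAC subrr add0r => /eqP; exact.
  have mb0 : mb M = 0.
    by apply/eqP; rewrite -(intr_eq0 R) -normr_eq0 -cabs_zC b0 cabs0.
  case: M hM n1 n2 c0 ad amd ea e1 d0 b0 mb0 E Ez => a b c d /=.
  move=> _ n1 n2 c0 _ _ ea e1 _ _ b0 _ _; rewrite c0 b0 -ea in n1 n2.
  by case: e1 => e; rewrite e in n1 n2; [case: n1|case: n2].
apply: negligibleS (line_negligible ((ma M - md M)%:~R / (2 * (mc M)%:~R))).
move=> q /= E; have := congr1 (@hpt R) E; rewrite hpt_tau ?hM //.
have j0 : jfac M (hpt q) != 0 by apply: jfac_neq0; [rewrite hM|exact: hpt_upper].
move=> Ez; have {Ez} := congr1 (fun x => imC (x * jfac M (hpt q))) Ez.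
rewrite /mob divfK // imCD !imCM !zCE jfac_re jfac_im /= mul0r !addr0.
have y0 : 0 < expR (- q.1) by exact: expR_gt0.
set y := expR _ in y0 *; set x := q.2 * y => h.
have cn : (mc M)%:~R != 0 :> R by rewrite intr_eq0.
have h' : y * ((ma M)%:~R - (2 * ((mc M)%:~R * x) + (md M)%:~R)) = 0 :> R.
  by rewrite mulrBr [y * (ma M)%:~R]mulrC h; ring.
move/eqP: h'; rewrite mulf_eq0 (gt_eqF y0) /= subr_eq0 => /eqP h'.
by rewrite rmorphB /= h' addrK mulrA mulrAC divff ?mul1r // mulf_neq0.
Qed.

Definition qstrip : set (T * T) := [set q | strip (hpt q)].

Lemma qstrip_measurable : measurable qstrip.
Proof.
rewrite (_ : qstrip = @horo R @^-1` (`[0%R, 1%R[%classic `*` `]1/2, +oo[%classic)).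
  by apply: horo_preimage_measurable; apply: measurableX; exact: measurable_itv.
apply/seteqP; split => q; rewrite /qstrip /strip /= !in_itv /= andbT.
  by move=> [-> -> ->].
by move=> [/andP[-> ->] ->].
Qed.

Lemma qstrip_area : lam qstrip = 2%:E.
Proof.
(* After [v -> -v] the height is [e^v], the section at [v > - ln 2] has length [e^(-v)], and the
   area is an exponential integral over a right half-line. *)
have [_ pr] := @reflect_y_area R (fun _ => 0) (measurable_cst _).
rewrite -(pr _ qstrip_measurable) lam_xsection.
rewrite (_ : (fun x => _) = ((fun v : R => (expR (- v))%:E) \_ `](- ln 2)%R, +oo[)); last first.
  apply/funext => v; rewrite patchE; case: ifPn => hv.
    move: hv; rewrite inE /= in_itv /= andbT => hv.
    rewrite (_ : xsection _ v = `[0, expR (- v)[%classic).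
      by rewrite lebesgue_measure_itv /= lte_fin expR_gt0 -EFinB subr0.
    have ev : 1 / 2 < expR v by rewrite div1r -ltf_pV2 ?posrE ?invr_gt0 ?expR_gt0 // invrK -expRN -[ltRHS]lnK ?posrE // ltr_expR; lra.
    apply/seteqP; split => Y; rewrite /xsection /= inE /= /qstrip /strip /= in_itv /= sub0r opprK.
      by move=> [h1 h2 _]; rewrite -(pmulr_lge0 _ (expR_gt0 v)) h1 expRN -[ltRHS]div1r ltr_pdivlMr ?expR_gt0.
    move=> /andP[h1 h2]; split=> //; first by rewrite mulr_ge0 // expR_ge0.
    by rewrite expRN -[ltRHS]div1r ltr_pdivlMr ?expR_gt0 // in h2.
  move: hv; rewrite notin_setE /= in_itv /= andbT => /negP; rewrite -leNgt => hv.
  rewrite (_ : xsection _ v = set0) ?measure0 //.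
  apply/seteqP; split => Y //; rewrite /xsection /= inE /= /qstrip /strip /= sub0r opprK.
  move=> [_ _]; apply/negP; rewrite -leNgt div1r -[leRHS]lnK ?posrE ?invr_gt0 // lnV ?posrE //.
  by rewrite ler_expR.
rewrite -integral_mkcond /= integral_itv_obnd_cbnd; last first.
  apply/measurable_EFinP; apply: measurable_funTS.
  by apply: (@measurableT_comp _ _ _ _ _ _ (expR : T -> T)); [exact: measurable_expR|exact: oppr_measurable].
have dE (x : R) : is_derive x 1 (fun v : R => - expR (- v)) (expR (- x)).
  by apply: is_derive_eq; rewrite /GRing.scale /= ?mulrN ?mulr1 ?opprK.
have cE (x : R) : {for x, continuous (fun v : R => - expR (- v))}.
  by apply: differentiable_continuous; apply/derivable1_diffP; have [] := dE x.
rewrite (@ge0_continuous_FTC2y R (fun v => expR (- v)) (fun v => - expR (- v)) _ 0).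
- by rewrite opprK lnK ?posrE // -EFinB sub0r opprK.
- by move=> x _; exact: expR_ge0.
- apply: continuous_subspaceT => x.
  by apply: continuous_comp; [exact: opp_continuous|exact: continuous_expR].
- rewrite -oppr0; apply: cvgN; exact: cvgr_expR.
- by move=> x _; have [] := dE x.
- exact: cvg_at_right_filter (cE _).
- by move=> x _; rewrite derive1E; exact: derive_val.
Qed.

Lemma orbit_count_measurable (E : set (T * T)) : measurable E ->
  measurable_fun [set: T * T] (orbit_count E : T * T -> \bar R).
Proof.
move=> mE; apply: (@ge0_emeasurable_sum _ _ _ _ _ xpredT) => [n q _ _|n _].
  by rewrite lee_fin.
exact: (hit_measurable (phi := id)).
Qed.

Lemma orbit_count_inv_measurable (E : set (T * T)) : measurable E ->
  measurable_fun [set: T * T] (orbit_count_inv E : T * T -> \bar R).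
Proof.
move=> mE; apply: (@ge0_emeasurable_sum _ _ _ _ _ xpredT) => [n q _ _|n _].
  by rewrite lee_fin.
by apply: (hit_measurable (phi := minv)) => // M; exact: SL2Z_minv.
Qed.

Lemma orbit_count_ge0 (E : set (T * T)) q : (0 <= orbit_count E q)%E.
Proof. by apply: nneseries_ge0 => n _ _; rewrite lee_fin. Qed.

Lemma orbit_count_inv_ge0 (E : set (T * T)) q : (0 <= orbit_count_inv E q)%E.
Proof. by apply: nneseries_ge0 => n _ _; rewrite lee_fin. Qed.

Lemma strip_fold_le q : (orbit_count_inv qstrip q <= 9%:E)%E.
Proof.
apply: countE_le => s us hs; rewrite ler_nat; apply: (@strip_mult R (hpt q)) => //.
  exact: hpt_upper.
move=> t /hs[ht]; rewrite /qstrip /= hpt_tau //; exact: (SL2Z_det (SL2Z_minv ht)).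
Qed.

Lemma strip_fold_ge q : (1 <= orbit_count_inv qstrip q)%E.
Proof.
have [M [hM hs]] := strip_cover (hpt_upper q).
have hi := SL2Z_minv hM.
have := @countE_ge _ R (fun t : mcode => SL2Z (dec t) /\ qstrip (tau (minv (dec t)) q))
  [:: enc (minv M)]; apply => //.
move=> t; rewrite inE => /eqP ->; rewrite encK; split=> //.
have mm : minv (minv M) = M by case: M {hM hs hi} => a b c d; rewrite /minv /= !opprK.
by rewrite mm /qstrip /= hpt_tau // hM.
Qed.

Lemma unfold_upper (E : set (T * T)) : measurable E ->
  (\int[lam]_(q in qstrip) orbit_count E q <= 9%:E * lam E)%E.
Proof.
move=> mE; rewrite (unfolding qstrip_measurable mE) -integral_cst //.
apply: ge0_le_integral => //.
- by move=> q _; exact: orbit_count_inv_ge0.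
- by apply: measurable_funTS; apply: orbit_count_inv_measurable; exact: qstrip_measurable.
- by move=> q _; exact: strip_fold_le.
Qed.

Lemma unfold_lower (E : set (T * T)) : measurable E ->
  (lam E <= \int[lam]_(q in qstrip) orbit_count E q)%E.
Proof.
move=> mE; rewrite (unfolding qstrip_measurable mE) -[leLHS]mul1e -integral_cst //.
apply: ge0_le_integral => //.
- by apply: measurable_funTS; apply: orbit_count_inv_measurable; exact: qstrip_measurable.
- by move=> q _; exact: strip_fold_ge.
Qed.

Definition box (x y c : R) : set (T * T) :=
  [set q | x <= reC (hpt q) <= x + c * y /\ y <= imC (hpt q) <= y * (1 + c)].

Lemma box_measurable x y c : measurable (box x y c).
Proof.
rewrite (_ : box x y c = @horo R @^-1` (`[x, x + c * y]%classic `*` `[y, y * (1 + c)]%classic)).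
  by apply: horo_preimage_measurable; apply: measurableX; exact: measurable_itv.
by apply/seteqP; split => q; rewrite /box /= !in_itv /=.
Qed.

(** After translation by [x] the box contains a rectangle in [(v, Y)] with sides [ln (1 + c)] and
    [c / (1 + c)]; the latter is small enough even at the top height [y (1 + c)]. The bound does not
    depend on [y]. *)
Lemma box_area (x y c : R) : 0 < y -> 0 < c ->
  ((ln (1 + c) * (c / (1 + c)))%:E <= lam (box x y c))%E.
Proof.
move=> y0 c0; have [ms ps] := @shear_area R x; rewrite -(ps _ (box_measurable x y c)).
pose A : set (T * T) := `[- ln (y * (1 + c)), - ln y]%classic `*` `[0%R, c / (1 + c)]%classic.
have c1 : 0 < 1 + c by lra.
have cc0 : 0 < c / (1 + c) by rewrite divr_gt0.
have ly : - ln (y * (1 + c)) < - ln y.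
  rewrite ltrN2 ltr_ln ?posrE ?mulr_gt0 //; rewrite ltr_pMr //; lra.
have <- : lam A = (ln (1 + c) * (c / (1 + c)))%:E.
  rewrite product_measure1E; [|exact: measurable_itv|exact: measurable_itv].
  have l1 : leb `[- ln (y * (1 + c)), - ln y]%classic = (ln (1 + c))%:E.
    by rewrite lebesgue_measure_itv /= lte_fin ly -EFinB lnM ?posrE // opprK addKr.
  have l2 : leb `[0, c / (1 + c)]%classic = (c / (1 + c))%:E.
    by rewrite lebesgue_measure_itv /= lte_fin cc0 -EFinB subr0.
  by rewrite EFinM; congr (_ * _)%E; [exact: l1|exact: l2].
apply: le_measure; rewrite ?inE.
- by apply: measurableX; exact: measurable_itv.
- by rewrite -[X in measurable X]setTI; apply: ms => //; exact: box_measurable.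
move=> q [/=]; rewrite !in_itv /= => /andP[v1 v2] /andP[Y1 Y2].
rewrite /preimage /box /mkset hpt_shear reCD imCD /= addr0.
have e1 : y <= expR (- q.1) by rewrite -[leLHS]lnK ?posrE // ler_expR; lra.
have e2 : expR (- q.1) <= y * (1 + c).
  by rewrite -[leRHS]lnK ?posrE ?mulr_gt0 // ler_expR; lra.
have e0 := expR_gt0 (- q.1).
split; last by rewrite e1 e2.
have : 0 <= q.2 * expR (- q.1) by rewrite mulr_ge0 // ltW.
have : q.2 * expR (- q.1) <= c / (1 + c) * (y * (1 + c)) by rewrite ler_pM // ltW.
rewrite (_ : c / (1 + c) * (y * (1 + c)) = c * y); last by field; lra.
by move=> ? ?; apply/andP; split; lra.
Qed.

End PlaneMeasure.

(** * Comparison of areas *)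

Section FundamentalDomain.
Local Open Scope classical_set_scope.
Local Open Scope ring_scope.
Variable R : realType.
Local Notation T := (measurableTypeR R).
Local Notation leb := (@lebesgue_measure R).
Local Notation lam := (leb \x leb)%E.
Implicit Types (q p : R * R) (M : mat2).
Variables (L : nat) (G : mat2 -> Prop) (D : set (T * T)).
Hypotheses (L1 : (1 < L)%N) (hG : level_subgroup L G) (hD : fund_domain G D).

Definition qdom : set (T * T) := @horo R @^-1` D.

Lemma qdom_measurable : measurable qdom.
Proof. by apply: horo_preimage_measurable; case: hD. Qed.

Lemma minvV M : minv (minv M) = M.
Proof. by case: M => a b c d; rewrite /minv /= !opprK. Qed.

(* the 2 is the order of the generic stabilizer {1, -1} *)
Lemma ae_fiber_le2 : {ae lam, forall q M s, SL2Z M -> uniq s ->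
  (forall t, t \in s -> SL2Z (dec t) /\ qdom (tau (dec t) q) /\ G (mmul (dec t) (minv M))) ->
  (size s <= 2)%N}.
Proof.
have [sG _ mG iG _] := hG; have [mD D0 cD nD] := hD.
set Bd := [set p | _] in nD.
(* [Z1] is the union of all translates of the overlaps of the domain, [Z2] the set of points with an
   extra stabilizer. Outside [Z1] two elements of one fibre move [q] to the same point; outside [Z2]
   they then differ by a sign. *)
pose Z1 := [set q : T * T | exists t : mcode, (if `[< SL2Z (dec t) >] then
   (@tau R (dec t)) @^-1` (@horo R @^-1` Bd) else set0) q].
pose Z2 := [set q : T * T | exists t : mcode,
  (if `[< [/\ SL2Z (dec t), dec t <> mid & dec t <> Mat2 (-1) 0 0 (-1)] >] then
   [set q : T * T | tau (dec t) q = q] else set0) q].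
have n1 : lam.-negligible Z1.
  apply: countable_union_negligible => t; case: ifPn => [/asboolP ht|_]; last exact: negligible_set0.
  by apply: tau_negligible => //; exact: horo_negligible.
have n2 : lam.-negligible Z2.
  apply: countable_union_negligible => t; case: ifPn => [/asboolP[h1 h2 h3]|_]; last exact: negligible_set0.
  exact: fixed_negligible.
apply: negligibleS (negligibleU n1 n2) => q nP; apply: contrapT => nZ; apply: nP => M s hM us hs.
case: s us hs => [|t0 s0] // us hs; set s := t0 :: s0 in us hs *.
have [h0 [D0' G0]] := hs t0 (mem_head _ _).
pose mm : mat2 := Mat2 (-1) 0 0 (-1).
rewrite -[2%N]/(size [:: t0; enc (mmul (dec t0) mm)]); apply: uniq_leq_size => // t ts.
have [ht [Dt Gt]] := hs t ts.
pose g := mmul (dec t) (minv (dec t0)).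
have Gg : G g.
  have -> : g = mmul (mmul (dec t) (minv M)) (minv (mmul (dec t0) (minv M))).
    by rewrite minv_mul minvV /g -mmulA (mmulA (minv M)) minvK // mmul1m.
  by apply: mG => //; exact: iG.
have hg := sG _ Gg.
pose p0 := horo (tau (dec t0) q).
have Eg : mob g (toC p0) = hpt (tau (dec t) q).
  rewrite -/(hpt _) !hpt_tau ?ht ?h0 // -mobM_SL //; last exact: hpt_upper.
  by rewrite /g -mmulA minvK // mmulm1.
have Ep : mob g (toC p0) = toC p0.
  apply: contrapT => ne; apply: nZ; left; exists t0; rewrite asboolT //=.
  by split => //; exists g; split => //; split => //; rewrite Eg ofC_toC.
have Eq : tau (dec t) q = tau (dec t0) q by apply: hpt_inj; rewrite -Eg Ep.
pose r := mmul (minv (dec t0)) (dec t).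
have hr : SL2Z r by apply: SL2Z_mul => //; exact: SL2Z_minv.
have Er : tau r q = q.
  rewrite tauM ?Eq ?tauVK //; last by rewrite ht.
  exact: (SL2Z_det (SL2Z_minv h0)).
have tE : dec t = mmul (dec t0) r by rewrite /r mmulA minvKr // mmul1m.
rewrite !inE; have [r1|r1] := pselect (r = mid).
  by have -> : t = t0 by [rewrite -(decK t) tE r1 mmulm1 decK]; rewrite eqxx.
have [r2|r2] := pselect (r = mm).
  by have <- : t = enc (mmul (dec t0) mm) by [rewrite -(decK t) tE r2]; rewrite eqxx orbT.
case: nZ; right; exists (enc r); rewrite encK asboolT //.
Qed.

(** The 4 is the generic stabilizer of order 2 times the area 2 of the strip. *)
Lemma qdom_area_le :
  (lam qdom <= ((4 * #|img L SL2Z|)%:R / (#|img L G|)%:R)%:E)%E.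
Proof.
have e0 : (0 < #|img L G|)%N by exact: img_gt0.
have eR : 0 < (#|img L G|)%:R :> R by rewrite ltr0n.
apply: le_trans (unfold_lower qdom_measurable) _.
pose k : R := (2 * #|img L SL2Z|)%:R / (#|img L G|)%:R.
have -> : (((4 * #|img L SL2Z|)%:R / (#|img L G|)%:R)%:E = k%:E * lam (@qstrip R))%E.
  by rewrite qstrip_area -EFinM; congr (_%:E); rewrite /k !natrM; ring.
rewrite -integral_cst; last exact: qstrip_measurable.
have k0 : 0 <= k by rewrite divr_ge0.
apply: ae_ge0_le_integral => //; first exact: qstrip_measurable.
- by move=> q _; exact: orbit_count_ge0.
- by apply: measurable_funTS; apply: orbit_count_measurable; exact: qdom_measurable.
apply: negligibleS ae_fiber_le2 => q nP H; apply: nP => _.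
apply: countE_le => s us hs; rewrite ler_pdivlMr // mulrC -natrM ler_nat.
by apply: (@orbit_count_upper L L1 G (fun M => qdom (tau M q))) => // M s' hM us' hs'; apply: (H M s').
Qed.

(** [A] is cut along the unit strips number [0, ..., W - 1]. The slices belong to distinct cosets of
    [Gp], so all of them contribute, each weighted by [#|img Gp| / #|img G|]. *)
Lemma mass_lower (Gp : mat2 -> Prop) (X A : set (T * T)) (s0 : mat2) (W : nat) :
  level_subgroup L Gp -> measurable X -> SL2Z s0 ->
  (forall M q, G M \/ Gp M -> X q -> X (tau M q)) ->
  (forall k k' : nat, (k < W)%N -> (k' < W)%N ->
     Gp (mmul (mmul s0 (transl k%:Z)) (minv (mmul s0 (transl k'%:Z)))) -> k = k') ->
  measurable A -> (forall q, A q -> X (tau s0 q)) ->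
  (forall q, A q -> exists2 k : nat, (k < W)%N & strip (hpt q - zC R k%:Z)) ->
  (((#|img L Gp|)%:R)%:E * lam A <= ((9 * #|img L G|)%:R)%:E * lam (qdom `&` X))%E.
Proof.
move=> hGp mX h0 hX inj mA AX Astrip.
have [sG _ mG iG _] := hG; have [mD D0 cD nD] := hD; have [sP _ _ _ _] := hGp.
set e := #|img L G|; set e' := #|img L Gp|.
have e0 : (0 < e)%N by exact: img_gt0.
have eR : 0 < e%:R :> R by rewrite ltr0n.
pose E := qdom `&` X.
have mE : measurable E by apply: measurableI => //; exact: qdom_measurable.
have hT k : SL2Z (mmul s0 (transl k)) by apply: SL2Z_mul => //; exact: SL2Z_transl.
pose Ak (k : nat) : set (T * T) := @tau R (mmul s0 (transl k%:Z)) @^-1` X.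
have mAk k : measurable (Ak k) by exact: tau_preimage_measurable.
pose c : R := e'%:R / e%:R; have c0 : 0 <= c by rewrite divr_ge0.
(* The coset count is applied pointwise, to those [k] for which [s0] after the translation by [k]
   carries [q] into [X]. *)
have fiber q : ((\sum_(k < W) (c%:E * (\1_(Ak k) q)%:E)) <= orbit_count E q)%E.
  pose ks : seq nat := [seq k <- iota 0 W | `[< Ak k q >]].
  pose kz : seq int := [seq k%:Z | k : nat <- ks].
  have [s [us hs le]] : exists s : seq mcode, [/\ uniq s,
      (forall t, t \in s -> SL2Z (dec t) /\ E (tau (dec t) q)) & (e' * size kz <= e * size s)%N].
    apply: (@orbit_count_lower L L1 G (fun M => E (tau M q)) hG Gp (fun M => X (tau M q)) s0 kz) => //.
    - by rewrite map_inj_uniq ?filter_uniq ?iota_uniq // => a b [].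
    - move=> M M' hM hM' XM; have hM1 : SL2Z M by case: hM => [/sG|/sP].
      by rewrite tauM ?hM1 ?hM' //; apply: hX.
    - move=> M hM XM; have [g [Gg Dg]] := cD (horo (tau M q)) (horo_upper _).
      have hg := sG _ Gg; exists g => //; rewrite tauM ?hg ?hM //; split; last by apply: hX => //; left.
      by move: Dg; rewrite -/(hpt _) -hpt_tau ?hg // ofC_toC.
    - by move=> _ /mapP[k kk ->]; move: kk; rewrite mem_filter => /andP[/asboolP].
    move=> _ _ /mapP[k kk ->] /mapP[k' kk' ->] h; congr (_%:Z); apply: inj => //.
      by move: kk; rewrite mem_filter mem_iota => /andP[_].
    by move: kk'; rewrite mem_filter mem_iota => /andP[_].
  apply: le_trans (countE_ge R us hs); rewrite size_map in le.
  rewrite -ge0_sume_distrr; last by move=> i _; rewrite lee_fin.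
  rewrite sumEFin -EFinM lee_fin.
  have -> : \sum_(k < W) \1_(Ak k) q = (size ks)%:R :> R.
    rewrite size_filter -sum1_count big_mkcond /= natr_sum -(big_mkord xpredT (fun k => \1_(Ak k) q)) /index_iota subn0.
    rewrite [RHS]big_mkcond /=; apply: eq_bigr => k _; rewrite indicE.
    case: asboolP => h; first by rewrite mem_set.
    by rewrite memNset.
  by rewrite /c mulrAC ler_pdivrMr // -!natrM ler_nat (mulnC (size s)).
have int : (\sum_(k < W) (c%:E * lam (Ak k `&` @qstrip R)) <= 9%:E * lam E)%E.
  apply: le_trans (unfold_upper mE).
  have mq := @qstrip_measurable R.
  have mI k : measurable_fun (@qstrip R) ((fun q => (\1_(Ak k) q)%:E) : T * T -> \bar R).
    by apply/measurable_EFinP; apply: measurable_funTS; exact: measurable_indic.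
  have mcI k : measurable_fun (@qstrip R) ((fun q => (c%:E * (\1_(Ak k) q)%:E)%E) : T * T -> \bar R).
    exact: measurable_funeM.
  have cI0 k q : (0 <= c%:E * (\1_(Ak k) q)%:E)%E by rewrite mule_ge0 ?lee_fin.
  apply: (@le_trans _ _ (\int[lam]_(q in @qstrip R) (\sum_(k < W) (c%:E * (\1_(Ak k) q)%:E)))%E).
    rewrite ge0_integral_sum //; apply: lee_sum => k _; rewrite ge0_integralZl //.
    by rewrite integral_indic.
  apply: ge0_le_integral => //.
  - by move=> q _; apply: sume_ge0 => k _.
  - exact: emeasurable_sum.
  - by apply: measurable_funTS; apply: orbit_count_measurable.
(* Translating the slice in the standard strip by [k] puts it where [A] lies; together these sets
   cover [A]. *)
pose Bk (k : nat) : set (T * T) := (@tau R s0 @^-1` X) `&` (@tau R (minv (transl k%:Z)) @^-1` @qstrip R).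
have mBk k : measurable (Bk k).
  apply: measurableI; apply: tau_preimage_measurable => //; last exact: qstrip_measurable.
  exact: (SL2Z_minv (SL2Z_transl k%:Z)).
have slice k : lam (Ak k `&` @qstrip R) = lam (Bk k).
  have [_ pt] := tau_area R (SL2Z_transl k%:Z); rewrite -(pt _ (mBk k)); congr (lam _).
  have tM q : tau (mmul s0 (transl k%:Z)) q = tau s0 (tau (transl k%:Z) q).
    by apply: tauM; rewrite ?h0 ?SL2Z_transl.
  have tV q : tau (minv (transl k%:Z)) (tau (transl k%:Z) q) = q.
    by apply: tauVK; exact: SL2Z_transl.
  by apply/seteqP; split => q; rewrite /Ak /Bk /setI /preimage /mkset tM tV.
have cover : (lam A <= \sum_(k < W) lam (Bk k))%E.
  apply: le_trans (Boole_inequality _ _) => [|k _]; last exact: mBk.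
  apply: le_measure; rewrite ?inE //; first exact: bigsetU_measurable.
  move=> q Aq; have [k kW hs] := Astrip q Aq; rewrite -bigcup_mkord; exists k => //.
  split; first exact: AX.
  rewrite /qstrip /= hpt_tau ?(SL2Z_minv (SL2Z_transl _)) //.
  have -> : minv (transl k%:Z) = transl (- k%:Z) by rewrite /minv /transl /= oppr0.
  by rewrite mob_transl zCN.
have : (c%:E * lam A <= 9%:E * lam E)%E.
  apply: le_trans int; under eq_bigr do rewrite slice.
  rewrite -ge0_sume_distrr; last by move=> k _; exact: measure_ge0.
  by apply: lee_wpmul2l => //; rewrite lee_fin.
move=> /(lee_wpmul2l (x := e%:R%:E)) => /(_ (ler0n _ _)).
rewrite !muleA -!EFinM /c mulrCA divff ?gt_eqF // mulr1 -natrM mulnC; exact.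
Qed.

End FundamentalDomain.

Section WeightedArea.
Local Open Scope classical_set_scope.
Local Open Scope ring_scope.
Variable R : realType.
Local Notation T := (measurableTypeR R).
Local Notation leb := (@lebesgue_measure R).
Local Notation lam := (leb \x leb)%E.
Variables (D : set (T * T)) (phi : R * R -> R) (B : R).
Hypotheses (mD : measurable D) (D0 : forall p, D p -> 0 < p.2).
Hypothesis mphi : measurable_fun (@upper_half R) (phi : T * T -> T).
Hypothesis phi0B : forall p, 0 < p.2 -> 0 <= phi p <= B.

Lemma inv_sqr_measurable : measurable_fun (@upper_half R) ((fun p => p.2 ^- 2) : T * T -> T).
Proof.
apply: (eq_measurable_fun ((fun p => invpos p.2 ^+ 2) : T * T -> T)).
  by move=> p; rewrite inE => p0; rewrite invposE // exprVn.
apply: measurable_funTS; apply: measurable_funX.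
exact: (measurableT_comp (@invpos_measurable R) measurable_snd).
Qed.

Definition superlevel (t : R) : set (T * T) := [set p | 0 < p.2 /\ t <= phi p].

Lemma superlevel_measurable t : measurable (superlevel t).
Proof.
rewrite (_ : superlevel t = @upper_half R `&` phi @^-1` `[t, +oo[%classic).
  exact: (mphi (@upper_half_measurable R) (measurable_itv `[t, +oo[)).
by apply/seteqP; split => p; rewrite /superlevel /upper_half /= in_itv /= andbT.
Qed.

Lemma weighted_measurable (psi : R * R -> R) (A : set (T * T)) :
  measurable_fun (@upper_half R) (psi : T * T -> T) -> A `<=` @upper_half R ->
  measurable_fun A ((fun p => (psi p * p.2 ^- 2)%:E) : T * T -> \bar R).
Proof.
move=> mpsi hA; apply: (measurable_funS (E := @upper_half R)) => //; first exact: upper_half_measurable.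
by apply/measurable_EFinP; apply: measurable_funM => //; exact: inv_sqr_measurable.
Qed.

Lemma scaled_area (k : R) (A : set (T * T)) : 0 <= k -> measurable A -> A `<=` @upper_half R ->
  (\int[lam]_(p in A) (k * p.2 ^- 2)%:E = k%:E * lam (@horo R @^-1` A))%E.
Proof.
move=> k0 mA hA; rewrite -hyp_area // -ge0_integralZl //.
  have := weighted_measurable (measurable_cst (1 : T)) hA.
  by apply: eq_measurable_fun => p _ /=; rewrite mul1r.
by move=> p /hA p0; rewrite lee_fin invr_ge0 exprn_ge0 // ltW.
Qed.

Lemma weighted_le : (\int[lam]_(p in D) (phi p * p.2 ^- 2)%:E <= B%:E * lam (@horo R @^-1` D))%E.
Proof.
have [->|/set0P[p Dp]] := eqVneq D set0.
  by rewrite integral_set0 preimage_set0 measure0 mule0.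
have B0 : 0 <= B by have /andP[h1 h2] := phi0B (D0 Dp); exact: le_trans h2.
rewrite -scaled_area //; apply: ge0_le_integral => //.
- move=> q /D0 q0; have /andP[h _] := phi0B q0.
  by rewrite lee_fin mulr_ge0 // invr_ge0 exprn_ge0 // ltW.
- exact: weighted_measurable.
- exact: (weighted_measurable (psi := cst B)).
move=> q /D0 q0; have /andP[_ h] := phi0B q0.
by rewrite lee_fin ler_wpM2r // invr_ge0 exprn_ge0 // ltW.
Qed.

Lemma weighted_ge (t : R) : 0 <= t ->
  (t%:E * lam (@horo R @^-1` (D `&` superlevel t)) <= \int[lam]_(p in D) (phi p * p.2 ^- 2)%:E)%E.
Proof.
move=> t0; have mS : measurable (D `&` superlevel t) by apply: measurableI => //; exact: superlevel_measurable.
have hS : D `&` superlevel t `<=` @upper_half R by move=> p [/D0].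
rewrite -scaled_area //.
apply: (@le_trans _ _ (\int[lam]_(p in D `&` superlevel t) (phi p * p.2 ^- 2)%:E)%E).
  apply: ge0_le_integral => //.
  - by move=> q /hS q0; rewrite lee_fin mulr_ge0 // invr_ge0 exprn_ge0 // ltW.
  - exact: (weighted_measurable (psi := cst t)).
  - exact: weighted_measurable.
  move=> q [/D0 q0 [_ h]].
  by rewrite lee_fin ler_wpM2r // invr_ge0 exprn_ge0 // ltW.
apply: ge0_subset_integral => //; first exact: weighted_measurable.
move=> q /D0 q0; have /andP[h _] := phi0B q0.
by rewrite lee_fin mulr_ge0 // invr_ge0 exprn_ge0 // ltW.
Qed.

End WeightedArea.

(** * Assembly of the index, area and supremum bounds *)

Section Final.
Local Open Scope classical_set_scope.
Local Open Scope ring_scope.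
Variable R : realType.
Local Notation T := (measurableTypeR R).
Local Notation leb := (@lebesgue_measure R).
Local Notation lam := (leb \x leb)%E.

(** The level [8 N L0] serves [G] and [Gamma8 N] simultaneously. *)
Lemma cong_level N (G : mat2 -> Prop) : (0 < N)%N -> cong_subgroup_of_Gamma0 (2 * N) G ->
  exists L, [/\ (1 < L)%N, (8 %| L)%N, (N %| L)%N & level_subgroup L G].
Proof.
move=> N0 [h1 h2 h3 h4 [L0 [L00 h5]]]; exists (8 * N * L0)%N; split.
- lia.
- by rewrite -mulnA dvdn_mulr.
- by rewrite mulnAC mulnC dvdn_mulr.
split=> // [M /h1[]|M [k1 k2 k3 k4 k5]] //; apply: h5.
have dv : (L0%:Z %| (8 * N * L0)%N%:Z)%Z by rewrite dvdzE /= dvdn_mull.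
by split => //; apply: (dvdz_trans dv).
Qed.

(* [n], [e], [e'] are the sizes of the images of [SL2(Z)], [G] and [Gamma8 N] in a
   common finite quotient, [lE], [lD] the areas of the set where [F^2 >= B / 4] and
   of the fundamental domain, [I] the integral of [F^2] *)
Lemma index_bookkeeping (B delta I lE lD n e e' J : R) :
  0 < e -> 0 < e' -> 0 <= B -> 0 < delta -> 0 <= n -> 0 < J ->
  e' * delta <= 9 * e * lE -> lE <= lD -> lD <= 4 * n / e -> n <= J * e' ->
  B / 4 * lE <= I -> B * delta <= 144 * J * (I / lD).
Proof.
move=> e0 e'0 B0 d0 n0 J0 h1 h2 h3 h4 h5.
have lE0 : 0 < lE.
  have : 0 < e' * delta by rewrite mulr_gt0.
  rewrite ltNge => h; rewrite ltNge; apply: contra h => h.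
  by apply: le_trans h1 _; rewrite mulr_ge0_le0 // mulr_ge0 // ltW.
have lD0 : 0 < lD by exact: lt_le_trans h2.
rewrite mulrA ler_pdivlMr //.
have I0 : 0 <= I by apply: le_trans h5; rewrite mulr_ge0 ?(ltW lE0) // divr_ge0.
have a1 : B * delta * lD <= B * delta * (4 * n / e) by rewrite ler_wpM2l // mulr_ge0 // ltW.
have a2 : B * delta * (4 * n / e) <= B * delta * (4 * (J * e') / e).
  rewrite ler_wpM2l ?mulr_ge0 ?(ltW d0) // ler_wpM2r ?invr_ge0 ?(ltW e0) // ler_wpM2l //.
apply: (le_trans a1); apply: (le_trans a2).
have -> : B * delta * (4 * (J * e') / e) = (4 * J * B / e) * (e' * delta) by ring.
apply: (@le_trans _ _ (4 * J * B / e * (9 * e * lE))).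
  by rewrite ler_wpM2l // divr_ge0 ?mulr_ge0 ?(ltW e0) ?(ltW J0).
(* In [144 = 4 * 9 * 4] the factors come from the area of the domain, the multiplicity of the strip,
   and the threshold [B / 4]. *)
have -> : 4 * J * B / e * (9 * e * lE) = 144 * J * (B / 4 * lE) by field; rewrite gt_eqF.
by rewrite ler_wpM2l // mulr_ge0 // ltW.
Qed.

Lemma sup_norm_bound (m : int) : odd (absz m) -> exists delta : R, 0 < delta /\
  forall N : nat, (0 < N)%N -> odd N -> squarefree N ->
  forall al be ga de : int, mdet (matW N al be ga de) = 2 ->
  forall g : R[i] -> R[i], in_B' m N (matW N al be ga de) g ->
  forall G : mat2 -> Prop, cong_subgroup_of_Gamma0 (2 * N) G ->
  invariant_under m G g ->
  forall D : set (R * R), fund_domain G D ->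
  exists B : R, [/\ 0 <= B,
    (forall z, upper z -> imC z `^ (m%:~R / 2) * cabs (g z) ^+ 2 <= B) &
    B * delta <= 144 * (2 ^+ size (primes N) * N%:R * 8 ^+ 4) * L2normsq m g D].
Proof.
move=> om; have [c0 [C3 [c00 c08 C31 H]]] := near_maximum R om.
(* [c0 / 2] lets horizontal and vertical displacement in the box add up to at most [c0 y];
   [1 / (2 C3)] keeps the horizontal side below [W / 2], as [y < C3 W]. *)
pose c := Num.min (c0 / 2) (1 / (2 * C3)).
have c_gt0 : 0 < c by rewrite lt_min !divr_gt0 //; lra.
have cc0 : c <= c0 / 2 by rewrite ge_min lexx.
have cC3 : c * (2 * C3) <= 1.
  by rewrite -ler_pdivlMr; [rewrite ge_min lexx orbT|lra].
pose delta := ln (1 + c) * (c / (1 + c)).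
have d0 : 0 < delta.
  by rewrite mulr_gt0 ?divr_gt0 ?ln_gt0 //; lra.
exists delta; split=> // N N0 oN sfN al be ga de dW g gB G cG inv D fD.
have [eta [f [a [M0 [he hf ha hM0 gf]]]]] := in_B'_norm dW gB.
have [B [B0 FB [K [K0 lip]] near]] := H N eta f a M0 N0 oN he hf ha hM0.
have dM0 : 0 < mdet M0 by case: hM0 => -[->|->].
pose F z := imC z `^ (m%:~R / 2) * cabs (g z) ^+ 2.
have FE z : upper z -> F z = imC (mob M0 z) `^ (m%:~R / 2) * cabs (f (mob M0 z)) ^+ 2.
  by move=> uz; exact: gf.
have F0 z : 0 <= F z by rewrite mulr_ge0 ?powR_ge0 ?exprn_ge0 ?cabs_ge0.
have FleB z : upper z -> F z <= B by move=> uz; rewrite FE // FB.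
exists B; split=> //.
pose phi (p : R * R) := F (toC p).
have mphi : measurable_fun (@upper_half R) (phi : T * T -> T).
  apply: (eq_measurable_fun ((fun p => (mdet M0)%:~R `^ (m%:~R / 2) *
     (p.2 `^ (m%:~R / 2) * cabs (slashed m f M0 (toC p)))) : T * T -> T)).
    by move=> p; rewrite inE => p0; rewrite /phi FE // -slashed_norm.
  apply: measurable_funM => //; apply: measurable_funM; first exact: powR_im_measurable.
  exact: lipschitz_measurable K0 lip.
have phi0B p : 0 < p.2 -> 0 <= phi p <= B by move=> p0; rewrite /phi F0 FleB.
have [mD D0 _ _] := fD.
set I := (\int[lam]_(p in D) (phi p * p.2 ^- 2)%:E)%E.
have [L [L1 L8 LN hG]] := cong_level N0 cG.
have hGp := Gamma8_level L8 LN.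
have e0 := img_gt0 hG; have e'0 := img_gt0 hGp.
have hle : (I <= B%:E * lam (qdom D))%E := weighted_le mD D0 mphi phi0B.
have B40 : 0 <= B / 4 by rewrite divr_ge0.
have hge := weighted_ge mD D0 mphi phi0B B40.
rewrite -/I in hge.
have area := qdom_area_le L1 hG fD.
pose n := #|img L SL2Z|; pose e := #|img L G|; pose e' := #|img L (Gamma8 N)|.
set X := superlevel phi (B / 4) in hge.
have mX : measurable X by exact: superlevel_measurable.
have mhX := horo_preimage_measurable mX.
(* [fine] sends infinite values to 0, so the inequalities pass to [volD] and [L2normsq] only after
   finiteness is established. *)
have lDfin : lam (qdom D) \is a fin_num.
  by rewrite ge0_fin_numE ?measure_ge0 //; apply: le_lt_trans area _; exact: ltry.
have EI : (@horo R @^-1` (D `&` X)) = qdom D `&` (@horo R @^-1` X) by [].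
have lElD : (lam (qdom D `&` (@horo R @^-1` X)) <= lam (qdom D))%E.
  apply: le_measure; rewrite ?inE; [apply: measurableI => //| |exact: subIsetl];
    exact: qdom_measurable fD.
have lEfin : lam (qdom D `&` (@horo R @^-1` X)) \is a fin_num.
  rewrite ge0_fin_numE ?measure_ge0 //; apply: le_lt_trans lElD _.
  by rewrite -ge0_fin_numE ?measure_ge0.
have I0 : (0 <= I)%E.
  apply: integral_ge0 => p /D0 p0; have p00 : 0 <= p.2 by exact: ltW.
  by rewrite lee_fin mulr_ge0 ?F0 // invr_ge0 exprn_ge0.
have Ifin : I \is a fin_num.
  rewrite ge0_fin_numE //; apply: le_lt_trans hle _.
  by rewrite -(fineK lDfin) -EFinM ltry.
have nE : L2normsq m g D = fine I / fine (lam (qdom D)).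
  rewrite /L2normsq /volD; congr (_ / fine _); exact: hyp_area.
have [B00|Bp] := leP B 0.
  have -> : B = 0 by apply/eqP; rewrite eq_le B00 B0.
  rewrite mul0r nE !mulr_ge0 ?exprn_ge0 ?invr_ge0 ?fine_ge0 ?measure_ge0 //.
have [s0 [w [h0 [x0 x1 y2] yW nearw]]] := near Bp.
set W := width N (mc s0) in yW.
pose x := reC w; pose y := imC w.
have y0 : 0 < y by rewrite /y; lra.
pose A := box x y c; have mA : measurable A by exact: box_measurable.
have hA := box_area x y0 c_gt0; rewrite -/A -/delta in hA.
(* For [G] this is the assumed invariance of [g]; an element of [Gamma8 N] is moved past [M0] by
   conjugation into [Gamma0 (4 N)], under which [f] transforms. *)
have hX M q : G M \/ Gamma8 N M -> (@horo R @^-1` X) q -> (@horo R @^-1` X) (tau M q).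
  move=> hM [_ hq]; split; first exact: horo_upper.
  have hMS : SL2Z M by case: hM => [|[[]]//]; case: hG => + _ _ _ _; apply.
  have uq := hpt_upper q.
  rewrite /phi -/(hpt _) hpt_tau ?hMS //.
  suff -> : F (mob M (hpt q)) = F (hpt q) by [].
  case: hM => hM; first exact: inv.
  have uMq : upper (mob M (hpt q)) by apply: upper_mob => //; rewrite hMS.
  have uM0 : upper (mob M0 (hpt q)) by exact: upper_mob.
  have [P [hP PE]] := base_conj oN hM0 hM.
  have [hPS _] := hP.
  rewrite !FE // -mobM ?gt_eqF ?hMS // -PE mobM ?gt_eqF ?hPS //.
  have [_ autf _] := hf.
  exact: (automorphic_norm N0 he autf).
have AX q : A q -> (@horo R @^-1` X) (tau s0 q).
  move=> [/andP[q1 q2] /andP[q3 q4]]; split; first exact: horo_upper.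
  rewrite /phi -/(hpt _) hpt_tau ?h0 // FE; last by apply: upper_mob; [rewrite h0|exact: hpt_upper].
  have -> : hpt q = w + (hpt q - w) by rewrite addrC subrK.
  apply: nearw; apply: le_trans (cabs_le _) _; rewrite reCD imCD reCN imCN -/x -/y.
  have hcy : c * y <= c0 / 2 * y by rewrite ler_wpM2r // ltW.
  rewrite !ger0_norm ?subr_ge0 //; clear -q1 q2 q3 q4 hcy; lra.
have W8 : 8 <= W%:R :> R.
  by rewrite (ler_nat _ 8) /W /width leq_pmulr // divn_gt0 ?gcdn_gt0 ?N0 // dvdn_leq ?dvdn_gcdl.
(* [x < 1] and [c y <= W / 2], which add up to less than [W] because [W >= 8]. *)
have xW : x + c * y < W%:R.
  have : c * y <= c * (C3 * W%:R) by rewrite ler_wpM2l ?(ltW c_gt0) // ltW.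
  have : c * (2 * C3) * W%:R <= 1 * W%:R by rewrite ler_wpM2r.
  move: x1; rewrite -/x; clear -W8; lra.
have Astrip q : A q -> exists2 k : nat, (k < W)%N & strip (hpt q - zC R k%:Z).
  move=> [/andP[q1 q2] /andP[q3 q4]].
  have r0 : 0 <= reC (hpt q) by apply: le_trans q1.
  have /andP[k1 k2] := Num.Theory.truncn_itv r0.
  exists (Num.truncn (reC (hpt q))).
    by rewrite -(ltr_nat R); apply: le_lt_trans k1 _; exact: le_lt_trans q2 xW.
  rewrite -addn1 natrD in k2.
  rewrite /strip zCE reCD imCD reCN imCN /= subr0 -pmulrn.
  by rewrite /= in k1 k2 q3; rewrite -/y in y2; clear -k1 k2 q3 y2; split; lra.
have low := mass_lower L1 hG fD hGp mhX h0 hX (fun k k' kW k'W => width_eq N0 oN sfN h0 kW k'W) mA AX Astrip.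
have idx := Gamma8_index N0 sfN L1 L8 LN.
rewrite nE; apply: (@index_bookkeeping _ _ _ (fine (lam (qdom D `&` (@horo R @^-1` X)))) _ n%:R e%:R e'%:R) => //.
- by rewrite ltr0n.
- by rewrite ltr0n.
- by rewrite !mulr_gt0 ?exprn_gt0 ?ltr0n.
- rewrite -natrM -lee_fin (EFinM e'%:R) (EFinM (9 * e)%:R) fineK //.
  by apply: le_trans low; apply: lee_wpmul2l => //; rewrite lee_fin.
- by rewrite fine_le.
- rewrite -lee_fin fineK // -natrM; exact: area.
- rewrite -!natrX -!natrM ler_nat; exact: idx.
by rewrite -lee_fin EFinM !fineK // -EI.
Qed.

End Final.

(* kappa = m/2 with m odd; W(2) = matW N al be ga de with det 2. *)
Theorem theorem3p3 (R : realType) (m : int) (eps : R) :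
  odd (absz m) -> 0 < eps ->
  exists K : R, forall N : nat, (0 < N)%N -> odd N -> squarefree N ->
  forall al be ga de : int, mdet (matW N al be ga de) = 2 ->
  forall g : R[i] -> R[i], in_B' m N (matW N al be ga de) g ->
  forall G : mat2 -> Prop, cong_subgroup_of_Gamma0 (2 * N) G ->
  invariant_under m G g ->
  forall D : set (R * R), fund_domain G D ->
  forall z : R[i], upper z ->
    imC z `^ (m%:~R / 4) * cabs (g z)
      <= K * N%:R `^ (1 / 2 + eps) * Num.sqrt (L2normsq m g D).
Proof.
move=> om eps0; have [delta [d0 H]] := sup_norm_bound R om.
(* The inequality is proved after squaring, so the bound for [2^omega(N)] is taken with exponent
   [2 eps]. *)
have e20 : 0 < 2 * eps by lra.
have [C [C0 hC]] := two_pow_omega e20.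
pose Q := 144 * C * 8 ^+ 4 / delta.
have Q0 : 0 < Q by rewrite divr_gt0 // !mulr_gt0 ?exprn_gt0.
exists (Num.sqrt Q) => N N0 oN sfN al be ga de dW g gB G cG inv D fD z uz.
have [B [B0 FB hB]] := H N N0 oN sfN al be ga de dW g gB G cG inv D fD.
have NR : 0 < N%:R :> R by rewrite ltr0n.
set nn := L2normsq m g D in hB *.
have nn0 : 0 <= nn.
  have J0 : 0 < 144 * (2 ^+ size (primes N) * N%:R * 8 ^+ 4) :> R by rewrite !mulr_gt0 ?exprn_gt0.
  by rewrite -(pmulr_rge0 _ J0); apply: le_trans hB; rewrite mulr_ge0 // ltW.
have l0 : 0 <= imC z `^ (m%:~R / 4) * cabs (g z) by rewrite mulr_ge0 ?powR_ge0 ?cabs_ge0.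
have r0 : 0 <= Num.sqrt Q * N%:R `^ (1 / 2 + eps) * Num.sqrt nn.
  by rewrite !mulr_ge0 ?sqrtr_ge0 ?powR_ge0.
rewrite -(ler_pXn2r (n := 2)) ?nnegrE // powR_quarter_sqr.
apply: le_trans (FB z uz) _.
rewrite !exprMn !sqr_sqrtr ?(ltW Q0) //.
have -> : (N%:R `^ (1 / 2 + eps)) ^+ 2 = N%:R * N%:R `^ (2 * eps) :> R.
  have -> : N%:R * N%:R `^ (2 * eps) = N%:R `^ (1 + 2 * eps) :> R.
    by rewrite powRD ?powRr1 ?ler0n // (gt_eqF NR) implybT.
  rewrite -powR_mulrn ?powR_ge0 // -powRrM.
  by congr (_ `^ _); field.
rewrite -(ler_pM2r d0); apply: (le_trans hB).
have h := hC N N0.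
have -> : Q * (N%:R * N%:R `^ (2 * eps)) * nn * delta =
  144 * (C * N%:R `^ (2 * eps) * N%:R * 8 ^+ 4) * nn by rewrite /Q; field; rewrite gt_eqF.
rewrite ler_wpM2r // ler_wpM2l // ler_wpM2r ?exprn_ge0 // ler_wpM2r // ltW.
Qed.
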